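(* Let $A\in\mathbb{R}^{m\times n}$ be an arbitrary matrix, let $k\ge1$ be an integer, and let $V_k,\overline{V}_k,\overline{\Sigma}_k$ be given by the partitioned singular value decomposition of $A$ described in the context. Let $L\in\mathbb{R}^{n\times r}$ satisfy $\operatorname{rank}(L^{T}V_k)=k$, and let $Z=ALG\in\mathbb{R}^{m\times\ell}$, where $G\in\mathbb{R}^{r\times\ell}$ is a random matrix whose columns are independent $r$-variate standard Gaussian vectors and $\ell\le\min\{\operatorname{rank}(A),\operatorname{rank}(L)\}\le r$. Let $C=LL^{T}$ and $$\beta_k=\frac{\operatorname{tr}\big(\overline{\Sigma}_k^{T}\overline{\Sigma}_k\overline{V}_k^{T}C\overline{V}_k\big)}{\lambda_1(C)\,\|\overline{\Sigma}_k\|_F^2},\qquad \gamma_k=\frac{k}{\lambda_1(C)\operatorname{tr}\big((V_k^{T}CV_k)^{-1}\big)}.$$ Then, if $\ell\ge k+2$, $$\mathbb{E}\big[\|[I_m-\Pi(Z)]A\|_F\big]\le\Big(1+\sqrt{\ell-k}\,\sqrt{\frac{k}{\ell-k-1}\,\frac{\beta_k}{\gamma_k}}\Big)\|\overline{\Sigma}_k\|_F.$$ Moreover, if $\ell\ge k+4$, then for all real $u,t\ge1$, the inequality $$\|[I_m-\Pi(Z)]A\|_F\le\Big(1+\sqrt3\,\big(\sqrt{\ell-k+1}+1\big)\sqrt{\frac{k}{\ell-k+1}\,\frac{\beta_k}{\gamma_k}}\cdot ut\Big)\|\overline{\Sigma}_k\|_F$$ holds with probability at least $1-e^{-u^2/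2}-t^{-(\ell-k)}$.
   Context: Partitioned SVD: $A=U\Sigma V^{T}$ with $U\in\mathbb{R}^{m\times m}$, $V\in\mathbb{R}^{n\times n}$ orthogonal and $\Sigma\in\mathbb{R}^{m\times n}$ (rectangular) diagonal with diagonal entries the singular values $\sigma_1\ge\dots\ge\sigma_{\min\{m,n\}}\ge 0$. For $k\le\min\{m,n\}$ write $V=[V_k\ \overline{V}_k]$ with $V_k\in\mathbb{R}^{n\times k}$, $\overline{V}_k\in\mathbb{R}^{n\times(n-k)}$, and $\Sigma=\begin{bmatrix}\Sigma_k&\\&\overline{\Sigma}_k\end{bmatrix}$ with $\Sigma_k\in\mathbb{R}^{k\times k}$, $\overline{\Sigma}_k\in\mathbb{R}^{(m-k)\times(n-k)}$. $\lambda_1(\cdot)$ is the largest eigenvalue. $\|\cdot\|_F$ is the Frobenius norm, and $\Pi(M)=MM^{\dagger}$ ($M^\dagger$ the Moore-Penrose inverse) is the orthogonal projection onto the column space of $M$. $I_m$ is the $m\times m$ identity. *)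

(* Defs.v *)
From HB Require Import structures.
From mathcomp Require Import all_boot all_order all_algebra.
From mathcomp Require Import all_classical all_reals all_analysis.

Set Implicit Arguments.
Unset Strict Implicit.
Unset Printing Implicit Defensive.

Import Order.TTheory GRing.Theory Num.Theory.
Import numFieldNormedType.Exports.

Local Open Scope classical_set_scope.
Local Open Scope ring_scope.

(* The norm that 'M[R]_(m, n) carries in normedtype is the max norm. *)
Definition frobenius_norm (R : realType) (m n : nat) (M : 'M[R]_(m, n)) : R :=
  Num.sqrt (\sum_i \sum_j M i j ^+ 2).

(* The eigenvalues form a finite set, so the supremum is a maximum as soon as
   M has a real eigenvalue, e.g. when M is symmetric of positive size. *)
Definition largest_eigenvalue (R : realType) (n : nat) (M : 'M[R]_n) : R :=
  sup [set a : R | eigenvalue M a].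

Definition is_moore_penrose (R : realType) (m n : nat)
    (M : 'M[R]_(m, n)) (X : 'M[R]_(n, m)) : Prop :=
  [/\ M *m X *m M = M, X *m M *m X = X,
      (M *m X)^T = M *m X & (X *m M)^T = X *m M].

(* mxalgebra's pinvmx is a one-sided partial inverse, not the Moore-Penrose
   inverse.  The choice below is determined: see mpinvP and
   moore_penrose_uniq. *)
Definition mpinv (R : realType) (m n : nat) (M : 'M[R]_(m, n)) :
  'M[R]_(n, m) := xget 0 [set X | is_moore_penrose M X].

Definition range_proj (R : realType) (m n : nat) (M : 'M[R]_(m, n)) :
  'M[R]_m := M *m mpinv M.

Lemma moore_penrose_uniq (R : realType) (m n : nat) (M : 'M[R]_(m, n))
    (X Y : 'M[R]_(n, m)) :
  is_moore_penrose M X -> is_moore_penrose M Y -> X = Y.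
Proof.
move=> [MXM XMX sMX sXM] [MYM YMY sMY sYM].
have eMX : M *m X = M *m Y.
  rewrite -sMX -{1}MYM -[M *m Y *m M *m X]mulmxA trmx_mul sMX sMY.
  by rewrite mulmxA MXM.
have eXM : X *m M = Y *m M.
  rewrite -sXM -{1}MYM -[M *m Y *m M]mulmxA mulmxA trmx_mul sXM sYM.
  by rewrite -mulmxA [M *m _]mulmxA MXM.
by rewrite -XMX eXM -mulmxA eMX mulmxA YMY.
Qed.

Lemma gram_unitmx (R : realType) (m n : nat) (B : 'M[R]_(m, n)) :
  row_free B -> B *m B^T \in unitmx.
Proof.
move=> fB; rewrite -row_free_unit -kermx_eq0; apply/eqP/row_matrixP => i.
rewrite row0; set v := row i _.
have vBB : v *m (B *m B^T) = 0.
  by apply/sub_kermxP; rewrite row_sub.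
have : (v *m B) *m (v *m B)^T = 0.
  by rewrite trmx_mul mulmxA -(mulmxA v B) vBB mul0mx.
move/matrixP/(_ 0 0); rewrite !mxE => /eqP.
rewrite psumr_eq0; last by move=> j _; rewrite !mxE -expr2 sqr_ge0.
move/allP => h; apply: (row_free_inj fB); rewrite mul0mx.
apply/rowP => j; rewrite [RHS]mxE; apply/eqP.
by have := h j (mem_index_enum _); rewrite [_^T _ _]mxE -expr2 sqrf_eq0.
Qed.

Lemma mpinvP (R : realType) (m n : nat) (M : 'M[R]_(m, n)) :
  is_moore_penrose M (mpinv M).
Proof.
rewrite /mpinv; case: xgetP => [X _ //|none]; exfalso.
have := mulmx_base M; have := row_base_free M; have := col_base_full M.
move: (col_base M) (row_base M); move: (\rank M) => p B C fullB freeC defM.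
have uC : C *m C^T \in unitmx by apply: gram_unitmx.
have uB : B^T *m B \in unitmx.
  rewrite -{2}[B]trmxK; apply: gram_unitmx.
  by rewrite /row_free mxrank_tr.
pose X := C^T *m invmx (C *m C^T) *m invmx (B^T *m B) *m B^T.
have MX : M *m X = B *m invmx (B^T *m B) *m B^T.
  by rewrite -defM /X -!mulmxA (mulmxA C) mulKVmx.
have XM : X *m M = C^T *m invmx (C *m C^T) *m C.
  by rewrite -defM /X -!mulmxA (mulmxA B^T) mulKmx.
apply: (none X); split.
- by rewrite MX -defM -!mulmxA (mulmxA B^T) mulKmx.
- by rewrite XM /X -!mulmxA (mulmxA C) mulKVmx.
- by rewrite MX !trmx_mul trmxK trmx_inv trmx_mul trmxK mulmxA.
- by rewrite XM !trmx_mul trmxK trmx_inv trmx_mul trmxK mulmxA.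
Qed.

Definition orthogonal_mx (R : realType) (n : nat) (Q : 'M[R]_n) : Prop :=
  Q^T *m Q = 1%:M /\ Q *m Q^T = 1%:M.

Definition diag_entry (R : realType) (m n : nat) (S : 'M[R]_(m, n))
    (i : 'I_(minn m n)) : R :=
  S (widen_ord (geq_minl m n) i) (widen_ord (geq_minr m n) i).

Definition is_svd (R : realType) (m n : nat) (A : 'M[R]_(m, n))
    (U : 'M[R]_m) (S : 'M[R]_(m, n)) (V : 'M[R]_n) : Prop :=
  [/\ A = U *m S *m V^T,
      orthogonal_mx U, orthogonal_mx V, is_diag_mx S &
      (forall i, 0 <= diag_entry S i) /\
      (forall i j : 'I_(minn m n),
         (i <= j)%N -> diag_entry S j <= diag_entry S i)].

(* The index k + j of 'I_n, for j < n - k. *)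
Definition tail_ord (n k : nat) (kn : (k <= n)%N) (j : 'I_(n - k)) : 'I_n :=
  cast_ord (subnKC kn) (rshift k j).

Definition lead_cols (R : realType) (n k : nat) (kn : (k <= n)%N)
    (V : 'M[R]_n) : 'M[R]_(n, k) := colsub (widen_ord kn) V.

Definition tail_cols (R : realType) (n k : nat) (kn : (k <= n)%N)
    (V : 'M[R]_n) : 'M[R]_(n, n - k) := colsub (tail_ord kn) V.

Definition tail_block (R : realType) (m n k : nat) (km : (k <= m)%N)
    (kn : (k <= n)%N) (S : 'M[R]_(m, n)) : 'M[R]_(m - k, n - k) :=
  mxsub (tail_ord km) (tail_ord kn) S.

Definition mutually_independent (R : realType) (d d' : measure_display)
    (T : measurableType d) (E : measurableType d') (P : probability T R)
    (I : finType) (X : I -> T -> E) : Prop :=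
  forall (J : {set I}) (B : I -> set E), (forall i, measurable (B i)) ->
    P (\bigcap_(i in [set` J]) (X i @^-1` B i)) =
    (\prod_(i in J) P (X i @^-1` B i))%E.

Definition standard_gaussian (R : realType) (d : measure_display)
    (T : measurableType d) (P : probability T R) (X : T -> R) : Prop :=
  measurable_fun [set: T] X /\
  forall B : set R, measurable B -> P (X @^-1` B) = normal_prob 0 1 B.

(* Random vectors take values in r.-tuple R, which carries the product
   sigma-algebra; matrices carry no measurable structure in the library. *)
Definition standard_gaussian_vector (R : realType) (d : measure_display)
    (T : measurableType d) (P : probability T R) (r : nat)
    (X : T -> r.-tuple R) : Prop :=
  (forall i : 'I_r, standard_gaussian P (fun w => tnth (X w) i)) /\
  mutually_independent P (fun (i : 'I_r) w => tnth (X w) i).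

Definition col_tuple (R : realType) (r l : nat) (M : 'M[R]_(r, l))
    (j : 'I_l) : r.-tuple R := [tuple M i j | i < r].

Definition standard_gaussian_matrix (R : realType) (d : measure_display)
    (T : measurableType d) (P : probability T R) (r l : nat)
    (G : T -> 'M[R]_(r, l)) : Prop :=
  (forall j : 'I_l, standard_gaussian_vector P (fun w => col_tuple (G w) j)) /\
  mutually_independent P (fun (j : 'I_l) w => col_tuple (G w) j).

Definition beta_coef (R : realType) (m n k : nat) (Sbar : 'M[R]_(m - k, n - k))
    (Vbar : 'M[R]_(n, n - k)) (C : 'M[R]_n) : R :=
  \tr (Sbar^T *m Sbar *m Vbar^T *m C *m Vbar) /
  (largest_eigenvalue C * frobenius_norm Sbar ^+ 2).

Definition gamma_coef (R : realType) (n k : nat) (Vk : 'M[R]_(n, k))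
    (C : 'M[R]_n) : R :=
  k%:R / (largest_eigenvalue C * \tr (invmx (Vk^T *m C *m Vk))).

(* Main.v *)
(* Write H = V_k^T L, which has independent rows, and M = H G.  Whenever M M^T is
   invertible, Z Y with Y = M^+ V_k^T competes with the projection, which gives
     err <= |A Vbar| + |H2 H^+| + |S G M^+|,   H2 = A Vbar Vbar^T L,
   where S is the part of H2 orthogonal to the rows of H; S G is independent of M.
   With tau = tr (H H^T)^-1, a = |H2 H^+ H| and b = |S| one has a^2 + b^2 = |H2|^2
   and |H2 H^+| <= a sqrt tau, and the theorem reduces to E |M^+|^2 <=
   tau / (l - k - 1), to E |S G M^+|^2 <= b^2 E |M^+|^2, and to tail bounds for
   |M^+| and |S G M^+|.

   Densities of Wishart matrices are avoided.  Rotation invariance of the planar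
   Gaussian shows that for a unit vector p the row p G may be replaced by a fresh
   Gaussian row without changing the law of G.  Taking p proportional to row i of
   (H H^T)^-1 H changes only row i of M, and ((M M^T)^-1)_ii is at most
   w_i / |g Q|^2, where w_i = ((H H^T)^-1)_ii, g is the fresh row and the
   l - k + 1 orthonormal columns of Q are orthogonal to the other rows of M.
   The negative moments of |g Q|^2 are Laplace integrals of its Laplace
   transform, which is explicit.  Taking p in the row space of S gives the bounds
   for S G M^+ given M.

   Ridge inverses (M M^T + e)^-1 obey the same bounds for all e >= 0 and blow up
   as e -> 0 when M M^T is singular, so that M M^T is almost surely invertible. *)
Require Import Defs.
From HB Require Import structures.
From mathcomp Require Import all_boot all_order all_algebra.
From mathcomp Require Import all_classical all_reals all_analysis.
From mathcomp Require Import measurable_realfun zify ring lra.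

Set Implicit Arguments.
Unset Strict Implicit.
Unset Printing Implicit Defensive.

Import Order.TTheory GRing.Theory Num.Theory.
Import numFieldNormedType.Exports.

Local Open Scope classical_set_scope.
Local Open Scope ring_scope.

(** * Frobenius norm *)

Section frobenius.
Context (R : realType).

(** The constants are governed by a + b sqrt x <= |H2| sqrt (1 + x). In the mean it is used with x =
    1 / (l - k - 1), which produces the factor (l - k) / (l - k - 1). In the tail, with z = l - k +
    1, the events |S G M^+|^2 <= 4 u^2 b^2 |M^+|^2 and |M^+|^2 <= (13/2) tau t^2 / z give x = 26 /
    z, and the claim becomes z + 26 <= 3 (sqrt z + 1)^2. At z = 5, the least value allowed, the
    margin is below 1/2, so the product of 4 and 13/2 could hardly be larger. The exponent l - k of
    t comes from Markov's inequality at the power l - k of |M^+|; since |g Q| has l - k + 1 degrees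
    of freedom, its next negative moment is infinite. Convexity with weights w_i / tau passes from
    the diagonal entries to the trace without loss. The residual is defined through a chosen
    pseudo-inverse; its measurability comes from writing it as an infimum of |A - Z Y| over rational
    Y. Finally k, lambda_1 and |Sbar| cancel in (k beta / gamma) |Sbar|^2 = |H2|^2 tau, so that only
    the positivity of lambda_1 has to be proved. *)

Lemma cauchy_schwarz_sum (I : finType) (a b : I -> R) :
  (\sum_i a i * b i) ^+ 2 <= (\sum_i a i ^+ 2) * (\sum_i b i ^+ 2).
Proof.
have expand x y : \sum_i (x * a i - y * b i) ^+ 2 = x ^+ 2 * (\sum_i a i ^+ 2) -
    2 * x * y * (\sum_i a i * b i) + y ^+ 2 * (\sum_i b i ^+ 2).
  rewrite !mulr_sumr -sumrB -big_split /=.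
  by apply: eq_bigr => i _; ring.
set A := \sum_i a i ^+ 2 in expand *; set B := \sum_i b i ^+ 2 in expand *.
set C := \sum_i a i * b i in expand *.
have [B0|Bn0] := eqVneq B 0.
  have C0 : C = 0.
    rewrite /C big1// => i _; move/eqP: B0; rewrite psumr_eq0 => [|j _]; last exact: sqr_ge0.
    by move=> /allP/(_ i (mem_index_enum _)); rewrite /= sqrf_eq0 => /eqP ->; rewrite mulr0.
  by rewrite C0 B0 expr0n mulr0.
have Bp : 0 < B by rewrite lt_neqAle eq_sym Bn0 sumr_ge0// => i _; exact: sqr_ge0.
have : 0 <= \sum_i (B * a i - C * b i) ^+ 2 by apply: sumr_ge0 => i _; exact: sqr_ge0.
rewrite expand (_ : _ + _ = B * (A * B - C ^+ 2)); last by ring.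
by rewrite pmulr_rge0// subr_ge0.
Qed.

Definition sqnorm m n (M : 'M[R]_(m, n)) : R := \sum_i \sum_j M i j ^+ 2.

Lemma sqnorm_ge0 m n (M : 'M[R]_(m, n)) : 0 <= sqnorm M.
Proof. by apply: sumr_ge0 => i _; apply: sumr_ge0 => j _; exact: sqr_ge0. Qed.

Lemma sqnorm0 m n : sqnorm (0 : 'M[R]_(m, n)) = 0.
Proof. by rewrite /sqnorm !big1// => i _; rewrite big1// => j _; rewrite mxE expr0n. Qed.

Lemma sqnorm_eq0 m n (M : 'M[R]_(m, n)) : sqnorm M = 0 -> M = 0.
Proof.
move/eqP; rewrite psumr_eq0 => [/allP h|i _]; last first.
  by apply: sumr_ge0 => j _; exact: sqr_ge0.
apply/matrixP => i j; rewrite mxE; have := h i (mem_index_enum _).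
rewrite /= psumr_eq0 => [/allP/(_ j (mem_index_enum _))|k _]; last exact: sqr_ge0.
by rewrite /= sqrf_eq0 => /eqP.
Qed.

Lemma frobenius_norm_ge0 m n (M : 'M[R]_(m, n)) : 0 <= frobenius_norm M.
Proof. exact: sqrtr_ge0. Qed.

Lemma frobenius_normE m n (M : 'M[R]_(m, n)) : frobenius_norm M = Num.sqrt (sqnorm M).
Proof. by []. Qed.

Lemma sqr_frobenius_norm m n (M : 'M[R]_(m, n)) : frobenius_norm M ^+ 2 = sqnorm M.
Proof. by rewrite sqr_sqrtr// sqnorm_ge0. Qed.

Lemma sqnorm_tr m n (M : 'M[R]_(m, n)) : sqnorm M = \tr (M *m M^T).
Proof.
by apply: eq_bigr => i _; rewrite mxE; apply: eq_bigr => j _; rewrite mxE.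
Qed.

Lemma sqnorm_trmx m n (M : 'M[R]_(m, n)) : sqnorm M^T = sqnorm M.
Proof. by rewrite !sqnorm_tr trmxK mxtrace_mulC. Qed.

Lemma sqnorm_mulmx_le m n p (A : 'M[R]_(m, n)) (B : 'M[R]_(n, p)) :
  sqnorm (A *m B) <= sqnorm A * sqnorm B.
Proof.
rewrite -[sqnorm B]sqnorm_trmx /sqnorm mulr_suml; apply: ler_sum => i _.
rewrite mulr_sumr; apply: ler_sum => j _; rewrite mxE.
apply: le_trans (cauchy_schwarz_sum _ _) _; rewrite ler_wpM2l//.
  by apply: sumr_ge0 => k _; exact: sqr_ge0.
by apply: ler_sum => k _; rewrite mxE.
Qed.

Lemma frobenius_mulmx_le m n p (A : 'M[R]_(m, n)) (B : 'M[R]_(n, p)) :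
  frobenius_norm (A *m B) <= frobenius_norm A * frobenius_norm B.
Proof.
by rewrite !frobenius_normE -sqrtrM ?sqnorm_ge0// ler_sqrt ?sqnorm_mulmx_le// mulr_ge0 ?sqnorm_ge0.
Qed.

Lemma frobenius_normD m n (A B : 'M[R]_(m, n)) :
  frobenius_norm (A + B) <= frobenius_norm A + frobenius_norm B.
Proof.
rewrite -ler_sqr ?nnegrE ?addr_ge0 ?frobenius_norm_ge0//.
rewrite sqrrD !sqr_frobenius_norm.
have -> : sqnorm (A + B) = sqnorm A + \sum_(p : 'I_m * 'I_n) (A p.1 p.2 * B p.1 p.2) *+ 2 + sqnorm B.
  rewrite /sqnorm !pair_bigA -!big_split /=; apply: eq_bigr => -[i j] _ /=.
  by rewrite mxE sqrrD.
rewrite lerD2r lerD2l sumrMnl lerMn2r /=.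
rewrite -[leRHS]ger0_norm ?mulr_ge0 ?frobenius_norm_ge0// -sqrtr_sqr.
apply: le_trans (ler_norm _) _; rewrite -sqrtr_sqr ler_sqrt ?sqr_ge0//.
rewrite exprMn !sqr_frobenius_norm /sqnorm !pair_bigA.
exact: (cauchy_schwarz_sum (fun p : 'I_m * 'I_n => A p.1 p.2)).
Qed.

Lemma sqnormN m n (A : 'M[R]_(m, n)) : sqnorm (- A) = sqnorm A.
Proof. by apply: eq_bigr => i _; apply: eq_bigr => j _; rewrite mxE sqrrN. Qed.

(* Pythagoras: the cross term is the trace of [A B^T = 0]. *)
Lemma sqnormD_orth m n (A B : 'M[R]_(m, n)) : A *m B^T = 0 ->
  sqnorm (A + B) = sqnorm A + sqnorm B.
Proof.
move=> AB; have BA : B *m A^T = 0 by rewrite -[LHS]trmxK trmx_mul trmxK AB trmx0.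
by rewrite !sqnorm_tr linearD /= mulmxDl !mulmxDr AB BA addr0 add0r linearD.
Qed.

(** The projection 1 - Pi kills the columns of [Z], so it sends [A] and [A - Z *m Y] to the same
    matrix, and an orthogonal projection does not increase the Frobenius norm. Bounding the residual
    is thereby reduced to choosing a competitor [Y]. *)
Lemma range_proj_residual_le m n l (A : 'M[R]_(m, n)) (Z : 'M[R]_(m, l)) (Y : 'M[R]_(l, n)) :
  frobenius_norm ((1%:M - range_proj Z) *m A) <= frobenius_norm (A - Z *m Y).
Proof.
have [ZXZ _ sZX _] := mpinvP Z.
set Pi := range_proj Z; have PiE : Pi = Z *m mpinv Z by [].
have PZ : Pi *m Z = Z by [].
have PT : Pi^T = Pi by rewrite PiE.
have PP : Pi *m Pi = Pi by rewrite {2 3}PiE mulmxA PZ.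
have -> : (1%:M - Pi) *m A = (1%:M - Pi) *m (A - Z *m Y).
  by rewrite mulmxBr (mulmxA (1%:M - Pi)) [in X in _ - X *m Y]mulmxBl mul1mx PZ subrr mul0mx subr0.
set B := A - _; rewrite !frobenius_normE ler_sqrt ?sqnorm_ge0//.
rewrite -[sqnorm B]sqnorm_trmx -[sqnorm (_ *m B)]sqnorm_trmx.
have BE : B^T = B^T *m (1%:M - Pi) + B^T *m Pi by rewrite -mulmxDr subrK mulmx1.
rewrite [in leRHS]BE.
rewrite sqnormD_orth; last first.
  rewrite trmx_mul trmxK PT mulmxA -(mulmxA B^T) mulmxBl mul1mx PP subrr.
  by rewrite mulmx0 mul0mx.
by rewrite trmx_mul [(1%:M - Pi)^T]linearB /= trmx1 PT lerDl sqnorm_ge0.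
Qed.

End frobenius.

(** * Independent Gaussian columns *)

Section iid_product.
Context d (E : measurableType d) (R : realType).

Definition tuple_cons n (x : E * n.-tuple E) : n.+1.-tuple E :=
  [tuple of x.1 :: x.2].

Lemma measurable_tuple_cons n : measurable_fun [set: _] (@tuple_cons n).
Proof. exact: measurable_cons. Qed.

HB.instance Definition _ n :=
  isMeasurableFun.Build _ _ _ _ (@tuple_cons n) (@measurable_tuple_cons n).

Lemma tnth_cons0 n (x : E) (v : n.-tuple E) : tnth (tuple_cons (x, v)) ord0 = x.
Proof. by []. Qed.

Lemma tnth_consS n (x : E) (v : n.-tuple E) i :
  tnth (tuple_cons (x, v)) (lift ord0 i) = tnth v i.
Proof. by rewrite !(tnth_nth x). Qed.

(** Recursion through binary products makes every induction on the number of coordinates a single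
    use of Tonelli. *)
Fixpoint iprod (mu : probability E R) n : probability (n.-tuple E) R :=
  match n with
  | 0 => dirac ([tuple] : 0.-tuple E)
  | n'.+1 => distribution (mu \x iprod mu n')%E (@tuple_cons n')
  end.

Lemma integral_iprodS (mu : probability E R) n (f : n.+1.-tuple E -> \bar R) :
  measurable_fun [set: n.+1.-tuple E] f -> (forall x, 0 <= f x)%E ->
  (\int[iprod mu n.+1]_x f x =
   \int[mu]_x \int[iprod mu n]_v f (tuple_cons (x, v)))%E.
Proof.
move=> mf f0; rewrite [LHS]ge0_integral_distribution//.
rewrite fubini_tonelli1 => [//||x]; last exact: f0.
exact: measurableT_comp.
Qed.

End iid_product.

Section iid_law.
Context d (E : measurableType d) (R : realType).

Definition rectangle n (B : 'I_n -> set E) : set (n.-tuple E) :=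
  [set v | forall i, B i (tnth v i)].

Lemma measurable_rectangle n (B : 'I_n -> set E) :
  (forall i, measurable (B i)) -> measurable (rectangle B).
Proof.
move=> mB; have -> : rectangle B =
    \bigcap_(i in [set: 'I_n]) ((fun v : n.-tuple E => tnth v i) @^-1` B i).
  by apply/seteqP; split => v /= Bv i; [move=> _|]; apply: Bv.
apply: fin_bigcap_measurable => [|i _]; first exact: finite_finset.
by rewrite -[X in measurable X]setTI; exact: measurable_tnth.
Qed.

(** A cylinder over one coordinate is a rectangle whose other sides are full. Rectangles, unlike
    such cylinders, are stable under intersection, as the uniqueness theorem for measures
    requires. *)
Lemma measurable_tuple_rectangles n :
  @measurable _ (n.-tuple E) =
  <<s [set rectangle B | B in [set B | forall i, measurable (B i)]] >>.
Proof.
apply/seteqP; split; last first.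
  apply: smallest_sub; first exact: sigma_algebra_measurable.
  by move=> _ [B mB <-]; exact: measurable_rectangle.
apply: smallest_sub; first exact: smallest_sigma_algebra.
move=> A; rewrite -bigcup_seq => -[i _] [B mB <-]; apply: sub_sigma_algebra.
exists (fun j => if j == i then B else setT).
  by move=> j; case: ifP.
apply/seteqP; split => v; rewrite /rectangle /=.
  by move=> /(_ i); rewrite eqxx.
by move=> [_ Bv] j; case: eqP => // ->.
Qed.

Lemma iprod_rectangle (mu : probability E R) n (B : 'I_n -> set E) :
  (forall i, measurable (B i)) ->
  iprod mu n (rectangle B) = (\prod_(i < n) mu (B i))%E.
Proof.
elim: n B => [|n IHn] B mB.
  rewrite big_ord0 /= diracE; case: (boolP (_ \in _)) => // /negP[].
  by rewrite inE; case.
rewrite big_ord_recl -IHn// -product_measure1E//; last exact: measurable_rectangle.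
rewrite /= /distribution /pushforward; congr product_measure1.
apply/seteqP; split => -[x v] /=.
  move=> Bxv; split=> [|i /=]; first exact: (Bxv ord0).
  by have := Bxv (lift ord0 i); rewrite (tnth_nth x) /= add0n -tnth_nth.
move=> [Bx Bv] i; case: (unliftP ord0 i) => [j ->|-> //].
by rewrite (tnth_nth x) /= add0n -tnth_nth; exact: Bv.
Qed.

(** Independence makes the law of the tuple agree with [iprod] on rectangles, hence on all
    measurable sets. Expectations on the abstract space thus become iterated integrals on a
    canonical product. *)
Lemma integral_iid d' (T : measurableType d') (P : probability T R)
    (mu : probability E R) n (X : 'I_n -> T -> E) (f : n.-tuple E -> \bar R) :
  (forall i, measurable_fun [set: T] (X i)) ->
  (forall i B, measurable B -> P (X i @^-1` B) = mu B) ->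
  mutually_independent P X ->
  measurable_fun [set: n.-tuple E] f -> (forall v, 0 <= f v)%E ->
  (\int[P]_w f [tuple X i w | i < n] = \int[iprod mu n]_v f v)%E.
Proof.
move=> mX lawX indX mf f0.
have mXt : measurable_fun [set: T] (fun w => [tuple X i w | i < n]).
  apply/measurable_fun_tnthP => i; apply: eq_measurable_fun (mX i) => w _ /=.
  by rewrite tnth_mktuple.
pose Xt : {RV P >-> (n.-tuple E)} := HB.pack (fun w => [tuple X i w | i < n])
  (isMeasurableFun.Build _ _ _ _ _ mXt).
transitivity (\int[distribution P Xt]_v f v)%E.
  by rewrite ge0_integral_distribution.
apply: eq_measure_integral => /= A mA _.
apply: (measure_unique [set rectangle B | B in [set B | forall i, measurable (B i)]] (fun=> setT)) => //.
- exact: measurable_tuple_rectangles.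
- move=> _ _ [B mB <-] [C mC <-]; exists (fun i => B i `&` C i).
    by move=> i; apply: measurableI.
  apply/seteqP; split => v; rewrite /rectangle/=.
    by move=> BC; split => i; case: (BC i).
  by move=> [Bv Cv] i; split.
- by move=> _; exists (fun=> setT) => //; apply/seteqP; split.
- by rewrite bigcup_const.
- move=> _ [B mB <-] /=.
  transitivity (\prod_(i < n) mu (B i))%E; last by rewrite -iprod_rectangle.
  rewrite /distribution /pushforward.
  have -> : Xt @^-1` rectangle B = \bigcap_(i in [set` [set: 'I_n]%SET]) (X i @^-1` B i).
    apply/seteqP; split => w; rewrite /rectangle /=.
      by move=> Bw i _; have := Bw i; rewrite tnth_mktuple.
    by move=> Bw i; rewrite tnth_mktuple; apply: Bw; rewrite /= inE.
  rewrite indX//; apply: eq_big => [i|i _]; first by rewrite inE.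
  exact: lawX.
- by move=> _; exact: le_lt_trans (probability_le1 _ measurableT) (ltry _).
Qed.

End iid_law.

(** * Rotation and resampling of Gaussian vectors *)

Section lebesgue_affine.
Context (R : realType).
Local Notation mu := (@lebesgue_measure R).

Lemma measurable_affine (a c : R) :
  measurable_fun [set: R] (fun x => a * x + c).
Proof. by apply: measurable_funD => //; exact: measurable_funM. Qed.

(** The pushforward of Lebesgue measure under the affine map, scaled by [a], gives half-open
    intervals their length, so it is Lebesgue measure by uniqueness. *)
Lemma ge0_integral_affine_pos (a c : R) (g : R -> \bar R) :
  0 < a -> measurable_fun [set: R] g -> (forall x, 0 <= g x)%E ->
  (a%:E * \int[mu]_x g (a * x + c)%R = \int[mu]_x g x)%E.
Proof.
move=> a0 mg g0; pose F x := a * x + c.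
have mF : measurable_fun [set: measurableTypeR R] (F : _ -> measurableTypeR R).
  exact: measurable_affine.
pose nu := measure_function_pushforward__canonical__measure_function_Measure mu mF.
pose k : {nonneg R} := NngNum (ltW a0).
transitivity (\int[mscale k nu]_x g x)%E.
  rewrite ge0_integral_mscale//=; congr (_ * _)%E.
  by rewrite ge0_integral_pushforward// => x _; exact: g0.
apply: eq_measure_integral => /= A mA _; apply/esym/lebesgue_measure_unique => //.
move=> _ [[u v] /= _ <-]; rewrite /mscale /= /pushforward.
have -> : F @^-1` `]u, v] = `](u - c) / a, (v - c) / a]%classic.
  apply/seteqP; split => x /=; rewrite !in_itv /= ltr_pdivrMr// ler_pdivlMr//;
  by rewrite /F (mulrC x) ltrBlDr lerBrDr.
rewrite !lebesgue_measure_itv /= !lte_fin ltr_pM2r ?invr_gt0// ltrD2r.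
case: ifP => _; last by rewrite mule0.
by rewrite -!EFinB -EFinM; congr EFin; field; rewrite gt_eqF.
Qed.

Lemma ge0_integral_oppr (g : R -> \bar R) :
  measurable_fun [set: R] g -> (forall x, 0 <= g x)%E ->
  (\int[mu]_x g (- x)%R = \int[mu]_x g x)%E.
Proof.
move=> mg g0.
transitivity (\int[pushforward mu (-%R : R -> measurableTypeR R)]_x g x)%E.
  by rewrite ge0_integral_pushforward// => x _; exact: g0.
by apply: eq_measure_integral => /= A mA _; exact: lebesgue_measureN.
Qed.

Lemma ge0_integral_affine (a c : R) (g : R -> \bar R) :
  a != 0 -> measurable_fun [set: R] g -> (forall x, 0 <= g x)%E ->
  (`|a|%:E * \int[mu]_x g (a * x + c)%R = \int[mu]_x g x)%E.
Proof.
move=> + mg g0; case: (ltgtP a 0) => // a0 _; last first.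
  by rewrite gtr0_norm//; exact: ge0_integral_affine_pos.
rewrite ltr0_norm//.
rewrite -(@ge0_integral_affine_pos (- a) c g) ?oppr_gt0//; congr (_ * _)%E.
rewrite -[RHS]ge0_integral_oppr //; last first.
  by apply: measurableT_comp => //; exact: measurable_affine.
by apply: eq_integral => x _; rewrite mulrNN.
Qed.

End lebesgue_affine.

Section standard_normal.
Context (R : realType).
Local Notation mu := (@lebesgue_measure R).

Definition gauss : probability (measurableTypeR R) R := normal_prob 0 1.

Lemma gauss_pdfE (x : R) :
  normal_pdf 0 1 x = normal_peak 1 * expR (- (x ^+ 2 / 2)).
Proof.
rewrite normal_pdfE ?oner_eq0//= /normal_fun subr0 expr1n.
by rewrite mulNr; congr (_ * expR (- (_ / _))); rewrite mulr2n.
Qed.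

(** The Radon-Nikodym derivative of [gauss] agrees almost everywhere with the normal density,
    because both have the same integral over every measurable set. *)
Lemma ge0_integral_gauss (f : R -> \bar R) :
  measurable_fun [set: R] f -> (forall x, 0 <= f x)%E ->
  (\int[gauss]_x f x = \int[mu]_x (f x * (normal_pdf 0 1 x)%:E))%E.
Proof.
move=> mf f0.
have dom : gauss `<< mu by exact: normal_prob_dominates.
rewrite -(Radon_Nikodym_SigmaFinite.change_of_variables dom)//.
have mRN := measurable_int _ (Radon_Nikodym_SigmaFinite.f_integrable dom).
have mpdf := measurable_normal_pdf (0 : R) 1.
apply: ae_eq_integral => //.
- exact: emeasurable_funM.
- by apply: emeasurable_funM => //; exact/measurable_EFinP.
- apply: ae_eqe_mul2l; apply: integral_ae_eq => //.
  + exact: Radon_Nikodym_SigmaFinite.f_integrable.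
  + exact/measurable_EFinP.
  + by move=> A _ mA; rewrite -Radon_Nikodym_SigmaFinite.f_integral.
Qed.

End standard_normal.

Section rotation.
Context (R : realType).
Local Notation mu := (@lebesgue_measure R).
Local Notation RR := (measurableTypeR R * measurableTypeR R)%type.

Lemma measurable_linear2 (a b c d : R) :
  measurable_fun [set: RR] (fun z : RR => (a * z.1 + b * z.2, c * z.1 + d * z.2) : RR).
Proof.
have m (u v : R) : measurable_fun [set: RR] (fun z : RR => (u * z.1 + v * z.2)).
  by apply: measurable_funD; apply: measurable_funM.
by apply/measurable_fun_pairP; split; exact: m.
Qed.

(* For [a != 0], substitute [u = a x - b y] in [x], then
   [v = y / a + (b / a) u] in [y]. *)
Lemma lebesgue_rotation (a b : R) (F : RR -> \bar R) :
  a ^+ 2 + b ^+ 2 = 1 -> measurable_fun [set: RR] F -> (forall z, 0 <= F z)%E ->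
  (\int[mu]_x \int[mu]_y F (a * x + - b * y, b * x + a * y)%R =
   \int[mu]_x \int[mu]_y F (x, y))%E.
Proof.
move=> ab1 mF F0.
have mFl u v w z : measurable_fun [set: RR]
    (fun x : RR => F (u * x.1 + v * x.2, w * x.1 + z * x.2)).
  by apply: measurableT_comp => //; exact: measurable_linear2.
(* The substitution divides by [a]. For [a = 0] the rotation is a quarter turn, that is, an exchange
   of the coordinates with signs. *)
have [a0|a0] := eqVneq a 0.
  have b1 : `|- b| = 1.
    by rewrite normrN; apply/eqP; rewrite -sqr_norm_eq1 -ab1 a0 expr0n /= add0r.
  have b0 : - b != 0 by rewrite -normr_eq0 b1 oner_eq0.
  transitivity (\int[mu]_x \int[mu]_u F (u, b * x)%R)%E.
    apply: eq_integral => x _.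
    rewrite -[RHS](@ge0_integral_affine R (- b) 0)//; last exact: measurable_fun_pair1.
    by rewrite b1 mul1e; apply: eq_integral => y _; rewrite a0 !mul0r add0r !addr0.
  have mFs : measurable_fun [set: RR] (fun z : RR => F (z.2, b * z.1)).
    apply: measurableT_comp => //; apply/measurable_fun_pairP.
    by split; [exact: measurable_snd|exact: measurable_funM].
  rewrite (fubini_tonelli (m1 := mu) (m2 := mu) _ mFs (fun z => F0 _)).
  apply: eq_integral => u _ /=.
  rewrite -[RHS](@ge0_integral_affine R b 0)//; last 2 first.
    by rewrite -oppr_eq0.
    exact: measurable_fun_pair2.
  by rewrite -normrN b1 mul1e; apply: eq_integral => x _; rewrite addr0.
have na0 : (0 < `|a|)%R by rewrite normr_gt0.
pose H y u := F (u, a^-1 * y + b / a * u).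
have mH : measurable_fun [set: RR] (fun z : RR => H z.2 z.1).
  apply: measurableT_comp => //; apply/measurable_fun_pairP.
  split; first exact: measurable_fst.
  by apply: measurable_funD; exact: measurable_funM.
have mHy y : measurable_fun [set: measurableTypeR R] (H y).
  exact: (measurable_fun_pair1 (f := fun z : RR => H z.2 z.1) y mH).
rewrite (fubini_tonelli (m1 := mu) (m2 := mu) _ (mFl a (- b) b a) (fun z => F0 _)).
transitivity (\int[mu]_y \int[mu]_x H y (a * x + - b * y)%R)%E.
  apply: eq_integral => y _; apply: eq_integral => x _; rewrite /H /=.
  congr (F (_, _)).
  have -> : a^-1 * y + b / a * (a * x + - b * y) = b * x + (1 - b ^+ 2) / a * y.
    by field.
  by rewrite -ab1 addrK; congr (_ + _ * y); field.
transitivity (\int[mu]_y (`|a|^-1%:E * \int[mu]_u H y u))%E.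
  apply: eq_integral => y _.
  rewrite -(@ge0_integral_affine R a (- b * y)%R (H y) a0 (mHy y) (fun u => F0 _)).
  rewrite muleA -EFinM mulVf ?gt_eqF// mul1e.
  by apply: eq_integral => x _.
transitivity (`|a|^-1%:E * \int[mu]_y \int[mu]_u H y u)%E.
  rewrite -ge0_integralZl//.
  - rewrite (_ : (fun x => _) = fubini_G mu (fun z => H z.2 z.1))//.
    by apply: measurable_fun_fubini_tonelli_G => // z; exact: F0.
  - by move=> y _; apply: integral_ge0 => u _; exact: F0.
rewrite -(fubini_tonelli (m1 := mu) (m2 := mu) _ mH (fun z => F0 _)).
rewrite -ge0_integralZl//; last 2 first.
- rewrite (_ : (fun x => _) = fubini_F mu (fun z => H z.2 z.1))//.
  by apply: measurable_fun_fubini_tonelli_F => // z; exact: F0.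
- by move=> y _; apply: integral_ge0 => u _; exact: F0.
apply: eq_integral => u _ /=.
rewrite -(@ge0_integral_affine R a^-1 (b / a * u)%R (fun v => F (u, v)))//.
- by rewrite normfV.
- by rewrite invr_eq0.
- exact: measurable_fun_pair2.
Qed.

(** The product density depends on x^2 + y^2 alone, so the invariance of Lebesgue measure carries
    over. *)
Lemma gauss_rotation (a b : R) (F : RR -> \bar R) :
  a ^+ 2 + b ^+ 2 = 1 -> measurable_fun [set: RR] F -> (forall z, 0 <= F z)%E ->
  (\int[gauss R]_x \int[gauss R]_y F (a * x + - b * y, b * x + a * y)%R =
   \int[gauss R]_x \int[gauss R]_y F (x, y))%E.
Proof.
move=> ab1 mF F0.
pose w (z : RR) := (normal_pdf 0 1 z.1 * normal_pdf 0 1 z.2)%:E.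
have w0 z : (0 <= w z)%E by rewrite lee_fin mulr_ge0// normal_pdf_ge0.
have mw : measurable_fun [set: RR] w.
  apply/measurable_EFinP; apply: measurable_funM;
  by apply: measurableT_comp => //; exact: measurable_normal_pdf.
have toleb G : measurable_fun [set: RR] G -> (forall z, 0 <= G z)%E ->
    (\int[gauss R]_x \int[gauss R]_y G (x, y) =
     \int[mu]_x \int[mu]_y (G (x, y) * w (x, y)))%E.
  move=> mG G0; rewrite ge0_integral_gauss; last 2 first.
  - rewrite (_ : (fun x => _) = fubini_F (gauss R) G)//.
    exact: measurable_fun_fubini_tonelli_F.
  - by move=> x; apply: integral_ge0.
  apply: eq_integral => x _; rewrite ge0_integral_gauss//; last exact: measurable_fun_pair2.
  rewrite -ge0_integralZr//.
  - by apply: eq_integral => y _; rewrite /w /= -muleA -EFinM mulrC.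
  - apply: emeasurable_funM; first exact: measurable_fun_pair2.
    by apply/measurable_EFinP; exact: measurable_normal_pdf.
  - by move=> y _; rewrite mule_ge0// lee_fin normal_pdf_ge0.
  - by rewrite lee_fin normal_pdf_ge0.
pose G (z : RR) := F (a * z.1 + - b * z.2, b * z.1 + a * z.2).
have mG : measurable_fun [set: RR] G.
  by apply: measurableT_comp => //; exact: measurable_linear2.
apply: etrans (toleb G mG (fun z => F0 _)) _.
apply: etrans (esym (toleb F mF F0)).
have mFw : measurable_fun [set: RR] (fun z => F z * w z)%E.
  exact: emeasurable_funM.
have Fw0 z : (0 <= F z * w z)%E by rewrite mule_ge0.
apply: etrans (lebesgue_rotation ab1 mFw Fw0).
apply: eq_integral => x _; apply: eq_integral => y _; congr (_ * _%:E)%E.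
rewrite /= !gauss_pdfE.
transitivity (normal_peak 1 ^+ 2 * expR (- ((x ^+ 2 + y ^+ 2) / 2)) : R).
  rewrite mulrDl opprD expRD; ring.
rewrite mulrACA -expRD -expr2; congr (_ * expR _).
rewrite -[x ^+ 2 + y ^+ 2]mul1r -ab1; field.
by rewrite ab1 oner_eq0.
Qed.

End rotation.

Lemma integral_cst_probability d (T : measurableType d) (R : realType)
    (P : probability T R) (c : \bar R) : (\int[P]_x c = c)%E.
Proof. by rewrite integral_cst//= probability_setT mule1. Qed.

Section resampling.
Context (R : realType).
Local Notation RT := (measurableTypeR R).
Local Notation gR := (gauss R).

Definition gauss_vec r : probability (r.-tuple RT) R := iprod gR r.

Definition dot r (p : 'I_r -> R) (x : r.-tuple RT) : R :=
  \sum_(i < r) tnth x i * p i.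

(** For a unit vector [p], the component of [x] along [p] is exchanged for [g] and the part
    orthogonal to [p] is kept. *)
Definition resample r (p : 'I_r -> R) (g : R) (x : r.-tuple RT) : r.-tuple RT :=
  [tuple (tnth x i : R) + (g - dot p x) * p i | i < r].

Lemma measurable_fun_dot d (X : measurableType d) r (p : 'I_r -> R)
    (x : X -> r.-tuple RT) :
  measurable_fun [set: X] x -> measurable_fun [set: X] (fun w => dot p (x w)).
Proof.
move=> /measurable_fun_tnthP mx; apply: measurable_sum => i.
by apply: measurable_funM => //; exact: mx.
Qed.

Lemma measurable_fun_resample d (X : measurableType d) r (p : 'I_r -> R)
    (g : X -> R) (x : X -> r.-tuple RT) :
  measurable_fun [set: X] g -> measurable_fun [set: X] x ->
  measurable_fun [set: X] (fun w => resample p (g w) (x w)).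
Proof.
move=> mg mx; apply/measurable_fun_tnthP => i.
apply: (eq_measurable_fun (fun w => tnth (x w) i + (g w - dot p (x w)) * p i : RT)).
  by move=> w _ /=; rewrite tnth_mktuple.
apply: measurable_funD; first by move/measurable_fun_tnthP : mx; exact.
by apply: measurable_funM => //; apply: measurable_funB => //; exact: measurable_fun_dot.
Qed.

(** After a rotation [h] depends on the first coordinate only, and the second one integrates to
    1. *)
Lemma gauss_marginal (a b : R) (h : RT -> \bar R) :
  a ^+ 2 + b ^+ 2 = 1 -> measurable_fun [set: RT] h -> (forall x, 0 <= h x)%E ->
  (\int[gR]_x \int[gR]_y h (a * x + b * y)%R = \int[gR]_x h x)%E.
Proof.
move=> ab1 mh h0.
have ab1' : a ^+ 2 + (- b) ^+ 2 = 1 by rewrite sqrrN.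
have mF : measurable_fun [set: RT * RT] (fun z : RT * RT => h z.1) by exact: measurableT_comp.
have := gauss_rotation ab1' mF (fun z => h0 _); rewrite /= opprK => ->.
by apply: eq_integral => x _; exact: integral_cst_probability.
Qed.

Lemma dot_cons r (p : 'I_r.+1 -> R) (x : RT) (v : r.-tuple RT) :
  dot p (tuple_cons (x, v)) = (x : R) * p ord0 + dot (fun i => p (lift ord0 i)) v.
Proof.
rewrite /dot big_ord_recl; congr (_ + _); apply: eq_bigr => i _.
by rewrite (tnth_nth x) /= add0n -tnth_nth.
Qed.

Lemma dot_resample r (p : 'I_r -> R) g (x : r.-tuple RT) :
  \sum_i p i ^+ 2 = 1 -> dot p (resample p g x) = g.
Proof.
move=> p1; rewrite {1}/dot.
under eq_bigr do rewrite tnth_mktuple mulrDl -mulrA -expr2.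
by rewrite big_split /= -mulr_sumr p1 mulr1 -/(dot p x) addrC subrK.
Qed.

(** Everything happens in the plane of the first axis and the tail direction [q], where the point is
    (x, h) and [p] is (a, s). Its component along [p] is replaced by [g], its component along (-s,
    a) is [w], and g (a, s) + w (-s, a) is the image of (g, w) under a rotation. *)
Lemma resample_cons_resample r (p : 'I_r.+1 -> R) (q : 'I_r -> R) (s g h x : R)
    (v : r.-tuple RT) : let a := p ord0 in let w := - s * x + a * h in
  (forall i, p (lift ord0 i) = s * q i) -> \sum_i q i ^+ 2 = 1 ->
  a ^+ 2 + s ^+ 2 = 1 ->
  resample p g (tuple_cons (x, resample q h v)) =
  tuple_cons (a * g + - s * w, resample q (s * g + a * w) v).
Proof.
move=> a w pq q1 as1; apply: eq_from_tnth => i.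
have dE : dot p (tuple_cons (x, resample q h v)) = x * a + s * h.
  rewrite dot_cons; congr (_ + _); rewrite -[h in RHS](dot_resample _ v q1).
  by rewrite /dot mulr_sumr; apply: eq_bigr => j _; rewrite pq mulrCA.
rewrite tnth_mktuple dE; case: (unliftP ord0 i) => [j ->|->].
  rewrite !tnth_consS !tnth_mktuple pq -addrA; congr (_ + _).
  rewrite -/(dot q v); set D := dot q v.
  have -> : s * g + a * w - D = (h - D) + (g * s - h * (1 - a ^+ 2) - a * s * x).
    by rewrite /w; ring.
  by rewrite -as1; ring.
rewrite !tnth_cons0 -/a.
have -> : a * g + - s * w = s ^+ 2 * x + a * (g - s * h) by rewrite /w; ring.
have -> : s ^+ 2 = 1 - a ^+ 2 by rewrite -as1; ring.
by ring.
Qed.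

End resampling.

Section resampling_invariance.
Context (R : realType).
Local Notation RT := (measurableTypeR R).
Local Notation gR := (gauss R).

Lemma measurable_integral_snd d1 d2 (X : measurableType d1) (Y : measurableType d2)
    (nu : {sigma_finite_measure set Y -> \bar R}) (F : X * Y -> \bar R) :
  measurable_fun [set: X * Y] F -> (forall z, 0 <= F z)%E ->
  measurable_fun [set: X] (fun x => \int[nu]_y F (x, y))%E.
Proof. exact: measurable_fun_fubini_tonelli_F. Qed.

Lemma integralT_ge0 d (X : measurableType d) (mu : {measure set X -> \bar R})
    (F : X -> \bar R) : (forall x, 0 <= F x)%E -> (0 <= \int[mu]_x F x)%E.
Proof. by move=> F0; exact: integral_ge0. Qed.

(** Induction on the length. The hypothesis for the normalized tail [q] inserts a fresh [h]; the
    integrand then sees x and [h] only through w, which is standard Gaussian by [gauss_marginal].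
    The rotation of (g, w) gives two independent Gaussian coordinates, and a second use of the
    hypothesis removes the resampling along [q]. *)
Lemma integral_gauss_vec_resample r (p : 'I_r -> R) (f : r.-tuple RT -> \bar R) :
  \sum_i p i ^+ 2 = 1 ->
  measurable_fun [set: r.-tuple RT] f -> (forall x, 0 <= f x)%E ->
  (\int[gauss_vec R r]_x f x =
   \int[gauss_vec R r]_x \int[gR]_g f (resample p g x))%E.
Proof.
elim: r p f => [|r IHr] p f p1 mf f0.
  by move/eqP: p1; rewrite big_ord0 eq_sym oner_eq0.
pose a := p ord0; pose s := Num.sqrt (\sum_i p (lift ord0 i) ^+ 2).
have s2 : s ^+ 2 = \sum_i p (lift ord0 i) ^+ 2.
  by rewrite sqr_sqrtr// sumr_ge0// => i _; exact: sqr_ge0.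
have as1 : a ^+ 2 + s ^+ 2 = 1 by rewrite s2 -p1 big_ord_recl.
have mfr : measurable_fun [set: r.+1.-tuple RT * RT]
    (fun z : r.+1.-tuple RT * RT => f (resample p z.2 z.1)).
  by apply: measurableT_comp => //; exact: measurable_fun_resample.
rewrite [RHS]integral_iprodS//; last 2 first.
- exact: (measurable_integral_snd gR mfr).
- by move=> x; apply: integralT_ge0 => ?; exact: f0.
rewrite [LHS](integral_iprodS _ mf f0).
(* Here [p] is plus or minus the first basis vector and has no tail direction; resampling replaces
   the first coordinate by [a * g] with a^2 = 1, and the symmetry of the Gaussian suffices. *)
have [s0|s0] := eqVneq s 0.
  have p0 i : p (lift ord0 i) = 0.
    apply/eqP; rewrite -sqrf_eq0; move/eqP: s2; rewrite s0 expr0n /= eq_sym.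
    rewrite psumr_eq0 => [/allP/(_ i (mem_index_enum _))//|j _].
    exact: sqr_ge0.
  have a1 : a ^+ 2 = 1 by rewrite -as1 s0 expr0n /= addr0.
  have E x v g : resample p g (tuple_cons (x, v)) = tuple_cons (a * g, v).
    apply: eq_from_tnth => i; rewrite tnth_mktuple dot_cons /dot.
    rewrite big1 => [|j _]; last by rewrite p0 mulr0.
    case: (unliftP ord0 i) => [j ->|->]; first by rewrite !tnth_consS p0 mulr0 addr0.
    rewrite !tnth_cons0 -/a addr0 mulrBl -mulrA -expr2 a1 mulr1 addrCA subrr addr0.
    by rewrite mulrC.
  under [RHS]eq_integral do under eq_integral do under eq_integral do rewrite E.
  rewrite [RHS]integral_cst_probability.
  have mfc : measurable_fun [set: RT * r.-tuple RT] (fun z : RT * r.-tuple RT => f (tuple_cons z)).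
    exact: measurableT_comp.
  rewrite (fubini_tonelli _ mfc (fun z => f0 _)).
  apply: eq_integral => v _ /=.
  have mfv : measurable_fun [set: RT] (fun x => f (tuple_cons (x, v))).
    exact: measurable_fun_pair1 mfc.
  have ab : a ^+ 2 + (0 : R) ^+ 2 = 1 by rewrite expr0n /= addr0.
  rewrite -(gauss_marginal ab mfv (fun x => f0 _)).
  apply: eq_integral => x _ /=.
  under eq_integral do rewrite mul0r addr0.
  by rewrite integral_cst_probability.
pose q i := p (lift ord0 i) / s.
have pq i : p (lift ord0 i) = s * q i by rewrite mulrC divfK.
have q1 : \sum_i q i ^+ 2 = 1.
  under eq_bigr do rewrite expr_div_n.
  by rewrite -mulr_suml -s2 divff// sqrf_eq0.
pose Phi (u v : R) x' := f (tuple_cons (u, resample q v x')).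
have mPhi d (X : measurableType d) (u v : X -> RT) (x' : X -> r.-tuple RT) :
    measurable_fun [set: X] u -> measurable_fun [set: X] v ->
    measurable_fun [set: X] x' ->
    measurable_fun [set: X] (fun w => Phi (u w) (v w) (x' w)).
  move=> mu mv mx; apply: measurableT_comp => //; apply: measurable_cons => //.
  exact: measurable_fun_resample.
have mlin d (X : measurableType d) (c c' : R) (u v : X -> R) :
    measurable_fun [set: X] u -> measurable_fun [set: X] v ->
    measurable_fun [set: X] (fun w => c * u w + c' * v w).
  by move=> mu mv; apply: measurable_funD; apply: measurable_funM.
pose W (x h : R) := - s * x + a * h.
pose K (z : (RT * r.-tuple RT) * RT * RT) :=
  Phi (a * z.2 + - s * W z.1.1.1 z.1.2) (s * z.2 + a * W z.1.1.1 z.1.2) z.1.1.2.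
have mK : measurable_fun setT K.
  have m1 : measurable_fun [set: (RT * r.-tuple RT) * RT * RT]
      (fun z : (RT * r.-tuple RT) * RT * RT => W z.1.1.1 z.1.2).
    by apply: mlin; do ?apply: measurableT_comp => //.
  by apply: mPhi; [exact: mlin|exact: mlin|do 2 apply: measurableT_comp => //].
have mK2 := measurable_integral_snd gR mK (fun z => f0 _).
have mK3 := measurable_integral_snd gR mK2 (fun z => integralT_ge0 _ (fun _ => f0 _)).
transitivity (\int[gR]_x \int[gauss_vec R r]_v \int[gR]_h \int[gR]_g K (x, v, h, g))%E; last first.
  apply: eq_integral => x _.
  have mfx : measurable_fun [set: r.-tuple RT]
      (fun v => \int[gR]_g f (resample p g (tuple_cons (x, v))))%E.
    apply: (measurable_integral_snd gR (F := fun z => f (resample p z.2 (tuple_cons (x, z.1))))).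
      apply: measurableT_comp => //; apply: measurable_fun_resample => //.
      by apply: (measurable_cons (f := fun=> x) (g := fst)).
    by move=> z; exact: f0.
  rewrite [RHS](IHr q _ q1 mfx (fun v => integralT_ge0 _ (fun _ => f0 _))).
  apply: eq_integral => v _; apply: eq_integral => h _; apply: eq_integral => g _.
  by rewrite /K /Phi /= (resample_cons_resample _ _ _ _ pq q1 as1).
rewrite (fubini_tonelli _ mK3); last first.
  by move=> z; do 2 apply: integralT_ge0 => ?; exact: f0.
transitivity (\int[gauss_vec R r]_v \int[gR]_u \int[gR]_w Phi u w v)%E; last first.
  apply: eq_integral => v _.
  have mF : measurable_fun [set: RT * RT] (fun z : RT * RT => Phi z.1 z.2 v).
    exact: mPhi.
  rewrite -(gauss_rotation as1 mF (fun z => f0 _)) /=.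
  have mH : measurable_fun [set: RT * RT] (fun z : RT * RT => Phi (a * z.2 + - s * z.1) (s * z.2 + a * z.1) v).
    by apply: mPhi => //; exact: mlin.
  rewrite -(fubini_tonelli (m1 := gR) (m2 := gR) _ mH (fun z => f0 _)) /=.
  have sa1 : (- s) ^+ 2 + a ^+ 2 = 1 by rewrite sqrrN addrC.
  have mh := measurable_integral_snd gR mH (fun z => f0 _).
  have := gauss_marginal sa1 mh (fun x => integralT_ge0 _ (fun _ => f0 _)).
  by move=> /= <-.
have mL : measurable_fun [set: r.-tuple RT * RT]
    (fun z : r.-tuple RT * RT => \int[gR]_w Phi z.2 w z.1)%E.
  apply: (measurable_integral_snd gR (F := fun z => Phi z.1.2 z.2 z.1.1)) => [|z]; last exact: f0.
  by apply: mPhi => //; apply: measurableT_comp.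
rewrite (fubini_tonelli (m1 := gauss_vec R r) (m2 := gR) _ mL); last first.
  by move=> z; apply: integralT_ge0 => ?; exact: f0.
apply: eq_integral => u _ /=.
have mfu : measurable_fun [set: r.-tuple RT] (fun v => f (tuple_cons (u, v))).
  apply: measurableT_comp => //.
  by apply: (measurable_cons (f := fun=> u) (g := id)).
exact: IHr q _ q1 mfu (fun v => f0 _).
Qed.

End resampling_invariance.

Section integral_full_domain.
Context d (X : measurableType d) (R : realType) (mu : {measure set X -> \bar R}).
Implicit Types f g : X -> \bar R.

Lemma ge0_integralZT (c : R) f : 0 <= c ->
  measurable_fun [set: X] f -> (forall x, 0 <= f x)%E ->
  (\int[mu]_x (c%:E * f x) = c%:E * \int[mu]_x f x)%E.
Proof. by move=> c0 mf f0; rewrite ge0_integralZl_EFin. Qed.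

Lemma ge0_integralDT f g :
  measurable_fun [set: X] f -> (forall x, 0 <= f x)%E ->
  measurable_fun [set: X] g -> (forall x, 0 <= g x)%E ->
  (\int[mu]_x (f x + g x) = \int[mu]_x f x + \int[mu]_x g x)%E.
Proof. by move=> mf f0 mg g0; rewrite ge0_integralD. Qed.

Lemma ge0_le_integralT f g :
  measurable_fun [set: X] f -> (forall x, 0 <= f x)%E ->
  measurable_fun [set: X] g -> (forall x, f x <= g x)%E ->
  (\int[mu]_x f x <= \int[mu]_x g x)%E.
Proof. by move=> mf f0 mg fg; apply: ge0_le_integral. Qed.

Lemma ge0_integral_sumT (I : finType) (f : I -> X -> \bar R) :
  (forall i, measurable_fun [set: X] (f i)) -> (forall i x, 0 <= f i x)%E ->
  (\int[mu]_x (\sum_i f i x) = \sum_i \int[mu]_x f i x)%E.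
Proof. by move=> mf f0; rewrite ge0_integral_sum. Qed.

End integral_full_domain.

Section gaussian_matrix.
Context (R : realType).
Local Notation RT := (measurableTypeR R).

Definition gauss_mat r l : probability (l.-tuple (r.-tuple RT)) R :=
  iprod (gauss_vec R r) l.

Definition resample_cols r l (p : 'I_r -> R) (g : l.-tuple RT)
    (W : l.-tuple (r.-tuple RT)) : l.-tuple (r.-tuple RT) :=
  [tuple resample p (tnth g j) (tnth W j) | j < l].

Lemma measurable_fun_resample_cols d (X : measurableType d) r l (p : 'I_r -> R)
    (g : X -> l.-tuple RT) (W : X -> l.-tuple (r.-tuple RT)) :
  measurable_fun [set: X] g -> measurable_fun [set: X] W ->
  measurable_fun [set: X] (fun w => resample_cols p (g w) (W w)).
Proof.
move=> /measurable_fun_tnthP mg /measurable_fun_tnthP mW.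
apply/measurable_fun_tnthP => j.
apply: (eq_measurable_fun (fun w => resample p (tnth (g w) j) (tnth (W w) j))).
  by move=> w _ /=; rewrite tnth_mktuple.
by apply: measurable_fun_resample; [exact: mg|exact: mW].
Qed.

Lemma resample_cols_cons r l (p : 'I_r -> R) g0 (g : l.-tuple RT) c
    (W : l.-tuple (r.-tuple RT)) :
  resample_cols p (tuple_cons (g0, g)) (tuple_cons (c, W)) =
  tuple_cons (resample p g0 c, resample_cols p g W).
Proof.
apply: eq_from_tnth => i; rewrite tnth_mktuple.
case: (unliftP ord0 i) => [j ->|->].
  by rewrite !tnth_consS tnth_mktuple.
by rewrite !tnth_cons0.
Qed.

(** The columns are independent and all are resampled along the same [p], so the vector case is
    applied one column at a time. *)
Lemma integral_gauss_mat_resample r l (p : 'I_r -> R)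
    (f : l.-tuple (r.-tuple RT) -> \bar R) :
  \sum_i p i ^+ 2 = 1 ->
  measurable_fun [set: l.-tuple (r.-tuple RT)] f -> (forall x, 0 <= f x)%E ->
  (\int[gauss_mat r l]_W f W =
   \int[gauss_mat r l]_W \int[gauss_vec R l]_g f (resample_cols p g W))%E.
Proof.
move=> p1; elim: l f => [|l IHl] f mf f0.
  apply: eq_integral => W _.
  rewrite -[LHS](integral_cst_probability (gauss_vec R 0)).
  by apply: eq_integral => g _; rewrite (tuple0 (resample_cols p g W)) (tuple0 W).
have mfr : measurable_fun [set: l.+1.-tuple (r.-tuple RT) * l.+1.-tuple RT]
    (fun z : l.+1.-tuple (r.-tuple RT) * l.+1.-tuple RT => f (resample_cols p z.2 z.1)).
  by apply: measurableT_comp => //; exact: measurable_fun_resample_cols.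
have mfr2 := measurable_integral_snd (gauss_vec R l.+1) mfr (fun z => f0 _).
rewrite [RHS](integral_iprodS _ mfr2 (fun x => integralT_ge0 _ (fun _ => f0 _))).
rewrite [LHS](integral_iprodS _ mf f0).
pose K (z : (r.-tuple RT * l.-tuple (r.-tuple RT)) * l.-tuple RT) :=
  f (tuple_cons (z.1.1, resample_cols p z.2 z.1.2)).
have mK : measurable_fun setT K.
  apply: measurableT_comp => //; apply: (measurable_cons (f := fst \o fst)).
    exact: measurableT_comp.
  by apply: measurable_fun_resample_cols => //; exact: measurableT_comp.
pose H (z : r.-tuple RT * l.-tuple (r.-tuple RT)) := (\int[gauss_vec R l]_g K (z, g))%E.
have mH : measurable_fun setT H := measurable_integral_snd _ mK (fun z => f0 _).
have H0 z : (0 <= H z)%E by apply: integralT_ge0 => ?; exact: f0.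
pose K' (z : (r.-tuple RT * l.-tuple (r.-tuple RT)) * RT) := H (resample p z.2 z.1.1, z.1.2).
have mK' : measurable_fun setT K'.
  apply: measurableT_comp => //; apply/measurable_fun_pairP; split.
    by apply: measurable_fun_resample => //; exact: measurableT_comp.
  exact: (measurableT_comp measurable_snd measurable_fst).
pose H' (z : r.-tuple RT * l.-tuple (r.-tuple RT)) := (\int[gauss R]_g K' (z, g))%E.
have mH' : measurable_fun setT H' := measurable_integral_snd _ mK' (fun z => H0 _).
have H'0 z : (0 <= H' z)%E by apply: integralT_ge0 => ?; exact: H0.
transitivity (\int[gauss_vec R r]_c \int[gauss_mat r l]_W H (c, W))%E.
  apply: eq_integral => c _.
  have mfc : measurable_fun [set: l.-tuple (r.-tuple RT)] (fun W => f (tuple_cons (c, W))).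
    apply: measurableT_comp => //.
    by apply: (measurable_cons (f := fun=> c) (g := id)).
  exact: IHl _ mfc (fun _ => f0 _).
transitivity (\int[gauss_vec R r]_c \int[gauss_mat r l]_W H' (c, W))%E; last first.
  apply: eq_integral => c _; apply: eq_integral => W _.
  have mfcW : measurable_fun [set: l.+1.-tuple RT]
      (fun g => f (resample_cols p g (tuple_cons (c, W)))).
    by apply: measurableT_comp => //; apply: measurable_fun_resample_cols.
  rewrite [RHS](integral_iprodS _ mfcW (fun _ => f0 _)).
  apply: eq_integral => g0 _; apply: eq_integral => g _.
  by rewrite resample_cols_cons.
rewrite (fubini_tonelli _ mH H0) (fubini_tonelli _ mH' H'0).
apply: eq_integral => W _.
have mHW : measurable_fun [set: r.-tuple RT] (fun c => H (c, W)).
  exact: measurable_fun_pair1 mH.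
exact: integral_gauss_vec_resample p1 mHW (fun _ => H0 _).
Qed.

Definition mx_of_cols r l (W : l.-tuple (r.-tuple RT)) : 'M[R]_(r, l) :=
  \matrix_(i, j) tnth (tnth W j) i.

Definition row_of_tuple l (g : l.-tuple RT) : 'rV[R]_l := \row_j tnth g j.

Lemma mx_of_resample_cols r l (p : 'rV[R]_r) g (W : l.-tuple (r.-tuple RT)) :
  mx_of_cols (resample_cols (p 0) g W) =
  mx_of_cols W + p^T *m (row_of_tuple g - p *m mx_of_cols W).
Proof.
apply/matrixP => i j; rewrite !mxE !tnth_mktuple big_ord1 !mxE [RHS]addrC.
rewrite [RHS]addrC (mulrC (p 0 i)); congr (_ + (_ - _) * _).
by apply: eq_bigr => k _; rewrite !mxE mulrC.
Qed.

(** [integral_iid] is used at two levels: for the independent columns, and inside each column, on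
    indicators, to identify the law of the column with [gauss_vec]. *)
Lemma integral_gaussian_matrix d (T : measurableType d) (P : probability T R) r l
    (G : T -> 'M[R]_(r, l)) (F : 'M[R]_(r, l) -> \bar R) :
  standard_gaussian_matrix P G ->
  measurable_fun [set: l.-tuple (r.-tuple RT)] (F \o @mx_of_cols r l) ->
  (forall M, 0 <= F M)%E ->
  (\int[P]_w F (G w) = \int[gauss_mat r l]_W F (mx_of_cols W))%E.
Proof.
move=> [colG indG] mF F0.
have mcol j : measurable_fun [set: T] (fun w => col_tuple (G w) j : r.-tuple RT).
  by apply/measurable_fun_tnthP => i; case: ((colG j).1 i).
rewrite -(integral_iid (P := P) (X := fun j w => col_tuple (G w) j : r.-tuple RT) mcol)//.
- apply: eq_integral => w _; congr F; apply/matrixP => i j.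
  by rewrite mxE !tnth_mktuple.
- move=> j B mB; have [gj indj] := colG j.
  have mc i : measurable_fun [set: T] (fun w => tnth (col_tuple (G w) j) i : RT).
    by case: (gj i).
  have mX : measurable_fun [set: T] (fun w => col_tuple (G w) j : r.-tuple RT).
    exact: mcol.
  have mi : measurable_fun [set: r.-tuple RT] (EFin \o \1_B : _ -> \bar R).
    exact/measurable_EFinP.
  have i0 (v : r.-tuple RT) : ((0 : \bar R) <= (EFin \o \1_B) v)%E by rewrite lee_fin.
  have := integral_iid (mu := gauss R) mc (fun i => (gj i).2) indj mi i0.
  rewrite [RHS]integral_indic// setIT => <-.
  transitivity (\int[P]_w (\1_((fun w => col_tuple (G w) j) @^-1` B) w)%:E)%E.
    rewrite integral_indic ?setIT// -[X in measurable X]setTI.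
    exact: mX.
  apply: eq_integral => w _ /=.
  suff -> : [tuple tnth (col_tuple (G w) j) i | i < r] = col_tuple (G w) j by [].
  by apply: eq_from_tnth => i; rewrite tnth_mktuple.
Qed.

(* Conditionally on the part of [G] orthogonal to the unit row [p], the row
   [p G] is a standard Gaussian vector. *)
Lemma gaussian_matrix_conditional_le d (T : measurableType d)
    (P : probability T R) r l (G : T -> 'M[R]_(r, l)) (p : 'rV[R]_r)
    (F F' : 'M[R]_(r, l) -> \bar R) :
  standard_gaussian_matrix P G -> sqnorm p = 1 ->
  measurable_fun [set: l.-tuple (r.-tuple RT)] (F \o @mx_of_cols r l) ->
  measurable_fun [set: l.-tuple (r.-tuple RT)] (F' \o @mx_of_cols r l) ->
  (forall M, 0 <= F M)%E -> (forall M, 0 <= F' M)%E ->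
  (forall M, \int[gauss_vec R l]_g F (M + p^T *m (row_of_tuple g - p *m M))%R <= F' M)%E ->
  (\int[P]_w F (G w) <= \int[P]_w F' (G w))%E.
Proof.
move=> gG; rewrite /sqnorm big_ord1 => p1 mF mF' F0 F'0 FF'.
rewrite (integral_gaussian_matrix gG mF F0) (integral_gaussian_matrix gG mF' F'0).
rewrite (integral_gauss_mat_resample p1 mF (fun _ => F0 _)).
apply: ge0_le_integralT => // [|W|W].
- apply: (measurable_integral_snd (gauss_vec R l)
    (F := fun z => F (mx_of_cols (resample_cols (p ord0) z.2 z.1)))) => [|z]; last exact: F0.
  by apply: (measurableT_comp mF); exact: measurable_fun_resample_cols.
- by apply: integralT_ge0 => ?; exact: F0.
- apply: le_trans (FF' _).
  by under eq_integral do rewrite /= mx_of_resample_cols.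
Qed.

End gaussian_matrix.

(** * Gaussian integrals and negative moments *)

Section gaussian_integrals.
Context (R : realType).
Local Notation RT := (measurableTypeR R).

(** The integrand times the standard density is [s] times the density of standard deviation [s].
    With this parameter one formula covers the Laplace transform of x^2 ([s] below 1) and its
    exponential moments ([s] above 1). *)
Lemma integral_gauss_exp_sqr (s : R) : 0 < s ->
  (\int[gauss R]_x (expR ((1 - s ^- 2) / 2 * x ^+ 2))%:E = s%:E)%E.
Proof.
move=> s0; have sn0 : s != 0 by rewrite gt_eqF.
rewrite ge0_integral_gauss//; last first.
  apply/measurable_EFinP; apply: measurableT_comp => //.
  by apply: measurable_funM => //; exact: measurable_funX.
transitivity (s%:E * \int[lebesgue_measure]_x (normal_pdf 0 s x)%:E)%E; last first.
  by rewrite integral_normal_pdf mule1.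
have mpdf : measurable_fun [set: RT] (fun x : RT => (normal_pdf 0 s x)%:E).
  by apply/measurable_EFinP; exact: measurable_normal_pdf.
have pdf0 (x : RT) : (0 <= (normal_pdf 0 s x)%:E)%E by rewrite lee_fin normal_pdf_ge0.
apply: etrans (ge0_integralZT _ (ltW s0) mpdf pdf0).
apply: eq_integral => x _; rewrite -!EFinM; congr EFin.
rewrite gauss_pdfE normal_pdfE// /normal_fun subr0.
have -> : normal_peak s = normal_peak (1 : R) / s.
  rewrite /normal_peak expr1n mul1r -mulrnAr sqrtrM ?sqr_ge0// sqrtr_sqr.
  by rewrite gtr0_norm// invfM mulrC.
rewrite mulrCA -expRD [RHS]mulrA [s * _]mulrC divfK//; congr (_ * expR _).
by rewrite mulr2n; field.
Qed.

(** Integrating 1 + c x^2 <= exp (c x^2), where c = (1 - s^-2) / 2, bounds the second moment by (s -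
    1) / c, which tends to 1 as s decreases to 1. For s = 1 + d that bound is 2 (1 + d)^2 / (2 + d)
    <= 1 + 3 d, whence the choice of [d]. *)
Lemma integral_gauss_sqr_le1 : (\int[gauss R]_x (x ^+ 2)%:E <= 1)%E.
Proof.
have m2 : measurable_fun [set: RT] (fun x : RT => x ^+ 2 : R) by exact: measurable_funX.
apply/lee_addgt0Pr => e e0.
pose d := Num.min 1 (e / 3); pose s := 1 + d.
have d0 : 0 < d by rewrite lt_min ltr01 divr_gt0.
have d1 : d <= 1 by rewrite ge_min lexx.
have d3 : 3 * d <= e by rewrite mulrC -ler_pdivlMr// ge_min lexx orbT.
have s0 : 0 < s by rewrite addr_gt0.
pose c := (1 - s ^- 2) / 2.
have c0 : 0 < c.
  rewrite divr_gt0// subr_gt0 invf_lt1 ?exprn_gt0// exprn_egt1//.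
  by rewrite ltrDl.
have : (c%:E * \int[gauss R]_x (x ^+ 2)%:E + 1 <= s%:E)%E.
  have mE : measurable_fun [set: RT] (fun x : RT => (x ^+ 2)%:E) by exact/measurable_EFinP.
  have E0 (x : RT) : (0 <= (x ^+ 2)%:E)%E by rewrite lee_fin sqr_ge0.
  rewrite -(ge0_integralZT _ (ltW c0) mE E0).
  rewrite -[X in (_ + X)%E](integral_cst_probability (gauss R)).
  rewrite -ge0_integralDT//; last 2 first.
  - by apply/measurable_EFinP; exact: measurable_funM.
  - by move=> x; rewrite -EFinM lee_fin mulr_ge0 ?sqr_ge0// ltW.
  rewrite -(integral_gauss_exp_sqr s0); apply: ge0_le_integralT.
  - by apply/measurable_EFinP; apply: measurable_funD => //; exact: measurable_funM.
  - by move=> x; rewrite -EFinM -EFinD lee_fin addr_ge0// mulr_ge0 ?sqr_ge0// ltW.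
  - by apply/measurable_EFinP; apply: measurableT_comp => //; exact: measurable_funM.
  - by move=> x; rewrite -EFinM -EFinD lee_fin addrC expR_ge1Dx.
case: (\int[gauss R]_x _)%E (integralT_ge0 (gauss R) (F := fun x : RT => (x ^+ 2)%:E)
    (fun x => sqr_ge0 x)) => [v|//|//].
  move=> _; rewrite -EFinM -EFinD !lee_fin => h.
  have {}h : c * v <= d by move: h; rewrite /s (addrC 1) lerD2r.
  have cE : c = d * (2 + d) / (2 * s ^+ 2).
    by rewrite /c /s; field; rewrite gt_eqF//.
  have hv : v <= d / c by rewrite ler_pdivlMr// mulrC.
  apply: le_trans hv _.
  have -> : d / c = 2 * s ^+ 2 / (2 + d).
    rewrite cE; field; rewrite -/s !gt_eqF//= addr_gt0//.
  rewrite ler_pdivrMr ?addr_gt0// /s; nra.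
by rewrite gt0_muley ?lte_fin.
Qed.

Lemma measurable_dot l (t : 'I_l -> R) : measurable_fun [set: l.-tuple RT] (dot t).
Proof. by apply: (measurable_fun_dot t (x := id)). Qed.

Lemma integral_gauss_vec_dot l (t : 'I_l -> R) (h : RT -> \bar R) :
  \sum_i t i ^+ 2 = 1 -> measurable_fun [set: RT] h -> (forall x, 0 <= h x)%E ->
  (\int[gauss_vec R l]_x h (dot t x) = \int[gauss R]_x h x)%E.
Proof.
move=> t1 mh h0.
have mf : measurable_fun [set: l.-tuple RT] (fun x => h (dot t x)).
  by apply: measurableT_comp => //; exact: measurable_dot.
rewrite (integral_gauss_vec_resample t1 mf (fun x => h0 _)).
under eq_integral do under eq_integral do rewrite dot_resample//.
by rewrite integral_cst_probability.
Qed.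

(** Resampling along the first direction leaves the products with the others unchanged, so each
    direction contributes an independent factor [s]. *)
Lemma integral_gauss_vec_exp_orthonormal l q (s : R) (Q : 'I_q -> 'I_l -> R) :
  0 < s -> (forall a b, \sum_i Q a i * Q b i = (a == b)%:R) ->
  (\int[gauss_vec R l]_x
     (expR ((1 - s ^- 2) / 2 * \sum_b dot (Q b) x ^+ 2))%:E = (s ^+ q)%:E)%E.
Proof.
move=> s0; elim: q Q => [|q IHq] Q QQ.
  under eq_integral do rewrite big_ord0 mulr0 expR0.
  by rewrite integral_cst_probability.
have mE n (B : 'I_n -> 'I_l -> R) : measurable_fun [set: l.-tuple RT]
    (fun x : l.-tuple RT => (expR ((1 - s ^- 2) / 2 * \sum_b dot (B b) x ^+ 2))%:E).
  apply/measurable_EFinP; apply: measurableT_comp => //; apply: measurable_funM => //.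
  apply: measurable_sum => b; apply: measurable_funX.
  exact: measurable_dot.
have Q1 : \sum_i Q ord0 i ^+ 2 = 1.
  by under eq_bigr do rewrite expr2; rewrite QQ eqxx.
rewrite (integral_gauss_vec_resample Q1 (mE _ Q)); last by move=> x; rewrite lee_fin expR_ge0.
have dotS b g (x : l.-tuple RT) :
    dot (Q (lift ord0 b)) (resample (Q ord0) g x) = dot (Q (lift ord0 b)) x.
  rewrite {1}/dot; under eq_bigr do rewrite tnth_mktuple mulrDl -mulrA.
  by rewrite big_split /= -mulr_sumr QQ mulr0 addr0.
under eq_integral => x _ do under eq_integral => g _ do
  rewrite big_ord_recl dot_resample// (eq_bigr _ (fun b _ => congr1 (fun z => z ^+ 2) (dotS b g x)))
    mulrDr expRD EFinM.
transitivity (\int[gauss_vec R l]_x (s%:E * (expR ((1 - s ^- 2) / 2 *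
    \sum_b dot (Q (lift ord0 b)) x ^+ 2))%:E))%E.
  apply: eq_integral => x _; rewrite ge0_integralZr//.
  - by rewrite integral_gauss_exp_sqr.
  - apply/measurable_EFinP; apply: measurableT_comp => //.
    by apply: measurable_funM => //; exact: measurable_funX.
rewrite (ge0_integralZT _ (ltW s0) (mE _ _) (fun x => expR_ge0 _)).
by rewrite (IHq (fun b => Q (lift ord0 b))) -?EFinM ?exprS.
Qed.

End gaussian_integrals.

Section improper_integrals.
Context (R : realType).
Local Notation mu := (@lebesgue_measure R).

Lemma continuous_is_derive (F : R -> R) (a df : R) :
  is_derive a (1 : R) F df -> {for a, continuous F}.
Proof. by move=> h; apply/differentiable_continuous/derivable1_diffP. Qed.

Lemma integral_exp_tail (a z : R) : 0 < z ->
  (\int[mu]_(y in `[a, +oo[) (expR (- (y / z)))%:E = (z * expR (- (a / z)))%:E)%E.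
Proof.
move=> z0; pose F y := - (z * expR (- (y / z))) : R.
have dF (y : R) : is_derive y (1 : R) F (expR (- (y / z))).
  apply: is_derive_eq. 
  rewrite /GRing.scale /= !mulr0 !add0r !mulr1 ?addr0.
  by field; rewrite gt_eqF.
rewrite (@ge0_continuous_FTC2y _ _ F a 0).
- by rewrite /F sub0e EFinN oppeK.
- by move=> y _; exact: expR_ge0.
- apply: continuous_subspaceT => y.
  apply: continuous_comp; last exact: continuous_expR.
  by apply: continuousN; apply: continuousM => //; exact: cvg_cst.
- rewrite -oppr0; apply: cvgN; rewrite -(mulr0 z); apply: cvgMr.
  rewrite (_ : (fun y => expR (- (y / z))) = (fun y => expR (- y)) \o (fun y => y / z))//.
  apply: (@cvg_comp _ _ _ _ _ _ (pinfty_nbhs R)); last exact: cvgr_expR.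
  by apply: gt0_cvgMly; [rewrite invr_gt0|exact: cvg_id].
- by move=> y _.
- apply: cvg_at_right_filter; exact: continuous_is_derive (dF a).
- by move=> y _; rewrite derive1E derive_val.
Qed.

(** The integrand is the Laplace transform at y of |g Q|^2 / w for n + 3 orthonormal columns. The
    offset 3 keeps the exponent (n + 3) / 2 of the affine function above 1, hence the integral
    finite. *)
Lemma integral_sqrt_affine_pow (w : R) n : 0 < w ->
  (\int[mu]_(y in `[0%R, +oo[) (Num.sqrt (1 + 2 * y / w) ^- n.+3)%:E =
   (w / n.+1%:R)%:E)%E.
Proof.
move=> w0; pose h y := 1 + 2 * y / w : R.
have h0 y : 0 <= y -> 1 <= h y.
  by move=> y0; rewrite lerDl divr_ge0 ?mulr_ge0// ltW.
have hp y : 0 <= y -> 0 < Num.sqrt (h y).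
  by move=> y0; rewrite sqrtr_gt0 (lt_le_trans ltr01)// h0.
pose F y := - (w / n.+1%:R * (Num.sqrt (h y))^-1 ^+ n.+1).
have dF (y : R) : 0 <= y -> is_derive y (1 : R) F (Num.sqrt (h y) ^- n.+3).
  move=> y0.
  have dh : is_derive y (1 : R) h (2 / w).
    apply: is_derive_eq; rewrite /GRing.scale /=; ring.
  have ds : is_derive y (1 : R) (fun y => Num.sqrt (h y)) ((2 * Num.sqrt (h y))^-1 * (2 / w)).
    apply: is_derive1_comp; apply: is_derive1_sqrt.
    by rewrite (lt_le_trans ltr01)// h0.
  have hn0 : Num.sqrt (h y) != 0 by rewrite gt_eqF// hp.
  have dV := is_deriveV (f := fun y => Num.sqrt (h y)) hn0 ds.
  have dX := is_deriveX n.+1 dV.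
  have -> : F = (- (w / n.+1%:R)) \*: ((fun y => (Num.sqrt (h y))^-1) ^+ n.+1).
    by apply/funext => z; rewrite /F -mulNr exprfctE.
  apply: is_derive_eq; rewrite /GRing.scale /=.
  rewrite -!exprVn invfM !exprS expr0 mulr1; set u := (Num.sqrt (h y))^-1.
  by field; rewrite gt_eqF//= gt_eqF// ltr_pwDl.
have Xlim : (Num.sqrt (h y))^-1 ^+ n.+1 @[y --> +oo] --> (0 : R).
  apply/cvgr0Pnorm_lt => e e0; near=> x.
  have y0 : 0 <= x by near: x; exact: nbhs_pinfty_ge.
  rewrite ger0_norm ?exprn_ge0 ?invr_ge0 ?sqrtr_ge0//.
  apply: (@le_lt_trans _ _ (Num.sqrt (h x))^-1).
    rewrite -[leRHS]expr1 ler_wiXn2l ?invr_ge0 ?sqrtr_ge0//.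
    rewrite invf_le1 ?hp// -sqrtr1 ler_sqrt ?h0// (le_trans ler01)// h0//.
  rewrite invf_plt ?posrE ?hp// -[ltLHS]gtr0_norm ?invr_gt0// -sqrtr_sqr ltr_sqrt; last first.
    by rewrite (lt_le_trans ltr01)// h0.
  rewrite /h; apply: (@lt_trans _ _ (2 * x / w)); last by rewrite ltrDr.
  rewrite ltr_pdivlMr// -ltr_pdivrMl//.
  by near: x; apply: nbhs_pinfty_gt; exact: num_real.
rewrite (@ge0_continuous_FTC2y _ _ F 0 0).
- rewrite /F /h mulr0 mul0r addr0 sqrtr1 invr1 expr1n mulr1.
  by rewrite sub0e EFinN oppeK.
- by move=> y y0; rewrite invr_ge0 exprn_ge0// sqrtr_ge0.
- apply: continuous_in_subspaceT => y; rewrite inE/= in_itv/= andbT => y0.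
  apply: cvgV; first by rewrite expf_neq0// gt_eqF// hp.
  apply: (continuous_comp (f := fun y => Num.sqrt (h y)) (g := fun z : R => z ^+ n.+3)); last exact: exprn_continuous.
  apply: (continuous_comp (f := h)); last exact: sqrt_continuous.
  apply: continuousD; first exact: cvg_cst.
  by apply: continuousM; [apply: continuousM => //; exact: cvg_cst|exact: cvg_cst].
- by rewrite -oppr0; apply: cvgN; rewrite -(mulr0 (w / n.+1%:R)); apply: cvgMr.
- by move=> y y0; have := dF y (ltW y0).
- by apply: cvg_at_right_filter; exact: continuous_is_derive (dF 0 (lexx _)).
- move=> y; rewrite in_itv/= andbT => y0; rewrite derive1E.
  by have dFy := dF y (ltW y0); rewrite derive_val.
Unshelve. all: by end_near.
Qed.

End improper_integrals.

(** Inversion is discontinuous at 0. It is rewritten with a real power of the nonnegative number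
    x^2, and the convention that 0 has inverse 0 is respected. *)
Lemma measurable_invr (R : realType) :
  measurable_fun [set: measurableTypeR R] (fun x : measurableTypeR R => x^-1 : R).
Proof.
have -> : (fun x : measurableTypeR R => x^-1 : R) =
    (fun x => x * (x ^+ 2) `^ (- 1)).
  apply/funext => x; have [->|x0] := eqVneq x 0; first by rewrite invr0 mul0r.
  by rewrite powR_inv1 ?sqr_ge0// expr2 invfM mulVKf.
apply: measurable_funM => //.
apply: (measurableT_comp (f := fun y : measurableTypeR R => y `^ (- 1) : R)).
  exact: measurable_powR.
exact: measurable_funX.
Qed.

Section inverse_moments.
Context (R : realType).
Local Notation RT := (measurableTypeR R).
Local Notation mu := (@lebesgue_measure R).

(* With [c = m / 2] this is [(e / c) ^ c]; for [m = 0] it is [1]. *)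
Definition moment_const (m : nat) : R :=
  expR (m%:R / 2) / Num.sqrt (m%:R / 2) ^+ m.

Lemma moment_const_ge0 m : 0 <= moment_const m.
Proof. by rewrite divr_ge0 ?expR_ge0// exprn_ge0// sqrtr_ge0. Qed.

Let kern m (r y : R) : \bar R := (Num.sqrt y ^+ m * expR (- (r * y)))%:E.

Let kern_ge0 m r y : (0 <= kern m r y)%E.
Proof. by rewrite lee_fin mulr_ge0 ?expR_ge0// exprn_ge0// sqrtr_ge0. Qed.

Let measurable_sqrt : measurable_fun [set: RT] (fun y : RT => Num.sqrt y : R).
Proof. by apply: continuous_measurable_fun; exact: sqrt_continuous. Qed.

Let measurable_kern m r : measurable_fun [set: RT] (kern m r : RT -> \bar R).
Proof.
apply/measurable_EFinP; apply: measurable_funM.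
  exact: (measurable_funX m measurable_sqrt).
by apply: measurableT_comp => //; exact: measurableT_comp.
Qed.

(* Restrict the integral to [y >= c z]. *)
Lemma sqrt_pow_le_laplace m (z r : R) : 0 <= z -> z * r <= 1 ->
  ((Num.sqrt z ^+ m.+2)%:E <=
   (moment_const m)%:E * \int[mu]_(y in `[0%R, +oo[) kern m r y)%E.
Proof.
move=> z0 zr; have [->|zn0] := eqVneq z 0.
  rewrite sqrtr0 expr0n /= mule_ge0 ?lee_fin ?moment_const_ge0//.
  by apply: integral_ge0 => y _; exact: kern_ge0.
have zp : 0 < z by rewrite lt_neqAle eq_sym zn0.
(* Cutting at y = theta z yields the factor theta^(m/2) exp (- theta), which is largest at theta = m
   / 2. The resulting constant replaces the exact 1 / Gamma (m / 2 + 1). *)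
pose c : R := m%:R / 2; have c0 : 0 <= c by rewrite divr_ge0.
have cz0 : 0 <= c * z by rewrite mulr_ge0.
apply: (@le_trans _ _ ((moment_const m)%:E *
    \int[mu]_(y in `[(c * z)%R, +oo[) ((Num.sqrt (c * z) ^+ m)%:E * (expR (- (y / z)))%:E))%E).
  have sc : 0 <= Num.sqrt (c * z) ^+ m by rewrite exprn_ge0// sqrtr_ge0.
  pose E (y : RT) : \bar R := (expR (- (y / z)))%:E.
  have E0 y : `[(c * z)%R, +oo[%classic y -> (0 <= E y)%E.
    by move=> _; rewrite lee_fin expR_ge0.
  have mE : measurable_fun `[(c * z)%R, +oo[%classic E.
    apply/measurable_EFinP; apply: measurableT_comp => //; apply: measurable_funTS.
    by apply: measurableT_comp => //; exact: measurable_funM.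
  rewrite (ge0_integralZl_EFin mu _ E0 mE sc)//.
  rewrite integral_exp_tail// -!EFinM lee_fin mulfK// sqrtrM// exprMn.
  have -> : Num.sqrt z ^+ m.+2 = Num.sqrt z ^+ m * z.
    by rewrite -addn2 exprD sqr_sqrtr.
  (* For [m = 0] the root of [c] vanishes but occurs to the power 0, so no division by it is
     possible in the general argument. *)
  have [m0|m0] := eqVneq m 0%N.
    by rewrite /moment_const /c m0 !mul0r expR0 !expr0 oppr0 expR0 divr1 !mul1r mulr1.
  have sc0 : Num.sqrt c ^+ m != 0.
    rewrite expf_neq0// gt_eqF// sqrtr_gt0 divr_gt0// ltr0n lt0n//.
  rewrite /moment_const -/c expRN.
  have eN0 := expR_gt0 c.
  rewrite le_eqVlt; apply/orP; left; apply/eqP; field; rewrite sc0 gt_eqF//.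
apply: lee_pmul => //; first by rewrite lee_fin moment_const_ge0.
  by apply: integral_ge0 => y _; rewrite -EFinM lee_fin mulr_ge0 ?expR_ge0// exprn_ge0// sqrtr_ge0.
apply: (@le_trans _ _ (\int[mu]_(y in `[(c * z)%R, +oo[) kern m r y)%E).
  have mE : measurable_fun `[(c * z)%R, +oo[%classic
      (fun y : RT => (Num.sqrt (c * z) ^+ m)%:E * (expR (- (y / z)))%:E)%E.
    apply: emeasurable_funM => //.
    apply/measurable_EFinP; apply: measurableT_comp => //; apply: measurable_funTS.
    by apply: measurableT_comp => //; exact: measurable_funM.
  have mk : measurable_fun `[(c * z)%R, +oo[%classic (kern m r : RT -> \bar R).
    by apply: measurable_funTS; exact: measurable_kern.
  refine (@ge0_le_integral _ _ _ mu _ _ _ _ _ mE mk _) => //.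
  move=> y; rewrite /= in_itv/= andbT => czy; rewrite -EFinM lee_fin.
    have y0 := le_trans cz0 czy.
    rewrite ler_pM ?exprn_ge0 ?sqrtr_ge0 ?expR_ge0//.
      by rewrite lerXn2r ?nnegrE ?sqrtr_ge0// ler_sqrt.
    rewrite ler_expR lerN2 mulrC ler_wpM2l//.
    by rewrite -ler_pdivlMl// mulr1 in zr.
apply: ge0_subset_integral => //.
- by apply: measurable_funTS; exact: measurable_kern.
- by move=> y /=; rewrite !in_itv/= !andbT; exact: le_trans.
Qed.

(** After Tonelli the Gaussian integral gives (1 + 2 y / w)^(-(m + n + 3)/2). Since y <= (w / 2) (1
    + 2 y / w), [m] of these square-root factors absorb sqrt y ^ m at the price sqrt (w / 2) ^ m,
    and the other n + 3 are integrated exactly. The bound on z is a product at most 1 rather than a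
    quotient, because g Q may vanish. *)
Lemma inverse_moment_le l m n (w : R) (Q : 'I_(m + n.+3) -> 'I_l -> R)
    (z : l.-tuple RT -> R) :
  0 < w -> (forall a b, \sum_i Q a i * Q b i = (a == b)%:R) ->
  measurable_fun [set: l.-tuple RT] z -> (forall g, 0 <= z g) ->
  (forall g, z g * (\sum_b dot (Q b) g ^+ 2 / w) <= 1) ->
  (\int[gauss_vec R l]_g (Num.sqrt (z g) ^+ m.+2)%:E <=
   (moment_const m * (Num.sqrt (w / 2) ^+ m * (w / n.+1%:R)))%:E)%E.
Proof.
move=> w0 QQ mz z0 zr.
pose r g := \sum_b dot (Q b) g ^+ 2 / w.
have mr : measurable_fun [set: l.-tuple RT] r.
  apply: measurable_sum => b; apply: measurable_funM => //.
  by apply: measurable_funX; exact: measurable_dot.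
pose D := `[0%R, +oo[%classic : set RT.
pose nu : {measure set RT -> \bar R} := mu.
pose K (x : l.-tuple RT * RT) := (kern m (r x.1) x.2 * (\1_D x.2)%:E)%E.
have K0 x : (0 <= K x)%E by rewrite mule_ge0 ?kern_ge0// lee_fin.
have mK : measurable_fun setT K.
  apply: emeasurable_funM; last first.
    apply/measurable_EFinP; apply: (measurableT_comp (f := \1_D : RT -> R)) => //.
    by apply: measurable_indic; exact: measurable_itv.
  apply/measurable_EFinP; apply: measurable_funM.
    apply: measurable_funX.
    exact: (measurableT_comp measurable_sqrt measurable_snd).
  apply: measurableT_comp => //; apply: measurableT_comp => //.
  by apply: measurable_funM => //; exact: measurableT_comp.
have KE g : (\int[mu]_(y in D) kern m (r g) y = \int[mu]_y K (g, y))%E.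
  rewrite integral_mkcond; apply: eq_integral => y _.
  by rewrite /K patchE /= indicE; case: ifP => _; rewrite ?mule1 ?mule0.
have m0 := moment_const_ge0 m.
apply: (@le_trans _ _ (\int[gauss_vec R l]_g ((moment_const m)%:E * \int[mu]_y K (g, y)))%E).
  apply: ge0_le_integralT.
  - apply/measurable_EFinP; apply: measurable_funX.
    exact: (measurableT_comp measurable_sqrt mz).
  - by move=> g; rewrite lee_fin exprn_ge0// sqrtr_ge0.
  - apply: emeasurable_funM => //.
    exact: (measurable_integral_snd _ mK K0).
  - by move=> g; rewrite -KE; exact: sqrt_pow_le_laplace.
rewrite (ge0_integralZT _ m0 (measurable_integral_snd _ mK K0)); last first.
  by move=> g; exact: integralT_ge0.
rewrite [leRHS]EFinM; apply: lee_pmul => //.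
  by do 2 apply: integralT_ge0 => ?; exact: K0.
rewrite (fubini_tonelli _ mK K0).
(* Chosen so that (1 - s^-2) / 2 = - y / w, the exponent of the Laplace transform. *)
pose s y := (Num.sqrt (1 + 2 * y / w))^-1.
have sw0 : 0 <= Num.sqrt (w / 2) ^+ m by rewrite exprn_ge0// sqrtr_ge0.
have mh k : measurable_fun [set: RT] (fun y : RT => Num.sqrt (1 + 2 * y / w) ^- k : R).
  apply: (measurableT_comp (@measurable_invr R)); apply: measurable_funX.
  by apply: (measurableT_comp measurable_sqrt); apply: measurable_funD => //; apply: measurable_funM => //; exact: measurable_funM.
rewrite (EFinM _ (w / _)) -(integral_sqrt_affine_pow n w0).
have mhE : measurable_fun D (fun y : RT => (Num.sqrt (1 + 2 * y / w) ^- n.+3)%:E).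
  by apply/measurable_EFinP; apply: measurable_funTS; exact: mh.
have h0E (y : RT) : D y -> (0 <= (Num.sqrt (1 + 2 * y / w) ^- n.+3)%:E)%E.
  by move=> _; rewrite lee_fin invr_ge0 exprn_ge0// sqrtr_ge0.
rewrite -(ge0_integralZl_EFin mu (measurable_itv _) h0E mhE sw0).
rewrite integral_mkcond.
have mK' : measurable_fun setT (fun x : RT * l.-tuple RT => K (x.2, x.1)).
  apply: (measurableT_comp mK).
  by apply: (measurable_fun_pair (f := snd) (g := fst)).
apply: ge0_le_integralT.
- exact: (measurable_integral_snd (gauss_vec R l) mK' (fun _ => K0 _)).
- by move=> y; apply: integralT_ge0 => ?; exact: K0.
- apply/(measurable_restrictT _ _).1 => //.
  by apply: emeasurable_funM => //; apply/measurable_EFinP; apply: measurable_funTS; exact: mh.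
- move=> y; rewrite patchE; case: ifPn => yD; last first.
    rewrite /K /=; under eq_integral do rewrite indicE (negbTE yD) mule0.
    by rewrite integral_cst_probability.
  have y0 : 0 <= y by move: yD; rewrite inE /= in_itv /= andbT.
  have KyE g : K (g, y) = ((Num.sqrt y ^+ m)%:E * (expR (- (r g * y)))%:E)%E.
    by rewrite /K /kern /= indicE yD mule1.
  under eq_integral do rewrite KyE.
  have h0 : 0 < 1 + 2 * y / w by rewrite ltr_pwDl// divr_ge0 ?mulr_ge0// ltW.
  have s0 : 0 < s y by rewrite invr_gt0 sqrtr_gt0.
  have sE g : - (r g * y) = (1 - (s y) ^- 2) / 2 * \sum_b dot (Q b) g ^+ 2.
    rewrite /s exprVn invrK sqr_sqrtr ?ltW// /r -mulr_suml.
    by field; rewrite gt_eqF.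
  under eq_integral do rewrite sE.
  have sy0 : 0 <= Num.sqrt y ^+ m by rewrite exprn_ge0// sqrtr_ge0.
  pose e g := (expR ((1 - s y ^- 2) / 2 * \sum_b dot (Q b) g ^+ 2))%:E.
  have e0 g : (0 <= e g)%E by rewrite lee_fin expR_ge0.
  have me : measurable_fun [set: l.-tuple RT] e.
    apply/measurable_EFinP; apply: measurableT_comp => //; apply: measurable_funM => //.
    by apply: measurable_sum => b; apply: measurable_funX; exact: measurable_dot.
  rewrite (ge0_integralZT _ sy0 me e0) integral_gauss_vec_exp_orthonormal// -!EFinM lee_fin.
  rewrite exprD mulrA -exprMn /s -[in leRHS]exprVn.
  apply: ler_wpM2r; first by rewrite exprn_ge0// invr_ge0 sqrtr_ge0.
  rewrite lerXn2r ?nnegrE ?mulr_ge0 ?sqrtr_ge0 ?invr_ge0 ?sqrtr_ge0//.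
  rewrite ler_pdivrMr ?sqrtr_gt0// -sqrtrM; last by rewrite divr_ge0// ltW.
  rewrite ler_sqrt; last by rewrite mulr_ge0// ltW// divr_gt0.
  by rewrite mulrDr mulr1 (_ : w / 2 * (2 * y / w) = y) ?lerDr ?divr_ge0 ?ltW//; field; rewrite gt_eqF.
Qed.

End inverse_moments.

(** * Deterministic residual bound *)

Section largest_eigenvalue.
Context (R : realType).

Lemma sqnorm_row n (x : 'rV[R]_n) : (x *m x^T) 0 0 = sqnorm x.
Proof. by rewrite sqnorm_tr /mxtrace big_ord1. Qed.

Lemma sqnormZ m n (c : R) (M : 'M[R]_(m, n)) : sqnorm (c *: M) = c ^+ 2 * sqnorm M.
Proof.
rewrite /sqnorm mulr_sumr; apply: eq_bigr => i _; rewrite mulr_sumr.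
by apply: eq_bigr => j _; rewrite mxE exprMn.
Qed.

Lemma quad_expand n (M : 'M[R]_n) (x y : 'rV[R]_n) (a : R) :
  (x - a *: y) *m M *m (x - a *: y)^T =
  x *m M *m x^T - a *: (x *m M *m y^T) - a *: (y *m M *m x^T) +
  a ^+ 2 *: (y *m M *m y^T).
Proof.
have -> : (x - a *: y)^T = x^T - a *: y^T by rewrite linearB linearZ.
rewrite !mulmxBl !mulmxBr -!scalemxAl -!scalemxAr scalerA -expr2.
by rewrite opprB addrA addrAC.
Qed.

(* The supremum [la] of the Rayleigh quotient is an eigenvalue: otherwise
   [M = la - L L^T] is positive semidefinite and invertible, and
   [|x M|^2 <= la (x M x^T)] bounds the quotient away from [la]. *)
Lemma largest_eigenvalue_gram_gt0 n r (L : 'M[R]_(n, r)) :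
  L != 0 -> 0 < largest_eigenvalue (L *m L^T).
Proof.
move=> Ln0; set C := L *m L^T.
pose E := [set sqnorm (x *m L) | x in [set x : 'rV[R]_n | sqnorm x = 1]].
have ubE : has_ubound E.
  exists (sqnorm L) => _ [x x1 <-]; apply: le_trans (sqnorm_mulmx_le _ _) _.
  by rewrite x1 mul1r.
have [i Li] : exists i, row i L != 0.
  apply/existsP; rewrite -negb_forall; apply: contra Ln0 => /forallP L0.
  by apply/eqP/row_matrixP => i; rewrite row0; exact/eqP/L0.
have Ei : E (sqnorm (row i L)).
  exists (delta_mx 0 i) => [/=|]; last by rewrite -rowE.
  rewrite /sqnorm big_ord1 (bigD1 i)//= mxE !eqxx expr1n big1 ?addr0// => j ji.
  by rewrite mxE (negbTE ji) andbF expr0n.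
pose la := sup E.
have la_gt0 : 0 < la.
  apply: lt_le_trans (ub_le_sup ubE Ei); rewrite lt_neqAle sqnorm_ge0 andbT eq_sym.
  by apply: contra Li => /eqP/sqnorm_eq0 ->.
have rayleigh (x : 'rV_n) : sqnorm (x *m L) <= la * sqnorm x.
  have [x0|xn0] := eqVneq (sqnorm x) 0.
    by rewrite (sqnorm_eq0 x0) mul0mx /sqnorm !big_ord1 !big1 ?mulr0// => j _; rewrite mxE expr0n.
  have xp : 0 < sqnorm x by rewrite lt_neqAle eq_sym xn0 sqnorm_ge0.
  rewrite -ler_pdivrMr//; apply: (ub_le_sup ubE).
  exists ((Num.sqrt (sqnorm x))^-1 *: x) => /=.
    by rewrite sqnormZ exprVn sqr_sqrtr ?ltW// mulVf.
  by rewrite -scalemxAl sqnormZ exprVn sqr_sqrtr ?ltW// mulrC.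
pose M := la%:M - C.
have MT : M^T = M by rewrite linearB /= tr_scalar_mx trmx_mul trmxK.
have ME (x : 'rV_n) : (x *m M *m x^T) 0 0 = la * sqnorm x - sqnorm (x *m L).
  rewrite mulmxBr mulmxBl mul_mx_scalar -scalemxAl mulmxA -(mulmxA (x *m L)) -trmx_mul.
  by rewrite mxE [X in _ + X]mxE [X in X + _]mxE !sqnorm_row.
have eig_la : eigenvalue C la.
  have [uM|] := boolP (M \in unitmx); last first.
    rewrite -row_free_unit -kermx_eq0 => /rowV0Pn[v /sub_kermxP vM vn0].
    apply/eigenvalueP; exists v => //; move/eqP: vM.
    by rewrite mulmxBr subr_eq0 mul_mx_scalar => /eqP.
  (* The form of [M] is nonnegative at x - la^-1 y, where y = x M. Expanding it and using y M y^T <=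
     la |y|^2 leaves x M x^T - la^-1 |y|^2 >= 0. *)
  have bound (x : 'rV_n) : sqnorm (x *m M) <= la * (la * sqnorm x - sqnorm (x *m L)).
    set y := x *m M; have yT : y^T = M *m x^T by rewrite trmx_mul MT.
    have : 0 <= ((x - la^-1 *: y) *m M *m (x - la^-1 *: y)^T) 0 0.
      by rewrite ME subr_ge0.
    have -> : (x - la^-1 *: y) *m M *m (x - la^-1 *: y)^T = x *m M *m x^T -
        (2 * la^-1) *: (y *m y^T) + la^-1 ^+ 2 *: (y *m M *m y^T).
      rewrite quad_expand -/y -(mulmxA y M x^T) -yT; congr (_ + _).
      by rewrite -addrA -opprD -scalerDl -mulr2n mulr_natl.
    have entry (X Y Z : 'M[R]_1) b c :
        (X - b *: Y + c *: Z) 0 0 = X 0 0 - b * Y 0 0 + c * Z 0 0 by rewrite !mxE.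
    rewrite entry !ME sqnorm_row.
    set q := la * sqnorm x - _; set s := sqnorm y => h.
    have : 0 <= q - 2 * la^-1 * s + la^-1 ^+ 2 * (la * s).
      by apply: le_trans h _; rewrite lerD2l ler_wpM2l ?sqr_ge0// gerBl sqnorm_ge0.
    have -> : q - 2 * la^-1 * s + la^-1 ^+ 2 * (la * s) = q - la^-1 * s.
      by field; rewrite gt_eqF.
    by rewrite subr_ge0 ler_pdivrMl.
  pose N := invmx M.
  have N2 (x : 'rV_n) : sqnorm x = 1 ->
      1 <= sqnorm N * (la * (la - sqnorm (x *m L))).
    move=> x1; rewrite -x1 -{1}[x](mulmxK uM).
    apply: le_trans (sqnorm_mulmx_le _ _) _; rewrite mulrC ler_wpM2l ?sqnorm_ge0//.
    by apply: le_trans (bound _) _; rewrite x1 mulr1.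
  have N0 : 0 < sqnorm N.
    rewrite lt_neqAle sqnorm_ge0 andbT; apply/eqP => N0.
    have [x x1 _] := Ei; have := N2 x x1.
    by rewrite -N0 mul0r ler10.
  have : la <= la - (sqnorm N * la)^-1.
    apply: ge_sup; first by exists (sqnorm (row i L)).
    move=> _ [x x1 <-]; rewrite lerBrDr -lerBrDl -(@ler_pM2l _ (sqnorm N * la)) ?mulr_gt0//.
    rewrite mulfV ?gt_eqF ?mulr_gt0//.
    by have := N2 x x1; rewrite mulrA.
  by rewrite lerBrDr gerDl leNgt invr_gt0 mulr_gt0.
apply: lt_le_trans la_gt0 _; apply: ub_le_sup => //.
exists la => a /eigenvalueP[v vC vn0].
have vp : 0 < sqnorm v.
  by rewrite lt_neqAle sqnorm_ge0 andbT eq_sym; apply: contra vn0 => /eqP/sqnorm_eq0 ->.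
have : a * sqnorm v <= la * sqnorm v.
  apply: le_trans (rayleigh v).
  have -> : sqnorm (v *m L) = (v *m C *m v^T) 0 0.
    by rewrite -sqnorm_row trmx_mul !mulmxA.
  by rewrite vC -scalemxAl mxE sqnorm_row.
by rewrite ler_pM2r.
Qed.

End largest_eigenvalue.

(** * Blocks of the singular value decomposition *)

Section svd_split.
Context (R : realType).

Lemma sum_lead_tail n k (kn : (k <= n)%N) (F : 'I_n -> R) :
  \sum_i F i = \sum_a F (widen_ord kn a) + \sum_j F (tail_ord kn j).
Proof.
rewrite (reindex (cast_ord (subnKC kn))) /=; last first.
  by exists (cast_ord (esym (subnKC kn))) => i _; rewrite ?cast_ordK ?cast_ordKV.
rewrite big_split_ord /=; congr (_ + _); apply: eq_bigr => a _.
by congr F; apply: val_inj.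
Qed.

Lemma tail_ord_inj n k (kn : (k <= n)%N) : injective (tail_ord kn).
Proof. by move=> a b /(congr1 val)/= /addnI/val_inj. Qed.

Lemma lead_tail_cols_mul n k (kn : (k <= n)%N) (V : 'M[R]_n) :
  V *m V^T = 1%:M ->
  lead_cols kn V *m (lead_cols kn V)^T + tail_cols kn V *m (tail_cols kn V)^T = 1%:M.
Proof.
move=> <-; apply/matrixP => i j; rewrite !mxE (sum_lead_tail kn).
by congr (_ + _); apply: eq_bigr => a _; rewrite !mxE.
Qed.

Lemma lead_cols_orthonormal n k (kn : (k <= n)%N) (V : 'M[R]_n) :
  V^T *m V = 1%:M -> (lead_cols kn V)^T *m lead_cols kn V = 1%:M.
Proof.
move=> VV; apply/matrixP => a b.
have := congr1 (fun M : 'M[R]_n => M (widen_ord kn a) (widen_ord kn b)) VV.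
have wi : injective (widen_ord kn) by move=> i j /(congr1 val)/= /val_inj.
rewrite !mxE (inj_eq wi) => <-.
by apply: eq_bigr => i _; rewrite !mxE.
Qed.

Lemma tail_cols_orthonormal n k (kn : (k <= n)%N) (V : 'M[R]_n) :
  V^T *m V = 1%:M -> (tail_cols kn V)^T *m tail_cols kn V = 1%:M.
Proof.
move=> VV; apply/matrixP => a b.
have := congr1 (fun M : 'M[R]_n => M (tail_ord kn a) (tail_ord kn b)) VV.
rewrite !mxE (inj_eq (@tail_ord_inj _ _ kn)) => <-.
by apply: eq_bigr => i _; rewrite !mxE.
Qed.

(** [A] times the trailing columns of [V] is [U] times the trailing columns of [S], whose first [k]
    rows vanish because [S] is diagonal; the orthogonal [U] drops out of the Gram matrix. With
    [sqnorm_mulmx_gram], the product can replace the trailing block in Frobenius norms although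
    their heights differ. *)
Lemma svd_tail_gram m n k (A : 'M[R]_(m, n)) U S V (km : (k <= m)%N) (kn : (k <= n)%N) :
  is_svd A U S V ->
  (A *m tail_cols kn V)^T *m (A *m tail_cols kn V) =
  (tail_block km kn S)^T *m tail_block km kn S.
Proof.
move=> [-> [UU _] [VV _] /is_diag_mxP dS _].
have -> : U *m S *m V^T *m tail_cols kn V = U *m colsub (tail_ord kn) S.
  rewrite -!mulmxA; congr (_ *m _); rewrite -[in RHS](mulmx1 S) -VV.
  apply/matrixP => i j; rewrite !mxE; apply: eq_bigr => a _; congr (_ * _).
  by rewrite !mxE; apply: eq_bigr => b _; rewrite !mxE.
rewrite trmx_mul -!mulmxA (mulmxA U^T) UU mul1mx.
apply/matrixP => a b; rewrite !mxE (sum_lead_tail km) big1 ?add0r.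
  by apply: eq_bigr => i _; rewrite !mxE.
move=> i _; rewrite !mxE (dS _ (tail_ord kn b)) ?mulr0//=.
by rewrite neq_ltn (leq_trans (ltn_ord i)) ?leq_addr.
Qed.

Lemma sqnorm_mulmx_gram m m' n p (Q : 'M[R]_(m, n)) (Q' : 'M[R]_(m', n)) (X : 'M[R]_(n, p)) :
  Q^T *m Q = Q'^T *m Q' -> sqnorm (Q *m X) = sqnorm (Q' *m X).
Proof.
move=> QQ; rewrite -[LHS]sqnorm_trmx -[RHS]sqnorm_trmx !sqnorm_tr !trmxK !trmx_mul.
by rewrite -!mulmxA (mulmxA Q^T) QQ -!mulmxA.
Qed.

Lemma sqnorm_mulmx_orthonormal m n p (X : 'M[R]_(m, p)) (Q : 'M[R]_(n, p)) :
  Q^T *m Q = 1%:M -> sqnorm (X *m Q^T) = sqnorm X.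
Proof.
by move=> QQ; rewrite !sqnorm_tr trmx_mul trmxK -mulmxA (mulmxA Q^T) QQ mul1mx.
Qed.

End svd_split.

Section deterministic_bound.
Context (R : realType).

(** The Moore-Penrose inverse of a matrix with independent rows. *)
Definition pinv_free m n (M : 'M[R]_(m, n)) : 'M[R]_(n, m) := M^T *m invmx (M *m M^T).

Lemma mulmx_pinv_free m n (M : 'M[R]_(m, n)) :
  M *m M^T \in unitmx -> M *m pinv_free M = 1%:M.
Proof. by move=> uM; rewrite mulmxA mulmxV. Qed.

Lemma sqnorm_pinv_free m n (M : 'M[R]_(m, n)) :
  M *m M^T \in unitmx -> sqnorm (pinv_free M) = \tr (invmx (M *m M^T)).
Proof.
move=> uM; rewrite -sqnorm_trmx sqnorm_tr trmxK /pinv_free trmx_mul trmxK trmx_inv.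
by rewrite trmx_mul trmxK -!mulmxA (mulmxA M) mulmxV// mulmx1.
Qed.

Section residual.
Variables (m n k r l q : nat) (A : 'M[R]_(m, n)) (Vk : 'M[R]_(n, k)) (Vb : 'M[R]_(n, q)).
Variables (L : 'M[R]_(n, r)).
Hypothesis VV : Vk *m Vk^T + Vb *m Vb^T = 1%:M.
Hypothesis Vk1 : Vk^T *m Vk = 1%:M.
Hypothesis Vb1 : Vb^T *m Vb = 1%:M.
Let H := Vk^T *m L.
Let H2 := A *m Vb *m Vb^T *m L.
Hypothesis uH : H *m H^T \in unitmx.

Definition orth_rows : 'M[R]_(m, r) := H2 - H2 *m pinv_free H *m H.

Lemma orth_rows_mulmx : orth_rows *m H^T = 0.
Proof.
have HpH : pinv_free H *m (H *m H^T) = H^T by rewrite -mulmxA mulVmx// mulmx1.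
by rewrite mulmxBl -(mulmxA _ H) -(mulmxA H2) HpH subrr.
Qed.

Let P2 := H2 *m pinv_free H *m H.

Lemma sqnorm_orth_rows : sqnorm P2 + sqnorm orth_rows = sqnorm H2.
Proof.
rewrite -sqnormD_orth; first by rewrite addrC subrK.
by rewrite -mulmxA -[H *m _]trmxK trmx_mul trmxK orth_rows_mulmx trmx0 mulmx0.
Qed.

(** Since H2 H^+ = P2 H^+, only the part [P2] of [H2] is charged here; the complementary part is
    left for the random term. *)
Lemma frobenius_pinv_free_le :
  frobenius_norm (H2 *m pinv_free H) <=
  frobenius_norm P2 * Num.sqrt (\tr (invmx (H *m H^T))).
Proof.
rewrite -sqnorm_pinv_free// -frobenius_normE.
have {1}-> : H2 *m pinv_free H = P2 *m pinv_free H.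
  by rewrite -(mulmxA _ H) mulmx_pinv_free// mulmx1.
exact: frobenius_mulmx_le.
Qed.

(** As H G T = 1, the competitor reproduces A Vk Vk^T exactly, and what remains besides A Vb Vb^T is
    the leakage H2 G T. Writing H2 = (H2 H^+) H + S splits it into the deterministic H2 H^+ and the
    random S G T. *)
Lemma residual_le (G : 'M[R]_(r, l)) : H *m G *m (H *m G)^T \in unitmx ->
  frobenius_norm ((1%:M - range_proj (A *m L *m G)) *m A) <=
  frobenius_norm (A *m Vb) +
  frobenius_norm P2 * Num.sqrt (\tr (invmx (H *m H^T))) +
  frobenius_norm (orth_rows *m G *m pinv_free (H *m G)).
Proof.
move=> uK; set T := pinv_free (H *m G).
apply: le_trans (range_proj_residual_le _ _ (T *m Vk^T)) _.
have HGT : H *m G *m T = 1%:M by exact: mulmx_pinv_free.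
have -> : A - A *m L *m G *m (T *m Vk^T) = A *m Vb *m Vb^T - (H2 *m G *m T) *m Vk^T.
  have AE : A = A *m Vk *m Vk^T + A *m Vb *m Vb^T.
    by rewrite -!mulmxA -mulmxDr VV mulmx1.
  have -> : A *m L *m G *m (T *m Vk^T) =
      A *m Vk *m (H *m G *m T) *m Vk^T + (H2 *m G *m T) *m Vk^T.
    rewrite {1}AE !mulmxDl; congr (_ + _); first by rewrite /H !mulmxA.
    by rewrite /H2 !mulmxA.
  by rewrite HGT mulmx1 {1}AE opprD addrACA subrr add0r.
apply: le_trans (frobenius_normD _ _) _; rewrite -addrA; apply: lerD.
  by rewrite !frobenius_normE sqnorm_mulmx_orthonormal.
rewrite frobenius_normE sqnormN sqnorm_mulmx_orthonormal// -frobenius_normE.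
have -> : H2 *m G *m T = H2 *m pinv_free H + orth_rows *m G *m T.
  rewrite /orth_rows !mulmxBl -(mulmxA _ H G) -(mulmxA _ (H *m G)) HGT mulmx1.
  by rewrite addrC subrK.
by apply: le_trans (frobenius_normD _ _) _; rewrite lerD2r frobenius_pinv_free_le.
Qed.

End residual.
End deterministic_bound.

(** * Measurability of matrix functions *)

Section measurable_matrices.
Context d (X : measurableType d) (R : realType).
Implicit Types m n p : nat.

Definition measurable_mx m n (M : X -> 'M[R]_(m, n)) :=
  forall i j, measurable_fun [set: X] (fun x => M x i j).

Lemma measurable_mx_cst m n (M : 'M[R]_(m, n)) : measurable_mx (fun=> M).
Proof. by move=> i j. Qed.

Lemma measurable_mx_mul m n p (A : X -> 'M[R]_(m, n)) (B : X -> 'M[R]_(n, p)) :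
  measurable_mx A -> measurable_mx B -> measurable_mx (fun x => A x *m B x).
Proof.
move=> mA mB i j; under eq_fun do rewrite mxE.
by apply: measurable_sum => k; exact: measurable_funM.
Qed.

Lemma measurable_mx_sub m n (A B : X -> 'M[R]_(m, n)) :
  measurable_mx A -> measurable_mx B -> measurable_mx (fun x => A x - B x).
Proof.
move=> mA mB i j; under eq_fun do rewrite !mxE.
exact: measurable_funB.
Qed.

Lemma measurable_mx_add m n (A B : X -> 'M[R]_(m, n)) :
  measurable_mx A -> measurable_mx B -> measurable_mx (fun x => A x + B x).
Proof.
move=> mA mB i j; under eq_fun do rewrite !mxE.
exact: measurable_funD.
Qed.

Lemma measurable_mx_tr m n (A : X -> 'M[R]_(m, n)) :
  measurable_mx A -> measurable_mx (fun x => (A x)^T).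
Proof. by move=> mA i j; under eq_fun do rewrite mxE; exact: mA. Qed.

Lemma measurable_mx_scale m n (f : X -> R) (A : X -> 'M[R]_(m, n)) :
  measurable_fun [set: X] f -> measurable_mx A -> measurable_mx (fun x => f x *: A x).
Proof.
move=> mf mA i j; under eq_fun do rewrite mxE.
exact: measurable_funM.
Qed.

Lemma measurable_mx_det n (A : X -> 'M[R]_n) :
  measurable_mx A -> measurable_fun [set: X] (fun x => \det (A x)).
Proof.
move=> mA; apply: measurable_sum => s; apply: measurable_funM => //.
by apply: measurable_prod => i _; exact: mA.
Qed.

Lemma measurable_mx_adj n (A : X -> 'M[R]_n) :
  measurable_mx A -> measurable_mx (fun x => \adj (A x)).
Proof.
move=> mA i j; under eq_fun do rewrite mxE.
apply: measurable_funM => //; apply: measurable_mx_det => a b.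
apply: (eq_measurable_fun (fun x => A x (lift j a) (lift i b))); last exact: mA.
by move=> x _; rewrite !mxE.
Qed.

Lemma measurable_mx_sqnorm m n (A : X -> 'M[R]_(m, n)) :
  measurable_mx A -> measurable_fun [set: X] (fun x => sqnorm (A x)).
Proof.
move=> mA; apply: measurable_sum => i; apply: measurable_sum => j.
by apply: measurable_funX; exact: mA.
Qed.

Lemma measurable_fun_sqrt (f : X -> R) :
  measurable_fun [set: X] f -> measurable_fun [set: X] (fun x => Num.sqrt (f x)).
Proof.
move=> mf; apply: measurableT_comp => //; apply: continuous_measurable_fun.
exact: sqrt_continuous.
Qed.

Lemma measurable_mx_frobenius m n (A : X -> 'M[R]_(m, n)) :
  measurable_mx A -> measurable_fun [set: X] (fun x => frobenius_norm (A x)).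
Proof. by move=> mA; apply: measurable_fun_sqrt; exact: measurable_mx_sqnorm. Qed.

(* Total inverse with value [0] on singular matrices (where [invmx K = K]). *)
Definition safe_inv n (K : 'M[R]_n) : 'M[R]_n := (\det K)^-1 *: \adj K.

Lemma safe_inv_unit n (K : 'M[R]_n) : K \in unitmx -> safe_inv K = invmx K.
Proof. by move=> uK; rewrite /invmx uK. Qed.

Lemma safe_inv_nonunit n (K : 'M[R]_n) : K \notin unitmx -> safe_inv K = 0.
Proof.
by rewrite unitmxE unitfE negbK /safe_inv => /eqP ->; rewrite invr0 scale0r.
Qed.

Lemma measurable_mx_safe_inv n (A : X -> 'M[R]_n) :
  measurable_mx A -> measurable_mx (fun x => safe_inv (A x)).
Proof.
move=> mA; apply: measurable_mx_scale; last exact: measurable_mx_adj.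
apply: (measurableT_comp (@measurable_invr R)); exact: measurable_mx_det.
Qed.

Lemma measurable_mx_trace n (A : X -> 'M[R]_n) :
  measurable_mx A -> measurable_fun [set: X] (fun x => \tr (A x)).
Proof. by move=> mA; apply: measurable_sum => i; exact: mA. Qed.

Lemma rational_approx m n (M : 'M[R]_(m, n)) (e : R) : 0 < e ->
  exists Y : 'M[rat]_(m, n), frobenius_norm (M - map_mx ratr Y) <= (m * n).+1%:R * e.
Proof.
move=> e0.
have approx i j : {q : rat | ratr q \in `]M i j - e, M i j + e[}.
  by apply: cid; apply: rat_in_itvoo; rewrite ltrD2l gt0_cp.
exists (\matrix_(i, j) sval (approx i j)).
have ne0 : 0 <= (m * n).+1%:R * e by rewrite mulr_ge0// ltW.
rewrite frobenius_normE -[leRHS](ger0_norm ne0) -sqrtr_sqr.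
rewrite ler_sqrt ?sqr_ge0// /sqnorm.
apply: (@le_trans _ _ (\sum_(i < m) \sum_(j < n) e ^+ 2)).
  apply: ler_sum => i _; apply: ler_sum => j _; rewrite !mxE.
  have := svalP (approx i j); rewrite in_itv/= => /andP[h1 h2].
  rewrite -[leLHS]real_normK ?num_real// lerXn2r ?nnegrE ?(ltW e0)//.
  by rewrite ler_norml; apply/andP; split; lra.
under eq_bigr do rewrite sumr_const card_ord.
rewrite sumr_const card_ord -mulrnA exprMn -[leLHS]mulr_natl ler_wpM2r ?sqr_ge0//.
by rewrite -natrX ler_nat mulnC (leq_trans (leqnSn _))// -{1}[_.+1]expn1 leq_pexp2l.
Qed.

(** [mpinv] is a choice and is discontinuous where the rank drops. Instead, the residual lies below
    [a] exactly when |A - Z Y| does for some rational Y, which is a countable union of measurable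
    conditions. *)
Lemma measurable_residual m n l (A : 'M[R]_(m, n)) (Z : X -> 'M[R]_(m, l)) :
  measurable_mx Z ->
  measurable_fun [set: X] (fun x => frobenius_norm ((1%:M - range_proj (Z x)) *m A)).
Proof.
move=> mZ _; apply: (measurability _ (RGenInftyO.measurableE R)) => //.
move=> _ [_ [a ->] <-]; rewrite setTI.
have -> : (fun x => frobenius_norm ((1%:M - range_proj (Z x)) *m A)) @^-1` `]-oo, a[ =
    \bigcup_(Y : 'M[rat]_(l, n))
      ((fun x => frobenius_norm (A - Z x *m map_mx ratr Y)) @^-1` `]-oo, a[).
  apply/seteqP; split => x /=; rewrite in_itv/=; last first.
    by move=> [Y _ /=]; rewrite in_itv/=; apply: le_lt_trans; exact: range_proj_residual_le.
  set r := frobenius_norm _ => ra.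
  pose z := frobenius_norm (Z x); have z0 : 0 <= z := frobenius_norm_ge0 _.
  pose N : R := (l * n).+1%:R; have N0 : 0 < N by [].
  have z1 : 0 < z + 1 by rewrite ltr_wpDl.
  (* The tolerance makes |Z| times the approximation error smaller than the gap a - r; the added 1
     covers Z = 0. *)
  have e0 : 0 < (a - r) / (N * (z + 1)) by rewrite divr_gt0 ?subr_gt0// mulr_gt0.
  have [Y hY] := rational_approx (mpinv (Z x) *m A) e0.
  exists Y => //=; rewrite in_itv/=.
  have -> : A - Z x *m map_mx ratr Y = (1%:M - range_proj (Z x)) *m A +
      Z x *m (mpinv (Z x) *m A - map_mx ratr Y).
    by rewrite mulmxBr mulmxBl mul1mx /range_proj mulmxA addrA subrK.
  apply: le_lt_trans (frobenius_normD _ _) _; rewrite -/r -ltrBrDl.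
  apply: le_lt_trans (frobenius_mulmx_le _ _) _.
  apply: le_lt_trans (ler_wpM2l z0 hY) _.
  have -> : N * ((a - r) / (N * (z + 1))) = (a - r) / (z + 1).
    by field; rewrite !gt_eqF.
  rewrite mulrCA -[ltRHS]mulr1 ltr_pM2l ?subr_gt0// ltr_pdivrMr// mul1r.
  by rewrite ltrDl.
apply: countable_bigcupT_measurable => [|Y].
  exact: countableP.
have := @measurable_mx_frobenius _ _ (fun x => A - Z x *m map_mx ratr Y).
move=> /(_ _ measurableT _ (measurable_itv `]-oo, a[)); rewrite setTI; apply.
apply: measurable_mx_sub; first exact: measurable_mx_cst.
by apply: measurable_mx_mul => //; exact: measurable_mx_cst.
Qed.

End measurable_matrices.

(** * Inverse Gram matrices of Gaussian matrices *)

Section gram_inverse.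
Context (R : realType).

Lemma sqnorm_mul_orthonormal_le m n q (x : 'M[R]_(m, n)) (Q : 'M[R]_(n, q)) :
  Q^T *m Q = 1%:M -> sqnorm (x *m Q) <= sqnorm x.
Proof.
move=> QQ; rewrite -(sqnorm_mulmx_orthonormal (x *m Q) QQ).
rewrite -[in leRHS](subrK (x *m Q *m Q^T) x) addrC sqnormD_orth ?lerDl ?sqnorm_ge0//.
rewrite [X in _ *m X]linearB /= mulmxBr !trmx_mul trmxK !mulmxA.
by rewrite -(mulmxA (x *m Q) Q^T Q) QQ mulmx1 subrr.
Qed.

(** Columns are added one at a time: the next one is a normalized vector orthogonal to the rows of
    [B] and to the columns found so far, which exists by counting ranks. *)
Lemma orthonormal_kernel b l q (B : 'M[R]_(b, l)) : (b + q <= l)%N ->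
  exists Q : 'M[R]_(l, q), Q^T *m Q = 1%:M /\ B *m Q = 0.
Proof.
elim: q => [|q IHq] bql.
  by exists 0; split; apply/matrixP => i j; [case: i|case: j].
have [|Q [QQ BQ]] := IHq; first by rewrite (leq_trans _ bql)// addnS.
pose D : 'M[R]_(l, b + q) := (col_mx B Q^T)^T.
have : kermx D != 0.
  rewrite -mxrank_eq0 mxrank_ker subn_eq0 -ltnNge (leq_ltn_trans (rank_leq_col _))//.
  by rewrite -addnS.
case/rowV0Pn => v /sub_kermxP vD vn0.
have [Bv Qv] : B *m v^T = 0 /\ Q^T *m v^T = 0.
  apply: eq_col_mx; rewrite -mul_col_mx col_mx0 -[LHS]trmxK trmx_mul trmxK vD.
  by rewrite trmx0.
have vp : 0 < sqnorm v.
  by rewrite lt_neqAle sqnorm_ge0 andbT eq_sym; apply: contra vn0 => /eqP/sqnorm_eq0 ->.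
pose u := (Num.sqrt (sqnorm v))^-1 *: v.
have uu : u *m u^T = 1%:M.
  apply/matrixP => i j; rewrite !ord1 sqnorm_row sqnormZ exprVn sqr_sqrtr ?ltW//.
  by rewrite mulVf ?gt_eqF// mxE.
have Bu : B *m u^T = 0 by rewrite linearZ /= -scalemxAr Bv scaler0.
have Qu : Q^T *m u^T = 0 by rewrite linearZ /= -scalemxAr Qv scaler0.
have E1 : (row_mx u^T Q)^T *m row_mx u^T Q = 1%:M.
  rewrite tr_row_mx trmxK mul_col_row uu QQ Qu -[u *m Q]trmxK trmx_mul Qu trmx0.
  by rewrite -scalar_mx_block.
have E2 : B *m row_mx u^T Q = 0 by rewrite mul_mx_row Bu BQ row_mx0.
by exists (row_mx u^T Q).
Qed.

(** With [safe_inv] the value at [e = 0] is (M M^T)^-1 for independent rows and 0 otherwise, so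
    moment bounds at [e = 0] can be stated before invertibility is known almost surely. *)
Definition ridge_inv k l (e : R) (M : 'M[R]_(k, l)) : 'M[R]_k :=
  safe_inv (M *m M^T + e%:M).

Section ridge.
Variables (k l : nat) (e : R) (M : 'M[R]_(k, l)).
Hypothesis e0 : 0 <= e.
Let K := M *m M^T + e%:M.
Let N := ridge_inv e M.

Let KT : K^T = K.
Proof. by rewrite linearD /= trmx_mul trmxK tr_scalar_mx. Qed.

Let NT : N^T = N.
Proof.
rewrite /N /ridge_inv -/K; have [uK|nK] := boolP (K \in unitmx).
  by rewrite safe_inv_unit// trmx_inv KT.
by rewrite safe_inv_nonunit// trmx0.
Qed.

(** This is N = N K N for the symmetric N, which also holds for the default value 0 at a singular
    K. *)
Lemma ridge_inv_unfold : N = N *m M *m (N *m M)^T + e *: (N *m N^T).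
Proof.
have -> : N *m M *m (N *m M)^T + e *: (N *m N^T) = N *m K *m N.
  rewrite /K mulmxDr mulmxDl trmx_mul NT.
  by rewrite mul_mx_scalar -(scalemxAl e N N) !mulmxA.
rewrite /N /ridge_inv -/K; have [uK|nK] := boolP (K \in unitmx).
  by rewrite safe_inv_unit// mulVmx// mul1mx.
by rewrite safe_inv_nonunit// mulmx0.
Qed.

Lemma ridge_inv_diag i :
  N i i = sqnorm (row i N *m M) + e * sqnorm (row i N).
Proof.
rewrite {1}ridge_inv_unfold mxE [X in _ + X]mxE -!sqnorm_row -row_mul.
by congr (_ + e * _); rewrite !mxE; apply: eq_bigr => j _; rewrite !mxE.
Qed.

Lemma ridge_inv_diag_ge0 i : 0 <= N i i.
Proof. by rewrite ridge_inv_diag addr_ge0 ?mulr_ge0 ?sqnorm_ge0. Qed.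

Lemma trace_ridge_inv_ge : e * sqnorm N <= \tr N.
Proof.
rewrite [in leRHS]ridge_inv_unfold linearD /= linearZ /= -!sqnorm_tr.
by rewrite lerDr sqnorm_ge0.
Qed.

(* The diagonal entry is at most the inverse squared distance of row [i] of [M]
   to the span of the other rows, which lies in the orthogonal of [Q]. *)
Lemma ridge_inv_diag_le i q (Q : 'M[R]_(l, q)) :
  Q^T *m Q = 1%:M -> (forall j, j != i -> row j M *m Q = 0) ->
  N i i * sqnorm (row i M *m Q) <= 1.
Proof.
move=> QQ MQ; set z := N i i.
have z0 : 0 <= z := ridge_inv_diag_ge0 i.
(* Row [i] of N M meets [Q] only through row [i] of [M], with coefficient z, and its squared norm is
   at most z by [ridge_inv_diag]. *)
have : z ^+ 2 * sqnorm (row i M *m Q) <= z.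
  rewrite -sqnormZ [in leRHS]/z ridge_inv_diag.
  rewrite (_ : z *: _ = row i N *m M *m Q).
    apply: le_trans (sqnorm_mul_orthonormal_le _ QQ) _.
    by rewrite lerDl mulr_ge0 ?sqnorm_ge0.
  rewrite -mulmxA [row i N *m _]mulmx_sum_row (bigD1 i)//= big1 ?addr0.
    by rewrite row_mul mxE.
  by move=> j ji; rewrite row_mul MQ// scaler0.
have [->|zn0] := eqVneq z 0; first by rewrite mul0r.
have zp : 0 < z by rewrite lt_neqAle eq_sym zn0.
by rewrite expr2 -mulrA -[leRHS]mulr1 ler_pM2l.
Qed.

End ridge.

(** A kernel vector of M M^T is an eigenvector of the ridge inverse N for e^-1, so |N|^2 >= e^-2,
    and the trace dominates e |N|^2. *)
Lemma trace_ridge_inv_nonunit k l (e : R) (M : 'M[R]_(k, l)) : 0 < e ->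
  M *m M^T \notin unitmx -> e^-1 <= \tr (ridge_inv e M).
Proof.
move=> e0; rewrite -row_free_unit -kermx_eq0 => /rowV0Pn[v /sub_kermxP vM vn0].
have uK : M *m M^T + e%:M \in unitmx.
  rewrite -row_free_unit -kermx_eq0; apply/negPn/rowV0Pn => -[x /sub_kermxP xK xn0].
  have : (x *m (M *m M^T + e%:M) *m x^T) 0 0 = sqnorm (x *m M) + e * sqnorm x.
    rewrite mulmxDr mulmxDl mul_mx_scalar -scalemxAl mulmxA -(mulmxA (x *m M)) -trmx_mul.
    by rewrite mxE [X in _ + X]mxE !sqnorm_row.
  rewrite xK mul0mx mxE => /esym/eqP; rewrite paddr_eq0 ?mulr_ge0 ?sqnorm_ge0 ?(ltW e0)//.
  rewrite mulf_eq0 (gt_eqF e0) /= => /andP[_ /eqP/sqnorm_eq0 x0].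
  by rewrite x0 eqxx in xn0.
set N := ridge_inv e M.
have vN : v *m N = e^-1 *: v.
  have vK : v *m (M *m M^T + e%:M) = e *: v by rewrite mulmxDr vM add0r mul_mx_scalar.
  have : e *: v *m N = v by rewrite -vK /N /ridge_inv safe_inv_unit// mulmxK.
  by rewrite -scalemxAl => {2}<-; rewrite scalerA mulVf ?gt_eqF// scale1r.
have vp : 0 < sqnorm v.
  by rewrite lt_neqAle sqnorm_ge0 andbT eq_sym; apply: contra vn0 => /eqP/sqnorm_eq0 ->.
have : e^-1 ^+ 2 <= sqnorm N.
  rewrite -(ler_pM2l vp) mulrC -sqnormZ -vN; exact: sqnorm_mulmx_le.
move=> h; apply: (le_trans _ (trace_ridge_inv_ge e M)).
by rewrite -ler_pdivrMl// -expr2.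
Qed.

End gram_inverse.

Section gaussian_rows.
Context (R : realType).
Local Notation RT := (measurableTypeR R).

Lemma measurable_mx_of_cols r l : measurable_mx (@mx_of_cols R r l).
Proof.
move=> i j.
have h : measurable_fun [set: l.-tuple (r.-tuple RT)] (fun W => tnth (tnth W j) i : RT).
  exact: (measurableT_comp (measurable_tnth i) (measurable_tnth j)).
have -> : (fun W => mx_of_cols W i j) = (fun W : l.-tuple (r.-tuple RT) => tnth (tnth W j) i).
  by apply/funext => W; rewrite mxE.
exact: h.
Qed.

Lemma measurable_row_of_tuple l : measurable_mx (@row_of_tuple R l).
Proof.
move=> i j.
have h : measurable_fun [set: l.-tuple RT] (fun g => tnth g j : RT).
  exact: measurable_tnth.
have -> : (fun g => row_of_tuple g i j) = (fun g : l.-tuple RT => tnth g j).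
  by apply/funext => g; rewrite mxE.
exact: h.
Qed.

Lemma row_of_tuple_mulmx l q (g : l.-tuple RT) (Q : 'M[R]_(l, q)) b :
  (row_of_tuple g *m Q) 0 b = dot (fun i => Q i b) g.
Proof. by rewrite mxE; apply: eq_bigr => i _; rewrite mxE. Qed.

Lemma sqnorm_row_of_tuple l q (g : l.-tuple RT) (Q : 'M[R]_(l, q)) :
  sqnorm (row_of_tuple g *m Q) = \sum_b dot (fun i => Q i b) g ^+ 2.
Proof. by rewrite /sqnorm big_ord1; apply: eq_bigr => b _; rewrite row_of_tuple_mulmx. Qed.

Lemma sqnorm_cols m n (M : 'M[R]_(m, n)) : sqnorm M = \sum_j \sum_i M i j ^+ 2.
Proof. exact: exchange_big. Qed.

Section gram.
Variables (k r : nat) (H : 'M[R]_(k, r)).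
Hypothesis uH : H *m H^T \in unitmx.
Let V := invmx (H *m H^T).

(** The rows of (H H^T)^-1 H form the basis dual to the rows of [H]; this is why a change of G along
    one of them touches a single row of H G. *)
Lemma mulmx_dual_row i : H *m (row i (V *m H))^T = delta_mx i 0.
Proof.
have WT : (H *m H^T)^T = H *m H^T by rewrite trmx_mul trmxK.
rewrite row_mul trmx_mul mulmxA -{1}WT -trmx_mul -row_mul mulVmx//.
by rewrite rowE mulmx1 trmx_delta.
Qed.

Lemma sqnorm_dual_row i : sqnorm (row i (V *m H)) = V i i.
Proof.
rewrite -sqnorm_row {1}row_mul -mulmxA mulmx_dual_row -colE.
by rewrite !mxE.
Qed.

Lemma gram_inv_diag_gt0 i : 0 < V i i.
Proof.
rewrite -sqnorm_dual_row lt_neqAle sqnorm_ge0 andbT eq_sym; apply/eqP.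
move=> /sqnorm_eq0 h; have := mulmx_dual_row i; rewrite h trmx0 mulmx0.
by move/matrixP/(_ i 0); rewrite !mxE !eqxx => /esym/eqP; rewrite oner_eq0.
Qed.

Definition dual_unit_row i : 'rV[R]_r := (Num.sqrt (V i i))^-1 *: row i (V *m H).

Lemma sqnorm_dual_unit_row i : sqnorm (dual_unit_row i) = 1.
Proof.
have V0 := gram_inv_diag_gt0 i.
by rewrite sqnormZ sqnorm_dual_row exprVn sqr_sqrtr ?ltW// mulVf ?gt_eqF.
Qed.

Lemma mulmx_dual_unit_row i :
  H *m (dual_unit_row i)^T = (Num.sqrt (V i i))^-1 *: delta_mx i 0.
Proof. by rewrite linearZ /= -scalemxAr mulmx_dual_row. Qed.

Lemma dual_unit_row_mulmx i l (G : 'M[R]_(r, l)) :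
  dual_unit_row i *m G = (Num.sqrt (V i i))^-1 *: (row i V *m (H *m G)).
Proof. by rewrite -scalemxAl row_mul mulmxA. Qed.

End gram.
End gaussian_rows.

Section ridge_moments.
Context (R : realType).
Local Notation RT := (measurableTypeR R).

Lemma measurable_ridge_inv d (X : measurableType d) k l (e : R) (M : X -> 'M[R]_(k, l)) :
  measurable_mx M -> measurable_mx (fun x => ridge_inv e (M x)).
Proof.
move=> mM; apply: measurable_mx_safe_inv; apply: measurable_mx_add.
  by apply: measurable_mx_mul => //; exact: measurable_mx_tr.
exact: measurable_mx_cst.
Qed.

Lemma measurable_comp_cols r l (F : 'M[R]_(r, l) -> R) :
  (forall d (X : measurableType d) (M : X -> 'M[R]_(r, l)), measurable_mx M ->
    measurable_fun [set: X] (F \o M)) ->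
  measurable_fun [set: l.-tuple (r.-tuple RT)] (EFin \o F \o @mx_of_cols R r l).
Proof. by move=> mF; apply/measurable_EFinP; apply: mF; exact: measurable_mx_of_cols. Qed.

(** Given the part of [G] orthogonal to the dual row, [inverse_moment_le] yields a bound that no
    longer depends on that part, so it holds for the full expectation. *)
Lemma ridge_moment_le d (T : measurableType d) (P : probability T R) r l k
    (G : T -> 'M[R]_(r, l)) (H : 'M[R]_(k, r)) (e w : R) (i : 'I_k) m n :
  standard_gaussian_matrix P G -> H *m H^T \in unitmx -> 0 <= e ->
  (k.-1 + (m + n.+3) <= l)%N ->
  w = invmx (H *m H^T) i i ->
  (\int[P]_t (Num.sqrt (ridge_inv e (H *m G t) i i) ^+ m.+2)%:E <=
   (moment_const R m * (Num.sqrt (w / 2) ^+ m * (w / n.+1%:R)))%:E)%E.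
Proof.
move=> gG uH e0 kml wE; set c := moment_const R m * _.
have w0 : 0 < w by rewrite wE; exact: gram_inv_diag_gt0.
have c0 : 0 <= c.
  by rewrite mulr_ge0 ?moment_const_ge0// mulr_ge0 ?exprn_ge0 ?sqrtr_ge0// divr_ge0// ltW.
pose p := dual_unit_row H i; have p1 : sqnorm p = 1 := sqnorm_dual_unit_row uH i.
pose F (M : 'M[R]_(r, l)) : R := Num.sqrt (ridge_inv e (H *m M) i i) ^+ m.+2.
have mF d' (X : measurableType d') (M : X -> 'M[R]_(r, l)) : measurable_mx M ->
    measurable_fun [set: X] (F \o M).
  move=> mM; apply: measurable_funX; apply: measurable_fun_sqrt.
  by apply: measurable_ridge_inv; apply: measurable_mx_mul => //; exact: measurable_mx_cst.
rewrite -[leRHS](integral_cst_probability P).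
have F0 M : (0 <= (EFin \o F) M)%E by rewrite /= lee_fin exprn_ge0// sqrtr_ge0.
have c0E (M : 'M[R]_(r, l)) : (0 <= c%:E)%E by rewrite lee_fin.
pose F' (_ : 'M[R]_(r, l)) : \bar R := c%:E.
have mF' : measurable_fun [set: l.-tuple (r.-tuple RT)] (F' \o @mx_of_cols R r l).
  exact: measurable_cst.
apply: (@gaussian_matrix_conditional_le R _ T P r l G p (EFin \o F) F' gG p1
  (measurable_comp_cols mF) mF' F0 c0E).
move=> M0 /=; pose M := H *m M0.
(* The other k - 1 rows are untouched by the resampling, so [Q] does not depend on the fresh row
   [g]. *)
have [Q [QQ BQ]] := orthonormal_kernel (row' i M) kml.
have MQ j : j != i -> row j M *m Q = 0.
  case: (unliftP i j) => [j' ->|->]; last by rewrite eqxx.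
  have -> : row (lift i j') M = row j' (row' i M) by apply/rowP => a; rewrite !mxE.
  by rewrite -row_mul BQ row0.
pose G' (g : l.-tuple RT) := M0 + p^T *m (row_of_tuple g - p *m M0).
have HG' g : H *m G' g = M + (Num.sqrt w)^-1 *:
    (delta_mx i 0 *m (row_of_tuple g - p *m M0)).
  by rewrite mulmxDr mulmxA mulmx_dual_unit_row// -wE -scalemxAl.
have M'Q g j : j != i -> row j (H *m G' g) *m Q = 0.
  move=> ji; rewrite HG' linearD /= mulmxDl MQ// add0r linearZ /= row_mul.
  have -> : row j (delta_mx i 0 : 'cV[R]_k) = 0.
    by apply/rowP => a; rewrite !mxE (negbTE ji).
  by rewrite mul0mx scaler0 mul0mx.
have pp : p *m p^T = 1%:M.
  by apply/matrixP => a b; rewrite !ord1 sqnorm_row p1 mxE.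
have pG' g : p *m G' g = row_of_tuple g.
  by rewrite mulmxDr (mulmxA p p^T) pp mul1mx addrC subrK.
(* The fresh row g = p G' is (sqrt w)^-1 times the combination of the rows of H G' with coefficients
   from row [i] of (H H^T)^-1. Multiplication by [Q] keeps only the term of index [i], whose
   coefficient is [w]. *)
have iQ g : row i (H *m G' g) *m Q = (Num.sqrt w)^-1 *: (row_of_tuple g *m Q).
  set M' := H *m G' g.
  have VM : row i (invmx (H *m H^T)) *m (M' *m Q) = w *: (row i M' *m Q).
    rewrite [LHS]mulmx_sum_row (bigD1 i)//= big1 ?addr0.
      by rewrite row_mul mxE -wE.
    by move=> j ji; rewrite row_mul M'Q// scaler0.
  rewrite -pG' dual_unit_row_mulmx -wE -scalemxAl scalerA -mulmxA VM scalerA.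
  by rewrite -invfM -expr2 sqr_sqrtr ?ltW// mulVf ?scale1r// gt_eqF.
apply: (@inverse_moment_le R l m n w (fun b a => Q a b) (fun g => ridge_inv e (H *m G' g) i i)) => //.
- move=> a b; have := congr1 (fun A : 'M[R]_(m + n.+3) => A a b) QQ.
  by rewrite !mxE => <-; apply: eq_bigr => j _; rewrite mxE.
- have mG' : measurable_mx G'.
    apply: measurable_mx_add; first exact: measurable_mx_cst.
    apply: measurable_mx_mul; first exact: measurable_mx_cst.
    apply: measurable_mx_sub; last exact: measurable_mx_cst.
    exact: measurable_row_of_tuple.
  by apply: measurable_ridge_inv; apply: measurable_mx_mul => //; exact: measurable_mx_cst.
- by move=> g; exact: ridge_inv_diag_ge0.
- move=> g; rewrite -mulr_suml -sqnorm_row_of_tuple.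
  have := ridge_inv_diag_le e0 QQ (M'Q g).
  by rewrite iQ sqnormZ exprVn (sqr_sqrtr (ltW w0)) [w^-1 * _]mulrC.
Qed.

End ridge_moments.

Section markov.
Context d (T : measurableType d) (R : realType) (P : probability T R).

Lemma markov_set_le (A : set T) (f : T -> R) (c : R) :
  measurable A -> 0 <= c -> measurable_fun [set: T] f -> (forall t, 0 <= f t) ->
  (forall t, A t -> c <= f t) ->
  (c%:E * P A <= \int[P]_t (f t)%:E)%E.
Proof.
move=> mA c0 mf f0 Af.
have mi : measurable_fun [set: T] (fun t => (\1_A t)%:E : \bar R).
  exact/measurable_EFinP.
have i0 t : (0 <= (\1_A t)%:E :> \bar R)%E by rewrite lee_fin.
rewrite -[A in P A]setIT -integral_indic// -(ge0_integralZT _ c0 mi i0).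
apply: ge0_le_integralT.
- by apply: emeasurable_funM.
- by move=> t; rewrite -EFinM lee_fin mulr_ge0.
- exact/measurable_EFinP.
- move=> t; rewrite -EFinM lee_fin indicE; case: (boolP (t \in A)).
    by rewrite inE mulr1; exact: Af.
  by rewrite mulr0.
Qed.

End markov.

(** * Moments and tails of the sketch *)

Section jensen.
Context (R : realType) (I : finType).

Lemma jensen_tangent (f : R -> R) (w x : I -> R) (D : pred R) :
  (forall i, 0 <= w i) -> \sum_i w i = 1 -> (forall i, D (x i)) ->
  (exists s, forall y, D y -> f (\sum_i w i * x i) + s * (y - \sum_i w i * x i) <= f y) ->
  f (\sum_i w i * x i) <= \sum_i w i * f (x i).
Proof.
move=> w0 w1 Dx [s hs]; set c := \sum_i w i * x i.
have : \sum_i w i * (f c + s * (x i - c)) <= \sum_i w i * f (x i).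
  by apply: ler_sum => i _; rewrite ler_wpM2l// hs.
apply: le_trans; rewrite le_eqVlt; apply/orP; left; apply/eqP.
under eq_bigr do rewrite mulrDr mulrCA mulrBr.
rewrite big_split /= -mulr_suml w1 mul1r -mulr_sumr sumrB -mulr_suml w1 mul1r -/c.
by rewrite subrr mulr0 addr0.
Qed.

Lemma jensen_expR (w x : I -> R) : (forall i, 0 <= w i) -> \sum_i w i = 1 ->
  expR (\sum_i w i * x i) <= \sum_i w i * expR (x i).
Proof.
move=> w0 w1; apply: (@jensen_tangent expR w x xpredT) => //.
set c := \sum_i _; exists (expR c) => y _.
have -> : expR y = expR c * expR (y - c) by rewrite -expRD addrC subrK.
by rewrite -[X in X + _]mulr1 -mulrDr ler_wpM2l ?expR_ge0 ?expR_ge1Dx.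
Qed.

(** The tangent of y^((m+2)/2), written in the square roots of the two points so that all exponents
    are natural numbers. *)
Lemma pow_tangent (m : nat) (x c : R) : 0 <= x -> 0 <= c ->
  m.+2%:R * (x ^+ 2 * c ^+ m) <= 2 * x ^+ m.+2 + m%:R * c ^+ m.+2.
Proof.
move=> x0 c0; elim: m => [|m IHm].
  by rewrite expr0 mulr1 mul0r addr0.
have h := ler_wpM2l x0 IHm.
(* The new inequality follows by adding this product to [IHm] multiplied by [x]. *)
have : 0 <= c ^+ m * ((x - c) ^+ 2 * (m.+2%:R * x + m.+1%:R * c)).
  by rewrite mulr_ge0 ?exprn_ge0// mulr_ge0 ?sqr_ge0// addr_ge0// mulr_ge0.
move: h; rewrite !exprS -!natr1; set y := x ^+ m; set e := c ^+ m; set k : R := m%:R.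
nra.
Qed.

Lemma jensen_sqrt_pow (m : nat) (w x : I -> R) : (forall i, 0 <= w i) ->
  \sum_i w i = 1 -> (forall i, 0 <= x i) ->
  Num.sqrt (\sum_i w i * x i) ^+ m.+2 <= \sum_i w i * Num.sqrt (x i) ^+ m.+2.
Proof.
move=> w0 w1 x0.
apply: (@jensen_tangent (fun y => Num.sqrt y ^+ m.+2) w x (fun y => 0 <= y)) => //.
set c := \sum_i _; have c0 : 0 <= c by apply: sumr_ge0 => i _; exact: mulr_ge0.
exists (m.+2%:R / 2 * Num.sqrt c ^+ m) => y y0.
have := pow_tangent m (sqrtr_ge0 y) (sqrtr_ge0 c).
rewrite sqr_sqrtr// => h.
have cE : Num.sqrt c ^+ m.+2 = Num.sqrt c ^+ m * c by rewrite -addn2 exprD sqr_sqrtr.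
have m2 : m.+2%:R = m%:R + 2 :> R by rewrite -addn2 natrD.
move: h => /=; rewrite !cE m2; set s := Num.sqrt c ^+ m; set z := Num.sqrt y ^+ _.
move: (m%:R) => q; nra.
Qed.

End jensen.

Section gaussian_row_functionals.
Context (R : realType).
Local Notation RT := (measurableTypeR R).

Lemma measurable_sqnorm_row_mul l c (T : 'M[R]_(l, c)) :
  measurable_fun [set: l.-tuple RT] (fun g => sqnorm (row_of_tuple g *m T)).
Proof.
apply: measurable_mx_sqnorm; apply: measurable_mx_mul.
  exact: measurable_row_of_tuple.
exact: measurable_mx_cst.
Qed.

Lemma integral_dot_scale l (t : 'I_l -> R) (h : R -> \bar R) :
  measurable_fun [set: RT] h -> (forall x, 0 <= h x)%E ->
  0 < \sum_i t i ^+ 2 ->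
  (\int[gauss_vec R l]_g h (dot t g / Num.sqrt (\sum_i t i ^+ 2))%R = \int[gauss R]_x h x)%E.
Proof.
move=> mh h0 t0; set s := Num.sqrt _.
have s0 : s != 0 by rewrite gt_eqF// sqrtr_gt0.
have t1 : \sum_i (t i / s) ^+ 2 = 1.
  under eq_bigr do rewrite expr_div_n.
  by rewrite -mulr_suml sqr_sqrtr ?ltW// divff// gt_eqF.
rewrite -(integral_gauss_vec_dot t1 mh h0); apply: eq_integral => g _; congr h.
by rewrite /dot mulr_suml; apply: eq_bigr => i _; rewrite mulrA.
Qed.

Lemma integral_sqnorm_row_le l c (T : 'M[R]_(l, c)) :
  (\int[gauss_vec R l]_g (sqnorm (row_of_tuple g *m T))%:E <= (sqnorm T)%:E)%E.
Proof.
under eq_integral do rewrite sqnorm_row_of_tuple -sumEFin.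
have md b : measurable_fun [set: l.-tuple RT] (fun g => (dot (T^~ b) g ^+ 2)%:E).
  by apply/measurable_EFinP; apply: measurable_funX; exact: measurable_dot.
rewrite ge0_integral_sumT//; last by move=> b g; rewrite lee_fin sqr_ge0.
rewrite sqnorm_cols -sumEFin; apply: lee_sum => b _.
have m2 : measurable_fun [set: RT] (fun x : RT => (x ^+ 2)%:E).
  by apply/measurable_EFinP; exact: measurable_funX.
set s2 := \sum_i T i b ^+ 2.
have s20 : 0 <= s2 by apply: sumr_ge0 => i _; exact: sqr_ge0.
have [s0|sn0] := eqVneq s2 0.
  have Tb i : T i b = 0.
    apply/eqP; rewrite -sqrf_eq0; move/eqP: s0; rewrite psumr_eq0 => [|j _]; last exact: sqr_ge0.
    by move=> /allP/(_ i (mem_index_enum _)).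
  rewrite s0 (eq_integral (cst 0%E)) ?integral_cst_probability// => g _ /=.
  by rewrite /dot big1 ?expr0n// => i _; rewrite Tb mulr0.
have s2p : 0 < s2 by rewrite lt_neqAle eq_sym sn0.
rewrite (eq_integral (fun g => s2%:E * ((dot (T^~ b) g / Num.sqrt s2) ^+ 2)%:E)%E); last first.
  move=> g _; rewrite -EFinM expr_div_n sqr_sqrtr// mulrCA divff ?mulr1//.
have md' : measurable_fun [set: l.-tuple RT] (fun g => ((dot (T^~ b) g / Num.sqrt s2) ^+ 2)%:E).
  apply/measurable_EFinP; apply: measurable_funX; apply: measurable_funM => //.
  exact: measurable_dot.
rewrite (ge0_integralZT _ s20 md' (fun g => sqr_ge0 _)).
rewrite (integral_dot_scale m2 (fun x => sqr_ge0 _) s2p).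
by rewrite -[leRHS]mule1 lee_wpmul2l// ?lee_fin// integral_gauss_sqr_le1.
Qed.

(** The ratio is a convex combination of squares of standard Gaussians, one per normalized column;
    they may be dependent, and Jensen makes their joint law irrelevant. The exponent 3/8 is (1 -
    s^-2) / 2 at s = 2, where the integral is 2. *)
Lemma integral_exp_sqnorm_row_le l c (T : 'M[R]_(l, c)) :
  (\int[gauss_vec R l]_g (expR (3 / 8 * (sqnorm (row_of_tuple g *m T) / sqnorm T)))%:E
    <= 2%:E)%E.
Proof.
have [T0|Tn0] := eqVneq (sqnorm T) 0.
  under eq_integral do rewrite T0 invr0 mulr0 mulr0 expR0.
  by rewrite integral_cst_probability lee_fin ler1n.
have Tp : 0 < sqnorm T by rewrite lt_neqAle eq_sym Tn0 sqnorm_ge0.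
pose s2 b := \sum_i T i b ^+ 2.
have s20 b : 0 <= s2 b by apply: sumr_ge0 => i _; exact: sqr_ge0.
pose w b := s2 b / sqnorm T.
have w0 b : 0 <= w b by rewrite divr_ge0 ?sqnorm_ge0.
have w1 : \sum_b w b = 1 by rewrite -mulr_suml /s2 -sqnorm_cols divff.
have Tb b i : s2 b = 0 -> T i b = 0.
  move=> s0; apply/eqP; rewrite -sqrf_eq0; move/eqP: s0; rewrite psumr_eq0 => [|j _]; last exact: sqr_ge0.
  by move=> /allP/(_ i (mem_index_enum _)).
pose f b g := expR (3 / 8 * (dot (T^~ b) g / Num.sqrt (s2 b)) ^+ 2).
have mf b : measurable_fun [set: l.-tuple RT] (fun g => (f b g)%:E).
  apply/measurable_EFinP; apply: measurableT_comp => //; apply: measurable_funM => //.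
  by apply: measurable_funX; apply: measurable_funM => //; exact: measurable_dot.
have f0 b g : (0 <= (f b g)%:E)%E by rewrite lee_fin expR_ge0.
apply: (@le_trans _ _ (\int[gauss_vec R l]_g \sum_b ((w b)%:E * (f b g)%:E))%E).
  apply: ge0_le_integralT.
  - apply/measurable_EFinP; apply: measurableT_comp => //; apply: measurable_funM => //.
    by apply: measurable_funM => //; exact: measurable_sqnorm_row_mul.
  - by move=> g; rewrite lee_fin expR_ge0.
  - by apply: emeasurable_sum => b; apply: emeasurable_funM.
  - move=> g; under eq_bigr do rewrite -EFinM.
    rewrite sumEFin lee_fin; apply: le_trans (jensen_expR _ w0 w1).
    rewrite ler_expR le_eqVlt; apply/orP; left; apply/eqP.
    rewrite sqnorm_row_of_tuple mulr_suml mulr_sumr; apply: eq_bigr => b _; rewrite /w.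
    have [s0|sn0] := eqVneq (s2 b) 0.
      rewrite s0 mul0r mul0r /dot big1 ?expr0n/= ?mul0r ?mulr0// => i _.
      by rewrite Tb// mulr0.
    by rewrite expr_div_n sqr_sqrtr//; field; rewrite Tn0 sn0.
have mwf b : measurable_fun [set: l.-tuple RT] (fun g => ((w b)%:E * (f b g)%:E)%E).
  exact: emeasurable_funM.
have wf0 b g : (0 <= (w b)%:E * (f b g)%:E)%E.
  by apply: mule_ge0; rewrite // lee_fin.
rewrite (ge0_integral_sumT _ mwf wf0).
apply: (@le_trans _ _ (\sum_b ((w b)%:E * 2%:E))%E).
  apply: lee_sum => b _; rewrite (ge0_integralZT _ (w0 b) (mf b) (f0 b)).
  apply: lee_wpmul2l; first by rewrite lee_fin.
  have [s0|sn0] := eqVneq (s2 b) 0.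
    rewrite (eq_integral (cst 1%E)) ?integral_cst_probability ?lee_fin ?ler1n// => g _ /=.
    by rewrite /f s0 sqrtr0 invr0 mulr0 expr0n mulr0 expR0.
  have s2p : 0 < s2 b by rewrite lt_neqAle eq_sym sn0 s20.
  have mh : measurable_fun [set: RT] (fun x : RT => (expR (3 / 8 * x ^+ 2))%:E).
    have mx2 : measurable_fun [set: RT] (fun x : RT => 3 / 8 * x ^+ 2 : RT).
      by apply: measurable_funM => //; exact: measurable_funX.
    by apply/measurable_EFinP; apply: (measurableT_comp _ mx2) => //; exact: measurable_expR.
  rewrite /f (@integral_dot_scale l (T^~ b) (fun x => (expR (3 / 8 * x ^+ 2))%:E) mh) //.
  have := @integral_gauss_exp_sqr R 2 (ltr0n _ 2).
  have -> : (1 - 2 ^- 2) / 2 = 3 / 8 :> R by field.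
  by move=> ->.
by under eq_bigr do rewrite -EFinM; rewrite sumEFin -mulr_suml w1 mul1r.
Qed.

End gaussian_row_functionals.

Section gaussian_gram.
Context (R : realType) d (T : measurableType d) (P : probability T R) (r l : nat).
Variable G : T -> 'M[R]_(r, l).
Hypothesis gG : standard_gaussian_matrix P G.
Local Notation RT := (measurableTypeR R).

Lemma measurable_gaussian_matrix : measurable_mx G.
Proof.
move=> i j; have [+ _] := gG => /(_ j) [+ _] => /(_ i) [mG _].
by apply: (eq_measurable_fun _ _ mG) => w _; rewrite tnth_mktuple.
Qed.

Let mG := measurable_gaussian_matrix.

Let mHG k (H : 'M[R]_(k, r)) : measurable_mx (fun t => H *m G t).
Proof. by apply: measurable_mx_mul => //; exact: measurable_mx_cst. Qed.

Section moments.
Variables (k : nat) (H : 'M[R]_(k, r)).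
Hypothesis uH : H *m H^T \in unitmx.
Hypothesis k0 : (0 < k)%N.
Let tau := \tr (invmx (H *m H^T)).

Lemma trace_gram_inv_gt0 : 0 < tau.
Proof.
rewrite /tau /mxtrace (bigD1 (Ordinal k0))//= ltr_pwDl ?gram_inv_diag_gt0//.
by apply: sumr_ge0 => i _; rewrite ltW// gram_inv_diag_gt0.
Qed.

(** The trace is the mean of (tau / o_i) z_i with weights o_i / tau. The bound for row [i] is
    homogeneous of degree (m + 2) / 2 in o_i, so after this rescaling all terms obey the same bound,
    with tau in place of o_i. *)
Lemma trace_ridge_moment_le (e : R) m n : 0 <= e -> (k.-1 + (m + n.+3) <= l)%N ->
  (\int[P]_t (Num.sqrt (\tr (ridge_inv e (H *m G t))) ^+ m.+2)%:E <=
   (moment_const R m * (Num.sqrt (tau / 2) ^+ m * (tau / n.+1%:R)))%:E)%E.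
Proof.
move=> e0 kml; have tau0 := trace_gram_inv_gt0.
pose o i := invmx (H *m H^T) i i.
have o0 i : 0 < o i := gram_inv_diag_gt0 uH i.
pose w i := o i / tau.
have w0 i : 0 <= w i by rewrite divr_ge0// ltW.
have w1 : \sum_i w i = 1 by rewrite -mulr_suml divff// gt_eqF.
pose z t i := ridge_inv e (H *m G t) i i.
have z0 t i : 0 <= z t i by exact: ridge_inv_diag_ge0.
pose c i := w i * Num.sqrt (tau / o i) ^+ m.+2.
have c0 i : 0 <= c i by rewrite mulr_ge0// exprn_ge0// sqrtr_ge0.
have mz i : measurable_fun [set: T] (fun t => (Num.sqrt (z t i) ^+ m.+2)%:E).
  by apply/measurable_EFinP/measurable_funX/measurable_fun_sqrt/measurable_ridge_inv.
have zp0 i t : (0 <= (Num.sqrt (z t i) ^+ m.+2)%:E)%E by rewrite lee_fin exprn_ge0// sqrtr_ge0.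
have mcz i : measurable_fun [set: T] (fun t => ((c i)%:E * (Num.sqrt (z t i) ^+ m.+2)%:E)%E).
  exact: emeasurable_funM.
have cz0 i t : (0 <= (c i)%:E * (Num.sqrt (z t i) ^+ m.+2)%:E)%E.
  by apply: mule_ge0 (zp0 i t); rewrite lee_fin; exact: c0.
apply: (@le_trans _ _ (\int[P]_t \sum_i ((c i)%:E * (Num.sqrt (z t i) ^+ m.+2)%:E))%E).
  apply: ge0_le_integralT.
  - apply/measurable_EFinP/measurable_funX/measurable_fun_sqrt/measurable_mx_trace.
    exact: measurable_ridge_inv.
  - by move=> t; rewrite lee_fin exprn_ge0// sqrtr_ge0.
  - exact: emeasurable_sum.
  - move=> t; under eq_bigr do rewrite -EFinM.
    rewrite sumEFin lee_fin.
    have x0 i : 0 <= tau / o i * z t i by rewrite mulr_ge0// divr_ge0// ltW.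
    have := jensen_sqrt_pow m w0 w1 x0.
    have -> : \sum_i w i * (tau / o i * z t i) = \tr (ridge_inv e (H *m G t)).
      apply: eq_bigr => i _; rewrite /w /z; field.
      by rewrite !gt_eqF.
    move=> /le_trans; apply; apply: ler_sum => i _.
    by rewrite sqrtrM ?(divr_ge0 (ltW tau0) (ltW (o0 i)))// exprMn mulrA.
rewrite (ge0_integral_sumT _ mcz cz0).
pose b := moment_const R m * (Num.sqrt (tau / 2) ^+ m * (tau / n.+1%:R)).
apply: (@le_trans _ _ (\sum_i (w i * b)%:E)%E); last first.
  by rewrite sumEFin -mulr_suml w1 mul1r.
apply: lee_sum => i _; rewrite (ge0_integralZT _ (c0 i) (mz i) (zp0 i)).
apply: le_trans (lee_wpmul2l _ (@ridge_moment_le R _ T P r l k G H e (o i) i m n gG uH e0 kml erefl)) _.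
  by rewrite lee_fin.
rewrite -EFinM lee_fin le_eqVlt; apply/orP; left; apply/eqP; rewrite /c /b -mulrA; congr (_ * _).
rewrite -addn2 exprD (sqr_sqrtr (divr_ge0 (ltW tau0) (ltW (o0 i)))).
have -> : tau / 2 = tau / o i * (o i / 2) by field; rewrite gt_eqF.
rewrite [in RHS]sqrtrM ?(divr_ge0 (ltW tau0) (ltW (o0 i)))// exprMn; field.
by rewrite addrC natr1 pnatr_eq0 (gt_eqF (o0 i)).
Qed.

Lemma integral_trace_ridge_le (e : R) n : 0 <= e -> (k.-1 + n.+3 <= l)%N ->
  (\int[P]_t (\tr (ridge_inv e (H *m G t)))%:E <= (tau / n.+1%:R)%:E)%E.
Proof.
move=> e0 kl; have := @trace_ridge_moment_le e 0 n e0 kl.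
rewrite /moment_const mul0r expR0 !expr0 divr1 !mul1r; apply: le_trans.
rewrite le_eqVlt; apply/orP; left; apply/eqP; apply: eq_integral => t _.
rewrite sqr_sqrtr//; apply: sumr_ge0 => i _; exact: ridge_inv_diag_ge0.
Qed.

Definition singular_event : set T := [set t | \det (H *m G t *m (H *m G t)^T) = 0].

Lemma measurable_singular_event : measurable singular_event.
Proof.
have mD : measurable_fun [set: T] (fun t => \det (H *m G t *m (H *m G t)^T)).
  by apply/measurable_mx_det/measurable_mx_mul => //; exact: measurable_mx_tr.
by have := mD measurableT _ (measurable_set1 0); rewrite setTI.
Qed.

(* A singular Gram matrix forces [e^-1 <= \tr (ridge_inv e (H G))], whose
   expectation is bounded uniformly in [e]. *)
Lemma singular_event_null : (k.-1 + 3 <= l)%N -> P singular_event = 0%E.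
Proof.
move=> kl; set x := fine (P singular_event).
have Px : P singular_event = x%:E.
  by rewrite fineK//; apply: fin_num_measure; exact: measurable_singular_event.
have x0 : 0 <= x by rewrite fine_ge0.
rewrite Px; congr EFin; apply/eqP; move: x0; rewrite le_eqVlt => /orP[/eqP -> //|x0].
exfalso.
have tau0 := trace_gram_inv_gt0.
(* With this ridge, Markov gives at least e^-1 x = 2 tau for an expectation bounded by tau. *)
have e0 : 0 < x / (2 * tau) by rewrite divr_gt0// mulr_gt0.
have := @integral_trace_ridge_le (x / (2 * tau)) 0 (ltW e0) kl; rewrite divr1.
apply/negP; rewrite -ltNge.
have h : (((x / (2 * tau))^-1)%:E * P singular_event <=
    \int[P]_t (\tr (ridge_inv (x / (2 * tau)) (H *m G t)))%:E)%E.
  apply: (markov_set_le P measurable_singular_event).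
  - by rewrite invr_ge0 ltW.
  - by apply/measurable_mx_trace/measurable_ridge_inv.
  - by move=> t; apply: sumr_ge0 => i _; exact: ridge_inv_diag_ge0 (ltW e0) _.
  - by move=> t st; apply: trace_ridge_inv_nonunit => //; rewrite unitmxE unitfE st eqxx.
apply: lt_le_trans h; rewrite Px -EFinM lte_fin.
have -> : (x / (2 * tau))^-1 * x = 2 * tau by field; rewrite !gt_eqF.
by rewrite mulr_natl mulr2n ltrDl.
Qed.

End moments.
End gaussian_gram.

Lemma measurable_set_ltr (R : realType) d (X : measurableType d) (f g : X -> R) :
  measurable_fun [set: X] f -> measurable_fun [set: X] g -> measurable [set x | f x < g x].
Proof.
move=> mf mg; have mT : measurable [set true] by [].
by have := measurable_fun_ltr mf mg measurableT mT; rewrite setTI.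
Qed.

Section orthogonal_part.
Context (R : realType) d (T : measurableType d) (P : probability T R) (r l k : nat).
Variables (G : T -> 'M[R]_(r, l)) (H : 'M[R]_(k, r)).
Hypothesis gG : standard_gaussian_matrix P G.
Local Notation RT := (measurableTypeR R).

(* The Moore-Penrose inverse of a matrix with independent rows, and [0] otherwise. *)
Definition safe_pinv (M : 'M[R]_(k, l)) : 'M[R]_(l, k) := (ridge_inv 0 M *m M)^T.

Lemma safe_pinv_unit (M : 'M[R]_(k, l)) : M *m M^T \in unitmx -> safe_pinv M = pinv_free M.
Proof.
move=> uM; have K0 : M *m M^T + 0%:M = M *m M^T.
  by apply/matrixP => i j; rewrite [LHS]mxE [X in _ + X]mxE mul0rn addr0.
rewrite /safe_pinv /ridge_inv K0 safe_inv_unit// trmx_mul trmx_inv.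
by rewrite trmx_mul trmxK.
Qed.

Lemma sqnorm_safe_pinv (M : 'M[R]_(k, l)) : sqnorm (safe_pinv M) = \tr (ridge_inv 0 M).
Proof.
by rewrite [in RHS]ridge_inv_unfold scale0r addr0 sqnorm_trmx -sqnorm_tr.
Qed.

Lemma measurable_safe_pinv d' (X : measurableType d') (M : X -> 'M[R]_(k, l)) :
  measurable_mx M -> measurable_mx (fun x => safe_pinv (M x)).
Proof.
move=> mM; apply: measurable_mx_tr; apply: measurable_mx_mul => //.
exact: measurable_ridge_inv.
Qed.

(* For [p] orthogonal to the rows of [H], the row [p G] is standard Gaussian and
   independent of [H G]. *)
Lemma gaussian_orthogonal_row_le (p : 'rV[R]_r) (F : 'rV[R]_l -> 'M[R]_(k, l) -> R)
    (F' : 'M[R]_(k, l) -> R) :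
  sqnorm p = 1 -> H *m p^T = 0 ->
  (forall d' (X : measurableType d') (v : X -> 'rV[R]_l) (M : X -> 'M[R]_(k, l)),
    measurable_mx v -> measurable_mx M -> measurable_fun [set: X] (fun x => F (v x) (M x))) ->
  (forall d' (X : measurableType d') (M : X -> 'M[R]_(k, l)),
    measurable_mx M -> measurable_fun [set: X] (fun x => F' (M x))) ->
  (forall v M, 0 <= F v M) -> (forall M, 0 <= F' M) ->
  (forall M, \int[gauss_vec R l]_g (F (row_of_tuple g) M)%:E <= (F' M)%:E)%E ->
  (\int[P]_w (F (p *m G w) (H *m G w))%:E <= \int[P]_w (F' (H *m G w))%:E)%E.
Proof.
move=> p1 Hp mF mF' F0 F'0 FF'.
have pp : p *m p^T = 1%:M by apply/matrixP => a b; rewrite !ord1 sqnorm_row p1 mxE.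
have mul d' (X : measurableType d') q (Q : 'M[R]_(q, r)) (M : X -> 'M[R]_(r, l)) :
    measurable_mx M -> measurable_mx (fun x => Q *m M x).
  by move=> mM; apply: measurable_mx_mul => //; exact: measurable_mx_cst.
pose E (M : 'M[R]_(r, l)) := F (p *m M) (H *m M); pose E' (M : 'M[R]_(r, l)) := F' (H *m M).
apply: (@gaussian_matrix_conditional_le R _ T P r l G p (EFin \o E) (EFin \o E') gG p1).
- by apply: measurable_comp_cols => d' X M mM; apply: mF; exact: mul.
- by apply: measurable_comp_cols => d' X M mM; apply: mF'; exact: mul.
- by move=> M; rewrite lee_fin F0.
- by move=> M; rewrite lee_fin F'0.
- move=> M /=; apply: le_trans (FF' (H *m M)); rewrite le_eqVlt; apply/orP; left; apply/eqP.
  apply: eq_integral => g _; rewrite /E; set v := row_of_tuple g - _.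
  rewrite (mulmxDr H) (mulmxDr p) (mulmxA H) (mulmxA p p^T) Hp pp mul0mx mul1mx addr0.
  by rewrite /v addrC subrK.
Qed.

Section matrix_functionals.
Variables (m : nat) (S : 'M[R]_(m, r)).
Hypothesis SH : S *m H^T = 0.
Let D w := safe_pinv (H *m G w).

Let mG := measurable_gaussian_matrix gG.

Let mHG : measurable_mx (fun w => H *m G w).
Proof. by apply: measurable_mx_mul => //; exact: measurable_mx_cst. Qed.

Let mD : measurable_mx D.
Proof. exact: measurable_safe_pinv. Qed.

Let p a : 'rV[R]_r := (Num.sqrt (sqnorm (row a S)))^-1 *: row a S.

Let sqnorm_p a : sqnorm (row a S) != 0 -> sqnorm (p a) = 1.
Proof.
by move=> s0; rewrite sqnormZ exprVn sqr_sqrtr ?sqnorm_ge0// mulVf.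
Qed.

Let Hp a : H *m (p a)^T = 0.
Proof.
rewrite linearZ /= -scalemxAr -[H *m _]trmxK trmx_mul trmxK -row_mul SH.
by rewrite row0 trmx0 scaler0.
Qed.

Let sqnorm_rows q (M : 'M[R]_(r, q)) :
  sqnorm (S *m M) = \sum_a sqnorm (row a S) * sqnorm (p a *m M).
Proof.
rewrite {1}/sqnorm; apply: eq_bigr => a _.
have -> : \sum_j (S *m M) a j ^+ 2 = sqnorm (row a S *m M).
  by rewrite -row_mul /sqnorm big_ord1; apply: eq_bigr => j _; rewrite [in RHS]mxE.
have [s0|s0] := eqVneq (sqnorm (row a S)) 0.
  by rewrite s0 mul0r (sqnorm_eq0 s0) mul0mx sqnorm0.
by rewrite /p -scalemxAl sqnormZ exprVn sqr_sqrtr ?sqnorm_ge0// mulrA mulfV// mul1r.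
Qed.

Let sum_sqnorm_rows : \sum_a sqnorm (row a S) = sqnorm S.
Proof.
rewrite {2}/sqnorm; apply: eq_bigr => a _.
by rewrite /sqnorm big_ord1; apply: eq_bigr => j _; rewrite mxE.
Qed.

(** Each nonzero row of [S] is a multiple of a unit vector orthogonal to the rows of [H]. Given H G,
    its product with G is a fresh Gaussian row, whose second moment against [D] is at most |D|^2. *)
Lemma integral_sqnorm_orthogonal_le :
  (\int[P]_w (sqnorm (S *m G w *m D w))%:E <=
   (sqnorm S)%:E * \int[P]_w (sqnorm (D w))%:E)%E.
Proof.
have mpD a : measurable_fun [set: T] (fun w => (sqnorm (p a *m G w *m D w))%:E).
  apply/measurable_EFinP/measurable_mx_sqnorm/measurable_mx_mul => //.
  by apply: measurable_mx_mul => //; exact: measurable_mx_cst.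
have s0 a : 0 <= sqnorm (row a S) := sqnorm_ge0 _.
have pD0 a w : (0 <= (sqnorm (p a *m G w *m D w))%:E)%E by rewrite lee_fin sqnorm_ge0.
have mspD a : measurable_fun [set: T]
    (fun w => ((sqnorm (row a S))%:E * (sqnorm (p a *m G w *m D w))%:E)%E).
  exact: emeasurable_funM.
have spD0 a w : (0 <= (sqnorm (row a S))%:E * (sqnorm (p a *m G w *m D w))%:E)%E.
  by rewrite -EFinM lee_fin mulr_ge0 ?sqnorm_ge0.
under eq_integral => w _.
  rewrite -mulmxA sqnorm_rows -sumEFin.
  under eq_bigr do rewrite EFinM mulmxA.
  over.
rewrite (ge0_integral_sumT _ mspD spD0) -sum_sqnorm_rows -sumEFin.
rewrite ge0_sume_distrl; last by move=> a _; rewrite lee_fin.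
apply: lee_sum => a _; rewrite (ge0_integralZT _ (s0 a) (mpD a) (pD0 a)).
have [->|sn0] := eqVneq (sqnorm (row a S)) 0; first by rewrite !mul0e.
apply: lee_wpmul2l; first by rewrite lee_fin.
apply: (@gaussian_orthogonal_row_le (p a) (fun v M => sqnorm (v *m safe_pinv M))
  (fun M => sqnorm (safe_pinv M))) => //.
- exact: sqnorm_p.
- move=> d' X v M mv mM; apply: measurable_mx_sqnorm; apply: measurable_mx_mul => //.
  exact: measurable_safe_pinv.
- by move=> d' X M mM; apply: measurable_mx_sqnorm; exact: measurable_safe_pinv.
- by move=> v M; exact: sqnorm_ge0.
- by move=> M; exact: sqnorm_ge0.
- by move=> M; exact: integral_sqnorm_row_le.
Qed.

(** Jensen over the rows of [S], with weights their shares of |S|^2, reduces to one unit row, where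
    the bound 2 holds conditionally on H G. *)
Lemma integral_exp_sqnorm_orthogonal_le :
  (\int[P]_w (expR (3 / 8 * (sqnorm (S *m G w *m D w) / (sqnorm S * sqnorm (D w)))))%:E
    <= 2%:E)%E.
Proof.
have [S0|Sn0] := eqVneq (sqnorm S) 0.
  under eq_integral do rewrite S0 mul0r invr0 mulr0 mulr0 expR0.
  by rewrite integral_cst_probability lee_fin ler1n.
pose w a := sqnorm (row a S) / sqnorm S.
have w0 a : 0 <= w a by rewrite divr_ge0 ?sqnorm_ge0.
have w1 : \sum_a w a = 1 by rewrite -mulr_suml sum_sqnorm_rows divff.
pose f a t := expR (3 / 8 * (sqnorm (p a *m G t *m D t) / sqnorm (D t))).
have mratio c (v : 'M[R]_(c, r)) (z : R) : measurable_fun [set: T]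
    (fun t => expR (3 / 8 * (sqnorm (v *m G t *m D t) / (z * sqnorm (D t))))).
  have h : measurable_fun [set: T]
      (fun t => 3 / 8 * (sqnorm (v *m G t *m D t) / (z * sqnorm (D t))) : RT).
    apply: measurable_funM => //; apply: measurable_funM.
      apply: measurable_mx_sqnorm; apply: measurable_mx_mul => //.
      by apply: measurable_mx_mul => //; exact: measurable_mx_cst.
    apply: (measurableT_comp (@measurable_invr R)); apply: measurable_funM => //.
    exact: measurable_mx_sqnorm.
  by apply: (measurableT_comp _ h); exact: measurable_expR.
have mf a : measurable_fun [set: T] (fun t => (f a t)%:E).
  apply/measurable_EFinP; have := mratio _ (p a) 1.
  by under eq_fun do rewrite mul1r.
have f0 a t : (0 <= (f a t)%:E)%E by rewrite lee_fin expR_ge0.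
have mwf a : measurable_fun [set: T] (fun t => ((w a)%:E * (f a t)%:E)%E).
  exact: emeasurable_funM.
have wf0 a t : (0 <= (w a)%:E * (f a t)%:E)%E.
  by apply: mule_ge0; rewrite // lee_fin.
apply: (@le_trans _ _ (\int[P]_t \sum_a ((w a)%:E * (f a t)%:E))%E).
  apply: ge0_le_integralT.
  - exact/measurable_EFinP/mratio.
  - by move=> t; rewrite lee_fin expR_ge0.
  - exact: emeasurable_sum.
  - move=> t; under eq_bigr do rewrite -EFinM.
    rewrite sumEFin lee_fin; apply: le_trans (jensen_expR _ w0 w1).
    rewrite ler_expR le_eqVlt; apply/orP; left; apply/eqP.
    rewrite -mulmxA sqnorm_rows mulr_suml mulr_sumr; apply: eq_bigr => a _.
    by rewrite /w invfM mulmxA; ring.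
rewrite (ge0_integral_sumT _ mwf wf0).
apply: (@le_trans _ _ (\sum_a ((w a)%:E * 2%:E))%E); last first.
  by under eq_bigr do rewrite -EFinM; rewrite sumEFin -mulr_suml w1 mul1r.
apply: lee_sum => a _; rewrite (ge0_integralZT _ (w0 a) (mf a) (f0 a)).
apply: lee_wpmul2l; first by rewrite lee_fin.
have [s0|sn0] := eqVneq (sqnorm (row a S)) 0.
  rewrite (eq_integral (cst 1%E)) ?integral_cst_probability ?lee_fin ?ler1n// => t _ /=.
  rewrite /f /p (sqnorm_eq0 s0) scaler0 !mul0mx.
  by rewrite sqnorm0 mul0r mulr0 expR0.
rewrite -[leRHS](integral_cst_probability P).
apply: (@gaussian_orthogonal_row_le (p a)
  (fun v M => expR (3 / 8 * (sqnorm (v *m safe_pinv M) / sqnorm (safe_pinv M))))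
  (fun=> 2)) => //.
- exact: sqnorm_p.
- move=> d' X v M mv mM; have mM' := measurable_safe_pinv mM.
  have h : measurable_fun [set: X]
      (fun t => 3 / 8 * (sqnorm (v t *m safe_pinv (M t)) / sqnorm (safe_pinv (M t))) : RT).
    apply: measurable_funM => //; apply: measurable_funM.
      by apply: measurable_mx_sqnorm; exact: measurable_mx_mul.
    apply: (measurableT_comp (@measurable_invr R)); exact: measurable_mx_sqnorm.
  by apply: (measurableT_comp _ h); exact: measurable_expR.
- by move=> M; exact: integral_exp_sqnorm_row_le.
Qed.

(** On the event the exponent is at least 3 u^2 / 2, so the probability is at most 2 exp (- 3 u^2 /
    2). The factor 2 is absorbed by 2 <= 1 + u^2 <= exp (u^2). *)
Lemma orthogonal_tail (u : R) : 1 <= u ->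
  (P [set w | (4 * u ^+ 2 * (sqnorm S * sqnorm (D w)) < sqnorm (S *m G w *m D w))%R]
    <= (expR (- (u ^+ 2 / 2)))%:E)%E.
Proof.
move=> u1; set A := [set w | _].
have mSGD : measurable_fun [set: T] (fun w => sqnorm (S *m G w *m D w)).
  apply: measurable_mx_sqnorm; apply: measurable_mx_mul => //.
  by apply: measurable_mx_mul => //; exact: measurable_mx_cst.
have mA : measurable A.
  apply: measurable_set_ltr => //.
  apply: measurable_funM => //; apply: measurable_funM => //.
  exact: measurable_mx_sqnorm.
have u2 : 1 <= u ^+ 2 by exact: exprn_ege1.
pose f w := expR (3 / 8 * (sqnorm (S *m G w *m D w) / (sqnorm S * sqnorm (D w)))).
have mf : measurable_fun [set: T] f.
  have h : measurable_fun [set: T]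
      (fun t => 3 / 8 * (sqnorm (S *m G t *m D t) / (sqnorm S * sqnorm (D t))) : RT).
    apply: measurable_funM => //; apply: measurable_funM => //.
    apply: (measurableT_comp (@measurable_invr R)); apply: measurable_funM => //.
    exact: measurable_mx_sqnorm.
  by apply: (measurableT_comp _ h); exact: measurable_expR.
have Af w : A w -> expR (3 / 2 * u ^+ 2) <= f w.
  rewrite /A /= => hw; rewrite ler_expR.
  (* If the denominator vanished, S G D would vanish too and the strict inequality of the event
     would fail; so the ratio is a genuine quotient on the event. *)
  have b0 : 0 < sqnorm S * sqnorm (D w).
    rewrite lt_neqAle mulr_ge0 ?sqnorm_ge0// andbT eq_sym.
    apply: contraTN hw => /eqP b0; rewrite b0 mulr0 -leNgt.
    move/eqP: b0; rewrite mulf_eq0 => /orP[] /eqP/sqnorm_eq0 ->.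
      by rewrite !mul0mx sqnorm0.
    by rewrite mulmx0 sqnorm0.
  have : 4 * u ^+ 2 <= sqnorm (S *m G w *m D w) / (sqnorm S * sqnorm (D w)).
    by rewrite ler_pdivlMr// ltW.
  lra.
have := markov_set_le P mA (expR_ge0 (3 / 2 * u ^+ 2)) mf (fun w => expR_ge0 _) Af.
move=> /le_trans/(_ integral_exp_sqnorm_orthogonal_le).
have PA : P A = (fine (P A))%:E by rewrite fineK//; exact: fin_num_measure.
rewrite PA -EFinM !lee_fin => h.
have x0 : 0 <= fine (P A) by rewrite fine_ge0.
have e2 : 2 <= expR (u ^+ 2).
  by apply: le_trans (expR_ge1Dx _); lra.
have eE : expR (3 / 2 * u ^+ 2) = expR (u ^+ 2) * expR (u ^+ 2 / 2).
  by rewrite -expRD; congr expR; field.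
rewrite expRN -[leRHS]mul1r ler_pdivlMr ?expR_gt0//.
rewrite eE in h; have := expR_gt0 (u ^+ 2 / 2); nra.
Qed.

End matrix_functionals.
End orthogonal_part.

(** * Numerical inequalities behind the tail constants *)

Section moment_numerics.
Context (R : realType).

(** From exp (- 1/6) >= 5/6 one gets e <= (6/5)^6, which is just below 3. *)
Lemma expR1_le3 : expR 1 <= 3 :> R.
Proof.
have h : 5 / 6 <= expR (- (1 / 6)) :> R.
  by apply: le_trans (expR_ge1Dx _); lra.
have e6 : expR 1 * expR (- (1 / 6)) ^+ 6 = 1 :> R.
  have -> : expR (- (1 / 6)) ^+ 6 = expR (- 1) :> R.
    by rewrite -expRM_natl; congr expR; field.
  by rewrite expRN divff// gt_eqF ?expR_gt0.
have : (5 / 6 : R) ^+ 6 <= expR (- (1 / 6)) ^+ 6.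
  by rewrite lerXn2r ?nnegrE ?expR_ge0//; lra.
move=> /(ler_wpM2l (expR_ge0 (1 : R))); rewrite e6.
have x0 : 26 / 45 <= (5 / 6) ^+ 3 :> R by lra.
rewrite (exprM _ 3 2); set x := (5 / 6) ^+ 3 in x0 *.
have := expR_gt0 (1 : R); nra.
Qed.

(** With M = m + 5 this reads 27 3^M (M + 3)^2 <= (13/2)^(M + 2). It fails at M = 4, hence the shift
    by 5 and the separate treatment of 2, 3 and 4 below. *)
Let pow_bound (m : nat) :
  3 ^+ (m + 8) * (m%:R + 8) ^+ 2 <= (13 / 2) ^+ (m + 7) :> R.
Proof.
elim: m => [|m IHm]; first by rewrite !add0n add0r; lra.
rewrite !addSn !exprS -[m.+1%:R]natr1; set x : R := m%:R.
have x0 : 0 <= x by exact: ler0n.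
have h : 3 * (x + 1 + 8) ^+ 2 <= 13 / 2 * (x + 8) ^+ 2 by nra.
have := ler_wpM2l (exprn_ge0 (m + 8) (ler0n R 3)) h.
have : 0 <= (13 / 2 : R) by lra.
move=> /ler_wpM2l/(_ _ _ IHm); rewrite -/x.
by set a := 3 ^+ _; set b := (13 / 2) ^+ _; lra.
Qed.

(* [(m + 3)^m <= e^3 m^m]; the finitely many [m] for which this is too weak are
   checked directly. *)
Lemma expR_moment_bound (m : nat) : (2 <= m)%N ->
  expR m%:R * (m%:R + 3) ^+ m.+2 <= (13 / 2) ^+ m.+2 * m%:R ^+ m :> R.
Proof.
move=> m2; have e3 : expR m%:R <= 3 ^+ m :> R.
  by rewrite -[m%:R]mulr1 expRM_natl lerXn2r ?nnegrE ?expR_ge0 ?expR1_le3.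
apply: le_trans (ler_wpM2r _ e3) _; first by rewrite exprn_ge0// addr_ge0.
case: m m2 {e3} => [|[|[|[|[|m]]]]]// _; [lra|lra|lra|].
set M := m.+4.+1; have M0 : 0 < M%:R :> R by [].
have h1 : (M%:R + 3) ^+ M <= 27 * M%:R ^+ M :> R.
  have -> : M%:R + 3 = M%:R * (1 + 3 / M%:R) :> R by field; rewrite gt_eqF.
  rewrite exprMn mulrC ler_wpM2r ?exprn_ge0//.
  have : (1 + 3 / M%:R) ^+ M <= expR (3 / M%:R) ^+ M :> R.
    by rewrite lerXn2r ?nnegrE ?expR_ge0 ?expR_ge1Dx// addr_ge0// divr_ge0.
  move=> /le_trans; apply; rewrite -expRM_natl mulrCA divff ?gt_eqF// mulr1.
  have -> : 3 = 3%:R * 1 :> R by rewrite mulr1.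
  rewrite expRM_natl; apply: (@le_trans _ _ (3 ^+ 3)); last by lra.
  by rewrite lerXn2r ?nnegrE ?expR_ge0 ?expR1_le3.
have h2 : 3 ^+ M * (M%:R + 3) ^+ 2 * 27 <= (13 / 2) ^+ M.+2 :> R.
  have := pow_bound m; rewrite -(addnC 7) -(addnC 8) /M.
  have -> : m.+4.+1%:R = m%:R + 5 :> R by rewrite -[m.+4.+1]/(5 + m)%N natrD addrC.
  rewrite -[(8 + m)%N]/(3 + m.+4.+1)%N exprD.
  have -> : (7 + m)%N = m.+4.+3 by [].
  set a := 3 ^+ m.+4.+1; set b := (13 / 2) ^+ _.
  have -> : m%:R + 5 + 3 = m%:R + 8 :> R by ring.
  have -> : (3 : R) ^+ 3 = 27 by ring.
  lra.
have -> : (M%:R + 3) ^+ M.+2 = (M%:R + 3) ^+ M * (M%:R + 3) ^+ 2 :> R by rewrite -exprD addn2.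
have := ler_wpM2r (exprn_ge0 M (ltW M0)) h2.
have h0 : 0 <= 3 ^+ M * (M%:R + 3) ^+ 2 :> R.
  by apply: mulr_ge0; [exact: exprn_ge0|exact: sqr_ge0].
have := ler_wpM2l h0 h1.
set a := 3 ^+ M; set b := (M%:R + 3) ^+ 2; set c := (M%:R + 3) ^+ M; set e := M%:R ^+ M.
by set f := (13 / 2) ^+ _; lra.
Qed.

(** Squaring removes the square roots and leaves [expR_moment_bound]. For m = l - k - 2 the
    denominator m + 3 is l - k + 1, and the right-hand side has the shape that Markov's inequality
    needs. *)
Lemma moment_const_le (m : nat) : (2 <= m)%N ->
  moment_const R m * Num.sqrt (1 / 2) ^+ m <= Num.sqrt (13 / 2 / (m%:R + 3)) ^+ m.+2.
Proof.
move=> m2; have m0 : 0 < m%:R :> R by rewrite ltr0n (leq_trans _ m2).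
have m3 : 0 < m%:R + 3 :> R by rewrite addr_gt0.
rewrite -ler_sqr ?nnegrE; last 2 first.
- by rewrite mulr_ge0 ?moment_const_ge0 ?exprn_ge0 ?sqrtr_ge0.
- exact: exprn_ge0 (sqrtr_ge0 _).
rewrite /moment_const exprMn expr_div_n !(exprAC _ _ 2) !sqr_sqrtr ?divr_ge0 ?(ltW m0) ?(ltW m3)//.
have -> : expR (m%:R / 2) ^+ 2 = expR m%:R :> R by rewrite -expRM_natl; congr expR; field.
have -> : expR m%:R / (m%:R / 2) ^+ m * (1 / 2) ^+ m = expR m%:R / m%:R ^+ m :> R.
  rewrite -mulrA; congr (_ * _); rewrite -!exprVn -exprMn; congr (_ ^+ _).
  by field; rewrite gt_eqF.
rewrite (expr_div_n (13 / 2)) ler_pdivrMr ?exprn_gt0//.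
rewrite mulrAC ler_pdivlMr ?exprn_gt0//.
exact: expR_moment_bound.
Qed.

End moment_numerics.

Section trace_tail.
Context (R : realType) d (T : measurableType d) (P : probability T R) (r l k : nat).
Variables (G : T -> 'M[R]_(r, l)) (H : 'M[R]_(k, r)).
Hypothesis gG : standard_gaussian_matrix P G.
Hypothesis uH : H *m H^T \in unitmx.
Hypothesis k0 : (0 < k)%N.
Let tau := \tr (invmx (H *m H^T)).

(** Markov's inequality for the power m + 2 = l - k of the root of the trace. All l - k + 1
    available columns are spent on this moment, which is the case n = 0 of
    [trace_ridge_moment_le]. *)
Lemma trace_gram_tail (t : R) : (k + 4 <= l)%N -> 1 <= t ->
  (P [set w | (13 / 2 * tau / (l%:R - k%:R + 1) * t ^+ 2 < \tr (ridge_inv 0 (H *m G w)))%R]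
    <= (t ^- (l - k))%:E)%E.
Proof.
move=> kl t1.
have [m lE m2] : exists2 m, (l - k = m.+2)%N & (2 <= m)%N.
  by exists (l - k - 2)%N; lia.
have -> : l%:R - k%:R + 1 = m%:R + 3 :> R.
  have -> : l = (m.+2 + k)%N by lia.
  by rewrite natrD -addn2 natrD; ring.
set A := [set w | _].
have tau0 : 0 < tau := trace_gram_inv_gt0 uH k0.
have mR : measurable_fun [set: T] (fun w => \tr (ridge_inv 0 (H *m G w))).
  apply: measurable_mx_trace; apply: measurable_ridge_inv; apply: measurable_mx_mul.
    exact: measurable_mx_cst.
  exact: measurable_gaussian_matrix gG.
have mA : measurable A by apply: measurable_set_ltr.
rewrite lE; have m3 : 0 < m%:R + 3 :> R by rewrite addr_gt0// ltr0n (leq_trans _ m2).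
pose b := Num.sqrt (13 / 2 / (m%:R + 3)) * Num.sqrt tau * t.
have t0 : 0 < t by exact: lt_le_trans t1.
have b0 : 0 < b by rewrite !mulr_gt0// sqrtr_gt0// divr_gt0.
have bE : Num.sqrt (13 / 2 * tau / (m%:R + 3) * t ^+ 2) = b.
  rewrite sqrtrM ?sqrtr_sqr ?(gtr0_norm t0) ?divr_ge0 ?mulr_ge0 ?(ltW tau0) ?(ltW m3)//.
  by rewrite mulrAC sqrtrM// divr_ge0// ltW.
have Ab w : A w -> b ^+ m.+2 <= Num.sqrt (\tr (ridge_inv 0 (H *m G w))) ^+ m.+2.
  move=> Aw; rewrite lerXn2r ?nnegrE ?sqrtr_ge0 ?(ltW b0)// -bE ler_sqrt ?(ltW Aw)//.
  by apply: sumr_ge0 => i _; exact: ridge_inv_diag_ge0.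
have kml : (k.-1 + (m + 0.+3) <= l)%N by lia.
have mS : measurable_fun [set: T] (fun w => Num.sqrt (\tr (ridge_inv 0 (H *m G w))) ^+ m.+2).
  by apply: measurable_funX; exact: measurable_fun_sqrt.
have bm0 : 0 <= b ^+ m.+2 by rewrite exprn_ge0 ?(ltW b0).
have := markov_set_le P mA bm0 mS (fun w => exprn_ge0 _ (sqrtr_ge0 _)) Ab.
move=> /le_trans/(_ (trace_ridge_moment_le gG uH k0 (lexx 0) kml)); rewrite -/tau divr1.
have PA : P A = (fine (P A))%:E by rewrite fineK//; exact: fin_num_measure.
rewrite PA -EFinM !lee_fin; set x := fine _.
have x0 : 0 <= x by rewrite fine_ge0.
have tau2 : Num.sqrt tau ^+ m.+2 = Num.sqrt tau ^+ m * tau by rewrite -addn2 exprD sqr_sqrtr ?(ltW tau0).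
have -> : moment_const R m * (Num.sqrt (tau / 2) ^+ m * tau) =
    moment_const R m * Num.sqrt (1 / 2) ^+ m * Num.sqrt tau ^+ m.+2.
  have -> : tau / 2 = 1 / 2 * tau by field.
  by rewrite sqrtrM ?divr_ge0// exprMn tau2; ring.
have tp : 0 < t ^+ m.+2 by rewrite exprn_gt0.
have sp : 0 < Num.sqrt tau ^+ m.+2 by rewrite exprn_gt0 ?sqrtr_gt0.
have bp : 0 < Num.sqrt (13 / 2 / (m%:R + 3)) ^+ m.+2 :> R by rewrite exprn_gt0 ?sqrtr_gt0 ?divr_gt0.
move=> /le_trans/(_ (ler_wpM2r (ltW sp) (moment_const_le R m2))).
rewrite /b !exprMn => h; rewrite -[leRHS]mul1r ler_pdivlMr// -(ler_pM2l (mulr_gt0 bp sp)).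
apply: le_trans _ (le_trans h _); rewrite le_eqVlt; apply/orP; left; apply/eqP; ring.
Qed.
End trace_tail.

(** * Expectation and tail of the residual *)

Section residual_estimates.
Context (R : realType) d (T : measurableType d) (P : probability T R).
Variables (m n k r l q : nat) (A : 'M[R]_(m, n)) (Vk : 'M[R]_(n, k)) (Vb : 'M[R]_(n, q)).
Variables (L : 'M[R]_(n, r)) (G : T -> 'M[R]_(r, l)).
Hypothesis VV : Vk *m Vk^T + Vb *m Vb^T = 1%:M.
Hypothesis Vk1 : Vk^T *m Vk = 1%:M.
Hypothesis Vb1 : Vb^T *m Vb = 1%:M.
Let H := Vk^T *m L.
Let H2 := A *m Vb *m Vb^T *m L.
Hypothesis uH : H *m H^T \in unitmx.
Hypothesis k0 : (0 < k)%N.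
Hypothesis gG : standard_gaussian_matrix P G.
Let tau := \tr (invmx (H *m H^T)).
Let err w := frobenius_norm ((1%:M - range_proj (A *m L *m G w)) *m A).
Let f := frobenius_norm (A *m Vb).
Let P2 := H2 *m pinv_free H *m H.
Let a := frobenius_norm P2.
Let S := orth_rows A Vk Vb L.
Let b := frobenius_norm S.
Let D w := safe_pinv (H *m G w).

Let tau0 : 0 < tau. Proof. exact: trace_gram_inv_gt0. Qed.
Let a0 : 0 <= a. Proof. exact: frobenius_norm_ge0. Qed.
Let b0 : 0 <= b. Proof. exact: frobenius_norm_ge0. Qed.
Let f0 : 0 <= f. Proof. exact: frobenius_norm_ge0. Qed.

Let abE : a ^+ 2 + b ^+ 2 = sqnorm H2.
Proof. by rewrite !sqr_frobenius_norm; exact: sqnorm_orth_rows. Qed.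

Let SH : S *m H^T = 0. Proof. exact: orth_rows_mulmx. Qed.

Let err_le w : ~ singular_event G H w ->
  err w <= f + a * Num.sqrt tau + Num.sqrt (sqnorm (S *m G w *m D w)).
Proof.
move=> /eqP nw; have uw : H *m G w *m (H *m G w)^T \in unitmx by rewrite unitmxE unitfE.
by have := residual_le A VV Vk1 Vb1 uH uw; rewrite /D safe_pinv_unit// -frobenius_normE.
Qed.

Let mG := measurable_gaussian_matrix gG.

Lemma measurable_sketch_residual : measurable_fun [set: T] err.
Proof.
apply: measurable_residual; apply: measurable_mx_mul => //; exact: measurable_mx_cst.
Qed.

Let mD : measurable_mx D.
Proof.
by apply: measurable_safe_pinv; apply: measurable_mx_mul => //; exact: measurable_mx_cst.
Qed.

Let mSGD : measurable_fun [set: T] (fun w => sqnorm (S *m G w *m D w)).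
Proof.
apply: measurable_mx_sqnorm; apply: measurable_mx_mul => //.
by apply: measurable_mx_mul => //; exact: measurable_mx_cst.
Qed.

(* Cauchy-Schwarz *)
Let combine (x : R) : 0 <= x ->
  a + b * Num.sqrt x <= Num.sqrt (sqnorm H2 * (1 + x)).
Proof.
move=> x0; have s0 := sqrtr_ge0 x; rewrite -[leLHS]ger0_norm ?addr_ge0 ?mulr_ge0//.
rewrite -sqrtr_sqr ler_sqrt ?mulr_ge0 ?sqnorm_ge0 ?addr_ge0//.
rewrite -abE -[in leRHS](sqr_sqrtr x0); set y := Num.sqrt x.
have := sqr_ge0 (a * y - b); nra.
Qed.

Lemma integral_residual_le : (k + 2 <= l)%N ->
  (\int[P]_w (err w)%:E <=
    (f + Num.sqrt (sqnorm H2 * tau * ((l%:R - k%:R) / (l%:R - k%:R - 1))))%:E)%E.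
Proof.
move=> kl; have kl3 : (k.-1 + 3 <= l)%N by move: kl; rewrite -{1}(prednK k0) addSnnS.
pose p := (l - k - 2)%N; set x : R := p.+1%:R.
have x0 : 0 < x by [].
have lkE : l%:R - k%:R = x + 1 :> R.
  have -> : l = (p.+2 + k)%N by rewrite /p; lia.
  by rewrite natrD -[p.+2]addn1 natrD /x; ring.
rewrite lkE addrK.
have ED : (\int[P]_w (sqnorm (D w))%:E <= (tau / x)%:E)%E.
  under eq_integral do rewrite sqnorm_safe_pinv.
  by apply: (integral_trace_ridge_le gG uH k0 (lexx 0)); rewrite /p; lia.
have ES : (\int[P]_w (sqnorm (S *m G w *m D w))%:E <= (b ^+ 2 * (tau / x))%:E)%E.
  apply: le_trans (integral_sqnorm_orthogonal_le gG SH) _.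
  by rewrite EFinM sqr_frobenius_norm lee_wpmul2l// lee_fin sqnorm_ge0.
(* In place of Jensen for the square root: sqrt s <= (s / e + e) / 2 for every e > 0, which is
   linear in s and can be integrated directly. *)
have step (e : R) : 0 < e -> (\int[P]_w (err w)%:E <=
    (f + a * Num.sqrt tau + (b ^+ 2 * (tau / x) / e + e) / 2)%:E)%E.
  move=> e0; pose c := f + a * Num.sqrt tau + e / 2.
  have c0 : 0 <= c by rewrite !addr_ge0 ?mulr_ge0 ?sqrtr_ge0 ?invr_ge0 ?(ltW e0).
  have e20 : 0 <= (2 * e)^-1 by rewrite invr_ge0 mulr_ge0 ?(ltW e0).
  have mS : measurable_fun [set: T] (fun w => (sqnorm (S *m G w *m D w))%:E).
    exact/measurable_EFinP.
  have S0 w : (0 <= (sqnorm (S *m G w *m D w))%:E)%E by rewrite lee_fin sqnorm_ge0.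
  apply: (@le_trans _ _ (\int[P]_w (c%:E + ((2 * e)^-1)%:E * (sqnorm (S *m G w *m D w))%:E))%E).
    apply: ae_ge0_le_integral => //.
    - by move=> w _; rewrite lee_fin frobenius_norm_ge0.
    - exact/measurable_EFinP/measurable_sketch_residual.
    - by move=> w _; rewrite -EFinM -EFinD lee_fin addr_ge0// mulr_ge0 ?sqnorm_ge0.
    - by apply: emeasurable_funD => //; exact: emeasurable_funM.
    - exists (singular_event G H); split.
      + exact: (measurable_singular_event gG).
      + exact: (singular_event_null gG uH k0).
      + move=> w /=; apply: contra_notP => nw _.
        rewrite -EFinM -EFinD lee_fin; apply: le_trans (err_le nw) _.
        rewrite /c -[leRHS]addrA lerD2l.
        have s0 := sqnorm_ge0 (S *m G w *m D w).
        rewrite -[in leRHS](sqr_sqrtr s0); set y := Num.sqrt _.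
        rewrite -(ler_pM2l (mulr_gt0 (ltr0n R 2) e0)).
        have -> : 2 * e * (e / 2 + (2 * e)^-1 * y ^+ 2) = e ^+ 2 + y ^+ 2.
          by field; rewrite gt_eqF.
        have := sqr_ge0 (e - y); lra.
  rewrite ge0_integralDT; last 4 first.
  - by [].
  - by move=> w; rewrite lee_fin.
  - exact: emeasurable_funM.
  - by move=> w; rewrite -EFinM lee_fin mulr_ge0 ?sqnorm_ge0.
  rewrite integral_cst_probability (ge0_integralZT _ e20 mS S0).
  apply: le_trans (leeD2l _ (lee_wpmul2l _ ES)) _; first by rewrite lee_fin.
  rewrite -EFinM -EFinD lee_fin le_eqVlt; apply/orP; left; apply/eqP.
  by rewrite /c; field; rewrite !gt_eqF.
have I0 : (0 <= \int[P]_w (err w)%:E)%E.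
  by apply: integral_ge0 => w _; rewrite lee_fin frobenius_norm_ge0.
have IE : (\int[P]_w (err w)%:E = (fine (\int[P]_w (err w)%:E))%:E)%E.
  by rewrite fineK// ge0_fin_numE//; apply: le_lt_trans (step 1 ltr01) (ltry _).
rewrite IE in step *; rewrite lee_fin.
apply: (@le_trans _ _ (f + a * Num.sqrt tau + Num.sqrt (b ^+ 2 * (tau / x)))).
  set y := b ^+ 2 * _ in step *.
  have y0 : 0 <= y by exact: mulr_ge0 (sqr_ge0 _) (divr_ge0 (ltW tau0) (ltW x0)).
  apply/ler_addgt0Pr => e e0.
  (* The optimal parameter would be sqrt y; the added [e] keeps it positive when y = 0. *)
  have se0 : 0 < Num.sqrt y + e by rewrite ltr_wpDl ?sqrtr_ge0.
  have := step _ se0; rewrite lee_fin => /le_trans; apply.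
  rewrite -[leRHS]addrA lerD2l ler_pdivrMr// -lerBrDr ler_pdivrMr//.
  rewrite -{1}(sqr_sqrtr y0); have := sqrtr_ge0 y; nra.
rewrite -addrA lerD2l.
have xV0 : 0 <= x^-1 by rewrite invr_ge0 ltW.
have -> : sqnorm H2 * tau * ((x + 1) / x) = sqnorm H2 * (1 + x^-1) * tau.
  by field; rewrite gt_eqF.
rewrite (sqrtrM _ (mulr_ge0 (sqnorm_ge0 _) (addr_ge0 ler01 xV0))).
apply: le_trans (ler_wpM2r (sqrtr_ge0 tau) (combine xV0)).
rewrite mulrDl lerD2l sqrtrM ?sqr_ge0// sqrtr_sqr (ger0_norm b0).
by rewrite sqrtrM ?(ltW tau0)// mulrA mulrAC.
Qed.

Lemma residual_tail (u t : R) : (k + 4 <= l)%N -> 1 <= u -> 1 <= t ->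
  ((1 - expR (- (u ^+ 2 / 2)) - t ^- (l - k))%:E <=
    P [set w | (err w <= f + Num.sqrt 3 * (Num.sqrt (l%:R - k%:R + 1) + 1) *
        Num.sqrt (sqnorm H2 * tau / (l%:R - k%:R + 1)) * (u * t))%R])%E.
Proof.
move=> kl u1 t1; set B := [set w | _].
have kl3 : (k.-1 + 3 <= l)%N by apply: leq_trans kl; rewrite leq_add ?leq_pred.
have u0 : 0 < u by exact: lt_le_trans u1.
have t0 : 0 < t by exact: lt_le_trans t1.
set z : R := l%:R - k%:R + 1 in B *.
have z5 : 5 <= z.
  have kl' : (k <= l)%N by exact: leq_trans (leq_addr _ _) kl.
  by rewrite /z -natrB// natr1 ler_nat ltnS leq_subRL.
have z0 : 0 < z by lra.
set E1 := [set w | (4 * u ^+ 2 * (sqnorm S * sqnorm (D w)) < sqnorm (S *m G w *m D w))%R].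
set E2 := [set w | (13 / 2 * tau / z * t ^+ 2 < \tr (ridge_inv 0 (H *m G w)))%R].
have P1 : (P E1 <= (expR (- (u ^+ 2 / 2)))%:E)%E by exact: orthogonal_tail.
have P2' : (P E2 <= (t ^- (l - k))%:E)%E by exact: trace_gram_tail.
have P3 : P (singular_event G H) = 0%E by exact: (singular_event_null gG uH k0 kl3).
have mE1 : measurable E1.
  apply: measurable_set_ltr => //; apply: measurable_funM => //; apply: measurable_funM => //.
  exact: measurable_mx_sqnorm.
have mE2 : measurable E2.
  apply: measurable_set_ltr => //; apply: measurable_mx_trace; apply: measurable_ridge_inv.
  by apply: measurable_mx_mul => //; exact: measurable_mx_cst.
have mE3 := measurable_singular_event gG H.
set bd := (f + _) in B *.
have BC : ~` B = [set w | (bd < err w)%R].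
  by apply/seteqP; split => w /=; rewrite ltNge => /negP.
have mBC : measurable (~` B).
  by rewrite BC; apply: measurable_set_ltr => //; exact: measurable_sketch_residual.
(* Here 26 = 4 (13/2). After squaring and cancelling |H2|^2 tau / z, the claim is z + 26 <= 3 (sqrt
   z + 1)^2, which holds from z = 5 on, that is, for l >= k + 4. *)
have bdE : f + Num.sqrt (sqnorm H2 * (1 + 26 / z)) * Num.sqrt tau * (u * t) <= bd.
  rewrite lerD2l ler_wpM2r ?mulr_ge0 ?(ltW u0) ?(ltW t0)//.
  have h0 := sqnorm_ge0 H2; have y0 : 0 <= Num.sqrt z + 1 by rewrite addr_ge0 ?sqrtr_ge0.
  have q0 : 0 <= 26 / z by rewrite divr_ge0 ?(ltW z0).
  rewrite -(ger0_norm y0) -sqrtr_sqr -!sqrtrM ?mulr_ge0 ?sqr_ge0 ?addr_ge0//.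
  rewrite ler_sqrt; last by rewrite !mulr_ge0 ?sqr_ge0 ?invr_ge0 ?(ltW tau0) ?(ltW z0).
  have -> : sqnorm H2 * (1 + 26 / z) * tau = (z + 26) * (sqnorm H2 * tau / z).
    by field; rewrite gt_eqF.
  rewrite ler_wpM2r ?divr_ge0 ?mulr_ge0 ?(ltW tau0) ?(ltW z0)//.
  have yE := sqr_sqrtr (ltW z0); set y := Num.sqrt z in yE y0 *.
  have : 0 <= y by exact: sqrtr_ge0.
  by nra.
have BE : ~` B `<=` E1 `|` E2 `|` singular_event G H.
  move=> w; apply: contraPP => /not_orP[/not_orP[/negP + /negP +] nw].
  rewrite -!leNgt => h1 h2; apply; rewrite /B /=; apply: le_trans bdE.
  apply: le_trans (err_le nw) _; rewrite -addrA lerD2l.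
  have ut1 : 1 <= u * t by rewrite -[1]mulr1 ler_pM.
  have q0 : 0 <= 26 / z by rewrite divr_ge0 ?(ltW z0).
  have c0 : 0 <= b * Num.sqrt (26 / z) * Num.sqrt tau * (u * t).
    by rewrite !mulr_ge0 ?sqrtr_ge0 ?(ltW u0) ?(ltW t0).
  have hS : Num.sqrt (sqnorm (S *m G w *m D w)) <=
      b * Num.sqrt (26 / z) * Num.sqrt tau * (u * t).
    rewrite -(ger0_norm c0) -sqrtr_sqr ler_sqrt ?sqr_ge0//; apply: le_trans h1 _.
    rewrite !exprMn sqr_frobenius_norm !sqr_sqrtr ?(ltW tau0)// sqnorm_safe_pinv.
    have u20 : 0 <= 4 * u ^+ 2 by rewrite mulr_ge0 ?sqr_ge0.
    apply: le_trans (ler_wpM2l u20 (ler_wpM2l (sqnorm_ge0 S) h2)) _.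
    by rewrite le_eqVlt; apply/orP; left; apply/eqP; field; rewrite gt_eqF.
  (* The deterministic term carries neither u nor t; as u t >= 1 it may take the same factor, so
     that [combine] applies to the sum. *)
  apply: le_trans (lerD (_ : _ <= a * Num.sqrt tau * (u * t)) hS) _.
    by rewrite ler_peMr// mulr_ge0 ?sqrtr_ge0.
  rewrite -!mulrDl ler_wpM2r ?mulr_ge0 ?(ltW u0) ?(ltW t0)//.
  by rewrite ler_wpM2r ?sqrtr_ge0// combine.
have PBC : (P (~` B) <= (expR (- (u ^+ 2 / 2)) + t ^- (l - k))%:E)%E.
  have mE12 : measurable (E1 `|` E2) by exact: measurableU.
  apply: le_trans (le_measure P _ _ BE) _; rewrite ?inE//; first exact: measurableU.
  apply: (@le_trans _ _ (P (E1 `|` E2) + P (singular_event G H))%E).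
    exact: measureU2.
  rewrite P3 adde0; apply: (@le_trans _ _ (P E1 + P E2)%E); first exact: measureU2.
  by rewrite EFinD leeD.
rewrite -[B]setCK probability_setC// -addrA -opprD EFinB.
exact: leeB.
Qed.

End residual_estimates.

Theorem corollary4p3 (R : realType) (d : measure_display)
    (T : measurableType d) (P : probability T R) (m n r l k : nat)
    (A : 'M[R]_(m, n)) (U : 'M[R]_m) (S : 'M[R]_(m, n)) (V : 'M[R]_n)
    (k_gt0 : (1 <= k)%N) (km : (k <= m)%N) (kn : (k <= n)%N)
    (svdA : is_svd A U S V)
    (L : 'M[R]_(n, r)) (rankLV : \rank (L^T *m lead_cols kn V) = k)
    (G : T -> 'M[R]_(r, l)) (gaussG : standard_gaussian_matrix P G)
    (l_le : (l <= minn (\rank A) (\rank L) <= r)%N) :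
  let Vk := lead_cols kn V in
  let Vbar := tail_cols kn V in
  let Sbar := tail_block km kn S in
  let C := L *m L^T in
  let beta := beta_coef Sbar Vbar C in
  let gamma := gamma_coef Vk C in
  let Z := fun w : T => A *m L *m G w in
  let err := fun w : T => frobenius_norm ((1%:M - range_proj (Z w)) *m A) in
  ((k + 2 <= l)%N ->
    ('E_P[err] <=
      ((1 + Num.sqrt (l%:R - k%:R)
            * Num.sqrt (k%:R / (l%:R - k%:R - 1) * (beta / gamma)))
       * frobenius_norm Sbar)%:E)%E) /\
  ((k + 4 <= l)%N -> forall u t : R, 1 <= u -> 1 <= t ->
    ((1 - expR (- (u ^+ 2 / 2)) - t ^- (l - k))%:E <=
      P [set w | (err w <=
        (1 + Num.sqrt 3 * (Num.sqrt (l%:R - k%:R + 1) + 1)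
             * Num.sqrt (k%:R / (l%:R - k%:R + 1) * (beta / gamma))
             * (u * t))
        * frobenius_norm Sbar)%R])%E).
Proof.
move=> Vk Vbar Sbar C beta gamma Z err.
have [_ _ [VtV VVt] _ _] := svdA.
have VV : Vk *m Vk^T + Vbar *m Vbar^T = 1%:M by exact: lead_tail_cols_mul.
have Vk1 : Vk^T *m Vk = 1%:M by exact: lead_cols_orthonormal.
have Vb1 : Vbar^T *m Vbar = 1%:M by exact: tail_cols_orthonormal.
set H := Vk^T *m L; set F := frobenius_norm Sbar.
have uH : H *m H^T \in unitmx.
  apply: gram_unitmx; rewrite /row_free -mxrank_tr trmx_mul trmxK; exact/eqP.
have HE : Vk^T *m C *m Vk = H *m H^T by rewrite trmx_mul trmxK !mulmxA.
(* Positivity is what allows [largest_eigenvalue C] to be cancelled between [beta] and [gamma];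
   [L = 0] is excluded by the rank condition and k >= 1. *)
have lam0 : 0 < largest_eigenvalue C.
  apply: largest_eigenvalue_gram_gt0; apply/eqP => L0; move: rankLV k_gt0.
  by rewrite L0 trmx0 mul0mx mxrank0 => <-.
have gramS := svd_tail_gram km kn svdA; rewrite -/Vbar -/Sbar in gramS.
have fE : frobenius_norm (A *m Vbar) = F.
  rewrite /F !frobenius_normE -[A *m Vbar]mulmx1 (sqnorm_mulmx_gram _ gramS).
  by rewrite mulmx1.
set h := sqnorm (A *m Vbar *m Vbar^T *m L).
have hS : h = sqnorm (Sbar *m (Vbar^T *m L)).
  by rewrite /h -(mulmxA (A *m Vbar)) (sqnorm_mulmx_gram _ gramS).
have hE : \tr (Sbar^T *m Sbar *m Vbar^T *m C *m Vbar) = h.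
  rewrite hS sqnorm_tr !trmx_mul trmxK [RHS]mxtrace_mulC -[in RHS]mulmxA mxtrace_mulC.
  by rewrite !mulmxA.
pose tau := \tr (invmx (H *m H^T)).
have tau0 : 0 < tau by exact: trace_gram_inv_gt0.
(* [k], the largest eigenvalue and [F] cancel, leaving the quantity of the two residual estimates.
   If [F = 0] then [beta] is a division by zero, but [Sbar = 0] and both sides vanish. *)
have key (q : R) : 0 < q ->
    Num.sqrt (k%:R / q * (beta / gamma)) * F = Num.sqrt (h * tau / q).
  move=> q0; have F0 : 0 <= F := frobenius_norm_ge0 _.
  have [Fz|Fn0] := eqVneq F 0.
    have Sz : Sbar = 0 by apply: sqnorm_eq0; rewrite -sqr_frobenius_norm -/F Fz expr0n.
    by rewrite Fz hS Sz mul0mx sqnorm0 !mul0r sqrtr0 mulr0.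
  rewrite -{1}(ger0_norm F0) -sqrtr_sqr -sqrtrM.
    congr Num.sqrt; rewrite /beta /gamma /beta_coef /gamma_coef hE HE -/tau -/F; field.
    by rewrite Fn0 !gt_eqF// ltr0n.
  rewrite /beta /gamma /beta_coef /gamma_coef hE HE -/tau -/F.
  have h0 : 0 <= h := sqnorm_ge0 _.
  do ?[apply: mulr_ge0 | rewrite invr_ge0] => //; exact: ltW.
split=> [kl|kl u t u1 t1].
  have z1 : 0 < l%:R - k%:R - 1 :> R.
    by rewrite -addrA -opprD natr1 subr_gt0 ltr_nat (leq_trans _ kl)// addn2.
  rewrite unlock; apply: le_trans (integral_residual_le A VV Vk1 Vb1 uH k_gt0 gaussG kl) _.
  rewrite fE -/h -/tau lee_fin [in leRHS]mulrDl mul1r lerD2l -[in leRHS]mulrA key// -sqrtrM; last by lra.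
  by rewrite le_eqVlt; apply/orP; left; apply/eqP; congr Num.sqrt; rewrite mulrCA mulrA.
have z1 : 0 < l%:R - k%:R + 1 :> R.
  by rewrite ltr_wpDl// subr_ge0 ler_nat (leq_trans _ kl)// leq_addr.
have := residual_tail A VV Vk1 Vb1 uH k_gt0 gaussG kl u1 t1.
rewrite fE -/h -/tau -key// => /le_trans; apply; rewrite le_eqVlt; apply/orP; left; apply/eqP.
congr (P _); apply/seteqP; split => w /=; rewrite -/H -/F.
  by congr (_ <= _); ring.
by congr (_ <= _); ring.
Qed.
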